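(* Let $T$ be a Calderón-Zygmund operator on $\mathbb R^d$ of convolution type or, more generally, let $T$ be a Calderón-Zygmund operator with $T(1)=T^*(1)=0$. Then $T$ maps $C_0(\mathbb R^d)$ to $\mathit{CMO}(\mathbb R^d)$.
   Context: A Calderón-Zygmund kernel is a locally integrable function $K$ on $\mathbb R^{2d}\setminus\Delta$, $\Delta=\{(x,y)\in\mathbb R^{2d}: x=y\}$, such that for some $C>0$ and $\delta\in(0,1]$: $|K(x,y)|\le C|x-y|^{-d}$ for all $x\neq y$, and $|K(x,y)-K(x',y)|+|K(y,x)-K(y,x')|\le C\frac{|x-x'|^\delta}{|x-y|^{d+\delta}}$ whenever $|x-x'|<\frac12|x-y|$. A Calderón-Zygmund operator is a continuous linear map $T:\mathcal S(\mathbb R^d)\to\mathcal S'(\mathbb R^d)$ whose distributional kernel coincides away from $\Delta$ with a Calderón-Zygmund kernel $K$, so that $T(f)(x)=\int K(x,y)f(y)\,dy$ for $x\notin\operatorname{supp}f$, and which extends to a bounded operator on $L^{p_0}(\mathbb R^d)$ for some $1<p_0<\infty$ (equivalently, it is bounded on $L^p$ for all $1<p<\infty$). Its transpose $T^*$ is given by $\langle T^*f,g\rangle=\langle Tg,f\rangle$ and has kernel $K(y,x)$. $T$ is of convolution type if $K(x,y)=k(x-y)$, with $Tf=k*f$ in the distributional sense. $\mathit{BMO}(\mathbb R^d)$ is the space of $f\in L^1_{\rm loc}(\mathbb R^d)$, modulo additive constants, with $\|f\|_{\mathit{BMO}}=\sup_Q\frac1{|Q|}\int_Q|f(x)-\operatorname{ave}_Qf|\,dx<\infty$,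 where the supremum is over all cubes $Q$ with sides parallel to the axes and $\operatorname{ave}_Qf=\frac1{|Q|}\int_Qf$. $\mathit{CMO}(\mathbb R^d)$ is the closure of $C_c^\infty(\mathbb R^d)$ in $\mathit{BMO}(\mathbb R^d)$. $C_0(\mathbb R^d)$ is the space of continuous functions vanishing at infinity. A Calderón-Zygmund operator is bounded from $L^\infty$ to $\mathit{BMO}$, where for $f\in L^\infty$ the element $T(f)\in\mathit{BMO}$ is defined in the standard way: for $g\in C_c^\infty$ with $\int g=0$ and $\operatorname{supp}g\subset B=B_{x_B}(\rho)$, $\langle T(f),g\rangle=\int T(f\mathbf 1_{4B})\,g\,dx+\int\int_{\mathbb R^d\setminus4B}(K(x,y)-K(x_B,y))f(y)\,dy\,g(x)\,dx$, where $4B=B_{x_B}(4\rho)$. $T(1)$ is the element of $\mathit{BMO}$ defined by $\langle T(1),g\rangle=\lim_{R\to\infty}\langle T(\phi_R),g\rangle$ for $g\in C_c^\infty(\mathbb R^d)$ with $\int g=0$, where $\phi_R(x)=\phi(R^{-1}x)$ and $\phi\in C_c^\infty$ satisfies $0\le\phi\le1$, $\phi(x)=1$ for $|x|\le\frac12$, $\operatorname{supp}\phi\subset B_0(1)$; similarly for $T^*(1)$. $T(1)=0$ means equality in $\mathit{BMO}$, i.e. modulo constants. For operators of convolution type, $T(1)=T^*(1)=0$ holds automatically. *)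

(* Defs.v *)
From HB Require Import structures.
From mathcomp Require Import all_boot all_order all_algebra.
From mathcomp Require Import all_classical all_reals all_analysis.
From mathcomp Require Import complex.

Set Implicit Arguments.
Unset Strict Implicit.
Unset Printing Implicit Defensive.

Import Order.TTheory GRing.Theory Num.Theory.
Import numFieldNormedType.Exports.
Import Normc.

Local Open Scope classical_set_scope.
Local Open Scope complex_scope.
Local Open Scope ring_scope.

(* All functions and distributions are complex valued.  The library has no
   topology or integral on R[i], so the modulus used is [normc : R[i] -> R] and
   analytic notions are taken on real and imaginary parts.

   R^n is 'rV[R]_n.  Its library norm is the max norm, which gives the right
   topology, but every norm, ball and decay condition below uses the Euclidean
   norm [enorm]. *)

Section measurable_rV.
Context {R : realType} (n : nat).

Let coors : 'I_n -> 'rV[R]_n -> R := fun i x => x 0 i.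

Let rV_set0 : g_sigma_preimage coors set0.
Proof. exact: sigma_algebra0. Qed.

Let rV_setC A : g_sigma_preimage coors A -> g_sigma_preimage coors (~` A).
Proof. exact: sigma_algebraC. Qed.

Let rV_bigcup (F : _^nat) : (forall i, g_sigma_preimage coors (F i)) ->
  g_sigma_preimage coors (\bigcup_i (F i)).
Proof. exact: sigma_algebra_bigcup. Qed.

HB.instance Definition _ := @isMeasurable.Build default_measure_display
  'rV[R]_n (g_sigma_preimage coors) rV_set0 rV_setC rV_bigcup.

End measurable_rV.

Section measurable_coordinates.
Context {R : realType}.

Lemma measurable_rV_coord n (i : 'I_n) :
  measurable_fun [set: 'rV[R]_n] (fun x : 'rV[R]_n => x 0 i).
Proof.
move=> _ Y mY; rewrite setTI; apply: sub_sigma_algebra => /=.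
rewrite -bigcup_seq/=; exists i => /=; first by rewrite mem_index_enum.
by exists Y => //; rewrite setTI.
Qed.

Lemma measurable_fun_rVP d (T : measurableType d) n (f : T -> 'rV[R]_n) :
  (forall i, measurable_fun setT (fun t => f t 0 i)) -> measurable_fun setT f.
Proof.
move=> mf _ A mA.
suff H : g_sigma_preimage (fun (i : 'I_n) (x : 'rV[R]_n) => x 0 i) `<=`
    [set B | measurable (f @^-1` B)] by rewrite setTI; exact: H.
apply: smallest_sub.
  split => /=; first by rewrite preimage_set0.
    move=> B mB; rewrite setTD preimage_setC; exact: measurableC.
  by move=> F mF; rewrite preimage_bigcup; exact: bigcup_measurable.
rewrite -bigcup_seq; apply: bigcup_sub => i _ B /= [D mD <-].
by rewrite setTI -comp_preimage -[X in measurable X]setTI; exact: mf.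
Qed.

Definition rV_cons n (p : R * 'rV[R]_n) : 'rV[R]_n.+1 :=
  row_mx (const_mx p.1 : 'rV_1) p.2.

Definition rV_uncons n (x : 'rV[R]_n.+1) : R * 'rV[R]_n :=
  (x 0 0, rsubmx (x : 'rV_(1 + n))).

Lemma rV_uncons_consK n : cancel (@rV_cons n) (@rV_uncons n).
Proof.
move=> [t x]; rewrite /rV_uncons /rV_cons row_mxKr; congr pair.
rewrite mxE; case: splitP => j /=; last by rewrite add1n.
by rewrite mxE.
Qed.

Lemma measurable_rV_cons n : measurable_fun setT (@rV_cons n).
Proof.
apply: measurable_fun_rVP => i; rewrite /rV_cons.
under eq_fun do rewrite mxE.
case: splitP => j _.
  by under eq_fun do rewrite mxE; exact: measurable_fst.
exact: (measurableT_comp (measurable_rV_coord j) measurable_snd).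
Qed.

Lemma measurable_rV_uncons n : measurable_fun setT (@rV_uncons n).
Proof.
apply/measurable_fun_pairP; split; first exact: measurable_rV_coord.
apply: measurable_fun_rVP => i.
rewrite (_ : (fun _ => _) = fun x : 'rV[R]_n.+1 => x 0 (rshift 1 i)).
  exact: measurable_rV_coord.
by apply/funext => x /=; rewrite mxE.
Qed.

End measurable_coordinates.

Section lebesgue_step.
Context {R : realType} (n : nat).
Variable m : {sigma_finite_measure set 'rV[R]_n -> \bar R}.

Definition lebesgue_step : set 'rV[R]_n.+1 -> \bar R :=
  pushforward ((@lebesgue_measure R) \x m)%E (@rV_cons R n).

Let step_pushforward : {measure set 'rV[R]_n.+1 -> \bar R} :=
  measure_function_pushforward__canonical__measure_function_Measure
    ((@lebesgue_measure R) \x m)%E (@measurable_rV_cons R n).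

Let lebesgue_step0 : (lebesgue_step set0 = 0)%E.
Proof. exact: (measure0 step_pushforward). Qed.

Let lebesgue_step_ge0 A : (0 <= lebesgue_step A)%E.
Proof. exact: (measure_ge0 step_pushforward). Qed.

Let lebesgue_step_sigma_additive : semi_sigma_additive lebesgue_step.
Proof. exact: (@measure_semi_sigma_additive _ _ _ step_pushforward). Qed.

HB.instance Definition _ := isMeasure.Build _ _ _ lebesgue_step
  lebesgue_step0 lebesgue_step_ge0 lebesgue_step_sigma_additive.

Let lebesgue_step_sigma_finite : sigma_finite setT lebesgue_step.
Proof.
have /sigma_finiteP[F [FT ndF Foo]] := sigma_finiteT (@lebesgue_measure R).
have /sigma_finiteP[G [GT ndG Goo]] := sigma_finiteT m.
exists (fun k => @rV_uncons R n @^-1` (F k `*` G k)).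
  rewrite -preimage_bigcup (_ : \bigcup_k (F k `*` G k) = setT)//.
  rewrite -subTset => -[x y] _.
  have [i _ Fix] : (\bigcup_k F k) x by rewrite -FT.
  have [j _ Gjy] : (\bigcup_k G k) y by rewrite -GT.
  exists (maxn i j) => //; split.
    by move: x Fix; exact/subsetPset/ndF/leq_maxl.
  by move: y Gjy; exact/subsetPset/ndG/leq_maxr.
move=> k; have [mF Fk] := Foo k; have [mG Gk] := Goo k; split.
  rewrite -[X in measurable X]setTI.
  by apply: measurable_rV_uncons => //; exact: measurableX.
rewrite /lebesgue_step /pushforward -comp_preimage.
rewrite (_ : _ \o _ = id); last by apply/funext => x /=; rewrite rV_uncons_consK.
by rewrite preimage_id product_measure1E// lte_mul_pinfty// ge0_fin_numE.
Qed.

HB.instance Definition _ :=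
  Measure_isSigmaFinite.Build _ _ _ lebesgue_step lebesgue_step_sigma_finite.

End lebesgue_step.

Fixpoint lebesgue_rV {R : realType} (n : nat) :
    {sigma_finite_measure set 'rV[R]_n -> \bar R} :=
  if n is k.+1 then lebesgue_step (lebesgue_rV k) else dirac (0 : 'rV[R]_0).

Section complex_functions.
Context {R : realType}.
Local Notation C := R[i].

Definition cmeasurable d (X : measurableType d) (D : set X) (f : X -> C) :=
  measurable_fun D (fun x => complex.Re (f x)) /\
  measurable_fun D (fun x => complex.Im (f x)).

Definition cintegral d (X : measurableType d) (mu : set X -> \bar R)
    (D : set X) (f : X -> C) : C :=
  (fine (\int[mu]_(x in D) (complex.Re (f x))%:E)) +i*
  (fine (\int[mu]_(x in D) (complex.Im (f x))%:E)).

Definition ccvg (I : Type) (F : set_system I) (u : I -> C) (l : C) :=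
  (fun j => normc (u j - l)) @ F --> (0 : R).

Definition ccontinuous (X : topologicalType) (f : X -> C) :=
  continuous (fun x => complex.Re (f x)) /\
  continuous (fun x => complex.Im (f x)).

Definition csupp (X : topologicalType) (f : X -> C) : set X :=
  closure [set x | f x != 0].

End complex_functions.

Section euclidean_space.
Context {R : realType} {n : nat}.
Local Notation C := R[i].
Local Notation E := 'rV[R]_n.
Local Notation mu := (@lebesgue_rV R n).
Implicit Types (f g : E -> C) (x y : E).

Definition enorm x : R := Num.sqrt (\sum_i x 0 i ^+ 2).

Definition eball x (r : R) : set E := [set y | enorm (y - x) < r].

Definition in_Lp (p : R) f :=
  cmeasurable setT f /\ (Lnorm mu p%:E (fun x => (normc (f x))%:E) < +oo)%E.

Fixpoint iter_partial (s : seq 'I_n) (u : E -> R) : E -> R :=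
  if s is i :: s' then fun x => 'D_(delta_mx 0 i) (iter_partial s' u) x else u.

Definition smooth (u : E -> R) :=
  forall s, continuous (iter_partial s u) /\
            forall i x, derivable (iter_partial s u) x (delta_mx 0 i).

Definition csmooth f :=
  smooth (fun x => complex.Re (f x)) /\ smooth (fun x => complex.Im (f x)).

Definition citer_partial (s : seq 'I_n) f x : C :=
  iter_partial s (fun y => complex.Re (f y)) x +i*
  iter_partial s (fun y => complex.Im (f y)) x.

Definition test f := csmooth f /\ compact (csupp f).

Definition test0 g := test g /\ cintegral mu setT g = 0.

Definition schwartz_seminorm (N : nat) f : \bar R :=
  ereal_sup [set ((1 + enorm z.2) ^+ N * normc (citer_partial z.1 f z.2))%:E
            | z in [set z : seq 'I_n * E | (size z.1 <= N)%N]].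

Definition schwartz f :=
  csmooth f /\ forall N, (schwartz_seminorm N f < +oo)%E.

(* Functionals are total on E -> C; only their values on Schwartz functions
   are meaningful.  The seminorms increase with N, so a linear functional is
   continuous on S iff it is bounded by a multiple of one of them. *)
Definition slinear (u : (E -> C) -> C) :=
  forall (a : C) f g, schwartz f -> schwartz g ->
    u (fun x => a * f x + g x) = a * u f + u g.

Definition scontinuous (u : (E -> C) -> C) :=
  exists N (A : R), forall f, schwartz f ->
    ((normc (u f))%:E <= A%:E * schwartz_seminorm N f)%E.

Definition tempered (u : (E -> C) -> C) := slinear u /\ scontinuous u.

End euclidean_space.

Section calderon_zygmund.
Context {R : realType} {d : nat}.
Local Notation C := R[i].
Local Notation E := 'rV[R]_d.
Local Notation mu := (@lebesgue_rV R d).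
Implicit Types (T : (E -> C) -> (E -> C) -> C) (K : E -> E -> C)
  (Tp : (E -> C) -> (E -> C)) (f g b : E -> C).

Definition diagonal : set (E * E) := [set z | z.1 = z.2].

Definition cz_kernel K :=
  [/\ cmeasurable (~` diagonal) (fun z : E * E => K z.1 z.2),
      (forall A : set (E * E), compact A -> A `<=` ~` diagonal ->
         (\int[mu \x mu]_(z in A) (normc (K z.1 z.2))%:E < +oo)%E) &
      exists (A delta : R),
        [/\ 0 < A, 0 < delta <= 1,
            (forall x y, x != y -> normc (K x y) <= A / enorm (x - y) ^+ d) &
            forall x x' y, enorm (x - x') < 2^-1 * enorm (x - y) ->
              normc (K x y - K x' y) + normc (K y x - K y x') <=
              A * (enorm (x - x') `^ delta / enorm (x - y) `^ (d%:R + delta))]].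

(* A linear map T : S -> S' is represented by the pairing T f g = <T f, g>;
   continuity is for the weak-* topology of S' *)
Definition continuous_linear_SS' T :=
  [/\ (forall f, schwartz f -> tempered (T f)),
      (forall g, schwartz g -> slinear (T^~ g)) &
      (forall g, schwartz g -> scontinuous (T^~ g))].

Definition transpose T : (E -> C) -> (E -> C) -> C := fun f g => T g f.

(* The Schwartz kernel of T: a distribution KT in S'(R^d x R^d) with
   <T f, g> = <KT, g(x) f(y)>; points (x, y) are written row_mx x y. *)
Definition distributional_kernel T (KT : ('rV[R]_(d + d) -> C) -> C) :=
  tempered KT /\
  forall f g, schwartz f -> schwartz g ->
    T f g = KT (fun z => g (lsubmx z) * f (rsubmx z)).

Definition agrees_off_diagonal (KT : ('rV[R]_(d + d) -> C) -> C) K :=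
  forall Phi : 'rV[R]_(d + d) -> C, test Phi ->
    csupp Phi `<=` [set z | lsubmx z != rsubmx z] ->
    KT Phi = cintegral (mu \x mu)%E setT
               (fun z : E * E => K z.1 z.2 * Phi (row_mx z.1 z.2)).

Definition bounded_Lp (p : R) Tp :=
  [/\ (forall f, in_Lp p f -> in_Lp p (Tp f)),
      (forall (a : C) f g, in_Lp p f -> in_Lp p g ->
         {ae mu, forall x, Tp (fun y => a * f y + g y) x = a * Tp f x + Tp g x}) &
      exists A : R, forall f, in_Lp p f ->
        (Lnorm mu p%:E (fun x => (normc (Tp f x))%:E) <=
         A%:E * Lnorm mu p%:E (fun x => (normc (f x))%:E))%E].

Definition extends T Tp :=
  forall f g, schwartz f -> schwartz g ->
    T f g = cintegral mu setT (fun x => Tp f x * g x).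

(* T is a Calderon-Zygmund operator with kernel K, and Tp is its bounded
   extension to L^p *)
Definition cz_operator T K (p : R) Tp :=
  [/\ continuous_linear_SS' T,
      cz_kernel K,
      (exists KT, distributional_kernel T KT /\ agrees_off_diagonal KT K),
      1 < p &
      bounded_Lp p Tp /\ extends T Tp].

(* T f = k * f, where the tempered distribution kdist is the function k away
   from 0 and <kdist * f, g> = <kdist, z |-> \int f(x - z) g(x) dx> *)
Definition convolution_type T K :=
  exists (k : E -> C) (kdist : (E -> C) -> C),
    [/\ (forall x y, x != y -> K x y = k (x - y)),
        tempered kdist,
        (forall phi, test phi -> ~ csupp phi 0 ->
           kdist phi = cintegral mu setT (fun x => k x * phi x)) &
        forall f g, schwartz f -> schwartz g ->
          T f g = kdist (fun z => cintegral mu setT (fun x => f (x - z) * g x))].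

Definition locally_integrable_fun b :=
  cmeasurable setT b /\
  forall A : set E, compact A -> (\int[mu]_(x in A) (normc (b x))%:E < +oo)%E.

Definition cube (a : E) (l : R) : set E :=
  [set x | forall i, a 0 i <= x 0 i <= a 0 i + l].

Definition ave (Q : set E) b : C := ((fine (mu Q))^-1)%:C * cintegral mu Q b.

Definition bmo_norm b : \bar R :=
  ereal_sup [set (((fine (mu (cube z.1 z.2)))^-1)%:E *
      \int[mu]_(x in cube z.1 z.2) (normc (b x - ave (cube z.1 z.2) b))%:E)%E
    | z in [set z : E * R | 0 < z.2]].

(* Elements of BMO are represented by functions, equal modulo constants. *)
Definition BMO b := locally_integrable_fun b /\ (bmo_norm b < +oo)%E.

Definition CMO b :=
  BMO b /\ forall e : R, 0 < e ->
    exists2 phi : E -> C, test phi & (bmo_norm (fun x => b x - phi x)%R < e%:E)%E.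

Definition C0 f :=
  ccontinuous f /\
  forall e : R, 0 < e -> exists r : R, forall x, r < enorm x -> normc (f x) < e.

Definition restr (D : set E) f : E -> C := fun x => if x \in D then f x else 0.

(* <T(f), g> for f in L^oo and g a test function of integral 0 supported in
   the ball B_xB(rho) *)
Definition bmo_pairing Tp K f (xB : E) (rho : R) g : C :=
  cintegral mu setT (fun x => Tp (restr (eball xB (4 * rho)) f) x * g x) +
  cintegral mu setT (fun x =>
    cintegral mu (~` eball xB (4 * rho)) (fun y => (K x y - K xB y) * f y) * g x).

(* T(f) = b modulo constants *)
Definition bmo_image Tp K f b :=
  forall g xB (rho : R), 0 < rho -> test0 g -> csupp g `<=` eball xB rho ->
    bmo_pairing Tp K f xB rho g = cintegral mu setT (fun x => b x * g x).

Definition cutoff (phi : E -> R) :=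
  let phiC x := (phi x)%:C in
  [/\ test phiC, (forall x, 0 <= phi x <= 1),
      (forall x, enorm x <= 2^-1 -> phi x = 1) & csupp phiC `<=` eball 0 1].

(* T(1) = b modulo constants, with T(1) computed from the cutoff phi *)
Definition bmo_image_one T (phi : E -> R) b :=
  forall g, test0 g ->
    ccvg (pinfty_nbhs R) (fun r : R => T (fun x => (phi (r^-1 *: x))%:C) g)
      (cintegral mu setT (fun x => b x * g x)).

Definition one_to_zero T :=
  exists2 phi : E -> R, cutoff phi & bmo_image_one T phi (fun=> 0).

End calderon_zygmund.

(* Main.v *)
From Pilot Require Import Defs.
From HB Require Import structures.
From mathcomp Require Import all_boot all_order all_algebra.
From mathcomp Require Import all_classical all_reals all_analysis.
From mathcomp Require Import complex measurable_realfun.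
From mathcomp Require Import ring lra zify.
Set Implicit Arguments.
Unset Strict Implicit.
Unset Printing Implicit Defensive.
Import Order.TTheory GRing.Theory Num.Theory.
Import numFieldNormedType.Exports.
Import Normc.
Local Open Scope classical_set_scope.
Local Open Scope complex_scope.
Local Open Scope ring_scope.

(** The image [T f] of a bounded function [f] is only defined modulo constants and ball by ball: on a
ball [B = B(x0, r)] it is [T (f 1_4B)], handled by the [L^p] bound, plus the far part
[\int_(~4B) (K x y - K x0 y) f y dy], handled by the smoothness of the kernel
([local_image], [far]).  Comparing two balls ([local_image_change]) shows that these local
representatives differ by constants, so they glue to one function [b] ([global_image]).  Both pieces
have mean oscillation at most a constant times [sup |f|], which is the bound from [L^oo] to [BMO];
it is proved for differences in [osc_image].  Since test functions are uniformly dense in [C_0]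
([C0_approx]), it remains to approximate [T f] in [BMO] by test functions when [f] itself is a test
function, and uniform approximation almost everywhere is enough.

For a test function [f] the condition [T 1 = 0] gives an oscillation estimate that is uniform in the
ball: if [g] has integral zero and is supported in [B(x0, r)], then [<T f, g> = <T (f - f x0), g>],
and [|f y - f x0| <= C |y - x0|^alpha] with [alpha = delta / 2].  The part of [f - f x0] near
[B(x0, r)] is of size [r^alpha] and is controlled by the [L^p] bound; the part away from it is
controlled by the smoothness of [K], the integral zero of [g] and the convergence of
[\int_(|y| > r) |y|^(- d - (delta - alpha)) dy].  The result is
[|<T f, g>| <= C r^alpha r^d sup |g|] ([near_part], [far_part], [test_oscillation]).

Applied to the difference of two mollifiers centred at the same point, this says that the
mollifications of [T f] at the scales [2^-k] form a geometric sequence for the uniform norm.  Hence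
they converge uniformly, and the limit is [T f] almost everywhere ([moll_limit]).  Every one of them
is smooth, and it tends to zero at infinity because [f] has compact support and the kernel decays
([moll_decay]).  So it belongs to [C_0] and is uniformly close to a test function
([test_image_approx]).

For an operator of convolution type with kernel [k (x - y)], the condition [T 1 = 0] is derived from
the kernel ([convolution_one_to_zero]): for a cutoff [phi_R] and [g] of integral zero, the function
[z |-> \int phi_R (x - z) g x dx] vanishes for [|z| < R / 8], is [O(1/R)], and is supported where
[|z|] is at most a multiple of [R]; since [|k z| <= A / |z|^d], its integral against [k] is
[O(1/R)].

The identity between [T] and its kernel is only given for test functions, on the product space and
away from the diagonal.  It is turned into a pointwise formula almost everywhere for bounded
functions of bounded support by approximation ([kernel_rep], [off_support_rep]). *)

(** * Euclidean balls and Lebesgue measure on R^n *)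

Section euclid.
Context {R : realType} {n : nat}.
Local Notation E := 'rV[R]_n.
Implicit Types x y : E.
Lemma norm_rV_leP x (r : R) : 0 <= r -> (`|x| <= r <-> forall i, `|x 0 i| <= r).
Proof.
move=> r0; have -> : `|x| = mx_norm x by []; rewrite mx_normrE; split=> [h i|h].
  by apply: le_trans h; apply: (le_bigmax 0 (fun ij : 'I_1 * 'I_n => `|x ij.1 ij.2|) (0, i)).
by apply: bigmax_le => // -[a j] _ /=; rewrite (ord1 a); exact: h.
Qed.

Lemma coord_le_norm x i : `|x 0 i| <= `|x|.
Proof. by move: i; apply/norm_rV_leP. Qed.

Lemma enorm_ge0 x : 0 <= enorm x.
Proof. exact: sqrtr_ge0. Qed.

(** The max norm governs the topology and the supports, the Euclidean norm the kernel estimates;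
this bound and the next one pass between them. *)
Lemma norm_le_enorm x : `|x| <= enorm x.
Proof.
apply/norm_rV_leP => [|i]; first exact: enorm_ge0.
rewrite -sqrtr_sqr ler_sqrt ?sumr_ge0// => [|j _]; last exact: sqr_ge0.
by rewrite (bigD1 i)//= lerDl sumr_ge0// => j _; exact: sqr_ge0.
Qed.

Lemma enorm_le x : enorm x <= n%:R * `|x|.
Proof.
have h : \sum_i x 0 i ^+ 2 <= n%:R * `|x| ^+ 2.
  apply: (@le_trans _ _ (\sum_(i < n) `|x| ^+ 2)).
    apply: ler_sum => i _; rewrite -normr_id -[leLHS]real_normK ?num_real//.
    by rewrite lerXn2r ?nnegrE ?normr_id// coord_le_norm.
  by rewrite sumr_const card_ord mulr_natl.
suff : \sum_i x 0 i ^+ 2 <= (n%:R * `|x|) ^+ 2.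
  move=> /(ler_wsqrtr); rewrite sqrtr_sqr [X in _ <= X -> _]ger0_norm ?mulr_ge0//.
apply: (le_trans h); rewrite exprMn ler_wpM2r ?sqr_ge0// -natrX ler_nat.
by case: (n) => // m; rewrite (@leq_pexp2l m.+1 1 2).
Qed.

Lemma enormN x : enorm (- x) = enorm x.
Proof. by rewrite /enorm; congr Num.sqrt; apply: eq_bigr => i _; rewrite mxE sqrrN. Qed.

Lemma enormC x y : enorm (x - y) = enorm (y - x).
Proof. by rewrite -enormN opprB. Qed.

Lemma enorm0 : enorm (0 : E) = 0.
Proof. by rewrite /enorm big1 ?sqrtr0// => i _; rewrite mxE expr0n. Qed.

Lemma enorm_gt0 x : x != 0 -> 0 < enorm x.
Proof. by move=> x0; apply: lt_le_trans (norm_le_enorm x); rewrite normr_gt0. Qed.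

Lemma continuous_enorm : continuous (@enorm R n).
Proof.
move=> x; rewrite /enorm.
apply: (@continuous_comp _ _ _ (fun x : E => \sum_i x 0 i ^+ 2) Num.sqrt); last exact: sqrt_continuous.
move: x; apply: (@continuous_big _ _ _ _ _ _ _ _ (fun i (x : E) => x 0 i ^+ 2)) => [|i _ x]; first exact: add_continuous.
by apply: (@continuous_comp _ _ _ (fun x : E => x 0 i) (fun t : R => t ^+ 2)); [exact: coord_continuous|exact: exprn_continuous].
Qed.

Lemma continuous_addv (v : E) : continuous (fun x => x + v).
Proof. by move=> x; apply: (@cvgD _ _ _ (nbhs x) _ id (fun=> v)); [exact: cvg_id|exact: cvg_cst]. Qed.

Lemma open_eball x (r : R) : open (eball x r).
Proof.
have -> : eball x r = (fun y => enorm (y - x)) @^-1` [set t | t < r] by [].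
apply: open_comp; last exact: open_lt.
move=> y _; apply: (@continuous_comp _ _ _ (fun y => y - x) (@enorm R n)).
  exact: continuous_addv.
exact: continuous_enorm.
Qed.

Lemma eball_bounded x (r : R) y : eball x r y -> `|y - x| < r.
Proof. exact: le_lt_trans (norm_le_enorm _). Qed.

End euclid.

Section measurable_open.
Context {R : realType} {n : nat}.
Local Notation E := 'rV[R]_n.
Lemma ball_rVE (x : E) (r : R) : 0 < r -> ball x r = \bigcap_(i in [set: 'I_n]) [set y : E | `|x 0 i - y 0 i| < r].
Proof.
move=> r0; apply/seteqP; split=> y.
  by move=> [_ h] i _; apply: h.
by move=> h; split => // i j; rewrite (ord1 i); exact: h.
Qed.

Lemma measurable_ball (x : E) (r : R) : measurable (ball x r).
Proof.
have [r0|r0] := ltP 0 r; last first.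
  rewrite (_ : ball x r = set0)// -subset0 => y [+ _].
  by rewrite ltNge r0.
rewrite ball_rVE//; apply: fin_bigcap_measurable => //  i _.
rewrite (_ : [set _ | _] = (fun y : E => y 0 i) @^-1` (ball (x 0 i) r)); last first.
  by apply/seteqP; split => y.
rewrite -[X in measurable X]setTI; apply: (@measurable_rV_coord R n i) => //.
exact: measurable_realfun.measurable_ball.
Qed.

Lemma open_measurable_rV (U : set E) : open U -> measurable U.
Proof.
move=> oU.
pose c (q : 'rV[rat]_n * nat) := map_mx ratr q.1 : E.
pose F q := if `[< ball (c q) q.2.+1%:R^-1 `<=` U >] then ball (c q) q.2.+1%:R^-1 else set0.
suff -> : U = \bigcup_q F q.
  apply: countable_bigcupT_measurable => // q; rewrite /F; case: ifPn => // _.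
  exact: measurable_ball.
apply/seteqP; split=> [x Ux|x [q _]]; last first.
  by rewrite /F; case: ifPn => // /asboolP; exact.
have /nbhs_ballP[e /= e0 xe] : nbhs x U by exact: open_nbhs_nbhs.
pose k := Num.truncn (2 / e).
have ke : 2 * k.+1%:R^-1 < e.
  rewrite ltr_pdivrMr// mulrC -ltr_pdivrMr//.
  have /andP[_ ] := truncn_itv (divr_ge0 (ler0n R 2) (ltW e0)); exact.
have /choice[q hq] : forall i : 'I_n, exists q : rat, `|x 0 i - ratr q| < k.+1%:R^-1.
  move=> i; have /rat_in_itvoo[q] : x 0 i - k.+1%:R^-1 < x 0 i + k.+1%:R^-1.
    by rewrite ltrBlDr -addrA ltrDl -mulr2n pmulrn_lgt0.
  rewrite in_itv/= => /andP[h1 h2]; exists q.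
  by rewrite distrC ltr_distl h1.
exists (\row_i q i, k) => //; rewrite /F /c /=.
have cx : ball (map_mx ratr (\row_i q i) : E) k.+1%:R^-1 x.
  by rewrite ball_rVE// => i _ /=; rewrite !mxE distrC.
case: ifPn => // /asboolP []; move=> y cy; apply: xe.
apply: (@le_ball _ _ _ (k.+1%:R^-1 + k.+1%:R^-1)).
  by apply: ltW; move: ke; rewrite mulr_natl mulr2n.
by apply: ball_triangle cy; exact: ball_sym.
Qed.

Lemma closed_measurable_rV (U : set E) : closed U -> measurable U.
Proof.
by move=> /closed_openC /open_measurable_rV/measurableC; rewrite setCK.
Qed.

Lemma continuous_measurable_rV (f : E -> R) : continuous f -> measurable_fun setT f.
Proof.
move=> /continuousP cf; apply: (measurability _ (measurable_realfun.RGenOpens.measurableE R)).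
move=> _ -[_ [a [b ->]]] <-; rewrite setTI; apply: open_measurable_rV.
exact/cf/interval_open.
Qed.

Lemma measurable_enorm : measurable_fun setT (@enorm R n).
Proof. by apply: continuous_measurable_rV; exact: continuous_enorm. Qed.

Lemma measurable_addv (v : E) : measurable_fun setT (fun x : E => x + v).
Proof.
apply: measurable_fun_rVP => i.
rewrite (_ : (fun _ => _) = fun t : E => t 0 i + v 0 i); last by apply/funext => t; rewrite mxE.
by apply: measurable_funD => //; exact: measurable_rV_coord.
Qed.

Lemma measurable_eball (x : E) (r : R) : measurable (eball x r).
Proof. by apply: open_measurable_rV; exact: open_eball. Qed.

(** The sigma-algebra generated by the coordinates is the Borel one: a coordinate preimage of an
interval is open, and conversely an open set is a countable union of products of intervals. This is
what allows uniqueness of measures to be tested on open sets. *)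
Lemma measurable_rV_open : (measurable : set (set E)) = <<s open >>.
Proof.
apply/seteqP; split; last first.
  apply: smallest_sub; first exact: sigma_algebra_measurable.
  by move=> U; exact: open_measurable_rV.
apply: smallest_sub; first exact: smallest_sigma_algebra.
rewrite -bigcup_seq; apply: bigcup_sub => i _ B /= [D mD <-].
rewrite setTI.
have : sigma_algebra [set: R] [set Y : set R | <<s open >> ((fun x : E => x 0 i) @^-1` Y)].
  split => /=.
  - by rewrite preimage_set0; exact: sigma_algebra0.
  - by move=> A hA; rewrite setTD preimage_setC; apply: sigma_algebraC.
  - by move=> F hF; rewrite preimage_bigcup; apply: sigma_algebra_bigcup.
move=> /smallest_sub; apply; last first.
  by move: mD; rewrite [measurable _](_ : _ = (@ocitv R).-sigma.-measurable D)// measurable_realfun.RGenOpens.measurableE; exact.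
move=> _ /= [a [b ->]]; apply: sub_sigma_algebra; apply: open_comp.
  by move=> x _; exact: coord_continuous.
exact: interval_open.
Qed.

End measurable_open.

Section cube_volume.
Context {R : realType}.
Lemma cubeE n (a : 'rV[R]_n) (l : R) :
  cube a l = \bigcap_(i in [set: 'I_n]) ((fun x : 'rV[R]_n => x 0 i) @^-1` `[a 0 i, a 0 i + l]).
Proof.
apply/seteqP; split=> x h i; first by move=> _ /=; rewrite in_itv/= h.
by have := h i I; rewrite /= in_itv.
Qed.

Lemma measurable_cube n (a : 'rV[R]_n) (l : R) : measurable (cube a l).
Proof.
rewrite cubeE; apply: fin_bigcap_measurable => // i _.
by rewrite -[X in measurable X]setTI; apply: measurable_rV_coord.
Qed.

Lemma rV_cons0 n t (x : 'rV[R]_n) : rV_cons (t, x) 0 0 = t.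
Proof. by have := rV_uncons_consK (t, x) => -[]. Qed.

Lemma rV_consS n t (x : 'rV[R]_n) i : rV_cons (t, x) 0 (rshift 1 i) = x 0 i.
Proof. by have := rV_uncons_consK (t, x) => -[_ /rowP/(_ i)]; rewrite mxE. Qed.

Lemma rV_consD n t (x : 'rV[R]_n) s y : rV_cons (t, x) + rV_cons (s, y) = rV_cons (t + s, x + y).
Proof.
apply/rowP => i; rewrite mxE; case: (@split_ordP 1 n i) => j ->; last by rewrite !rV_consS mxE.
by rewrite (ord1 j) (_ : lshift n 0 = 0) ?rV_cons0//; exact/val_inj.
Qed.

(** Induction on the dimension: the measure is built one coordinate at a time as a product measure,
and a cube is an interval times a cube. *)
Lemma lebesgue_cube n (a : 'rV[R]_n) (l : R) : 0 <= l -> lebesgue_rV n (cube a l) = (l ^+ n)%:E.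
Proof.
move=> l0; elim: n a => [|n IH] a.
  rewrite /= diracE expr0 mem_set// => -[]//.
have -> : lebesgue_rV n.+1 (cube a l) = ((@lebesgue_measure R) \x lebesgue_rV n)%E (@rV_cons R n @^-1` cube a l) by [].
have -> : @rV_cons R n @^-1` cube a l = `[a 0 0, a 0 0 + l]%classic `*` cube (rsubmx (a : 'rV_(1 + n))) l.

  have RS i : (rsubmx (a : 'rV_(1 + n))) 0 i = a 0 (rshift 1 i) by rewrite mxE.
  apply/seteqP; split => -[t x] /=.
    move=> h; split; first by have := h 0; rewrite in_itv/= rV_cons0.
    by move=> i; have := h (rshift 1 i); rewrite rV_consS RS.
  rewrite in_itv/= => -[h1 h2] i.
  case: (@split_ordP 1 n i) => j ->; last by rewrite rV_consS -RS; exact: h2.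
  by rewrite (ord1 j) (_ : lshift n 0 = 0) ?rV_cons0//; exact/val_inj.
rewrite product_measure1E//; last exact: measurable_cube.
rewrite [X in (X * _)%E](_ : _ = @lebesgue_measure R `[a 0 0, a 0 0 + l]%classic)//.
rewrite IH lebesgue_measure_itv/= lte_fin ltrDl.
have [l1|] := ltP 0 l; first by rewrite -EFinD -EFinM addrAC subrr add0r exprS.
by move=> l1; rewrite (le_anti (introT andP (conj l1 l0)))// mul0e expr0n.
Qed.

Lemma lebesgue1_translate (c : R) (A : set R) : measurable A ->
  (@lebesgue_measure R) ((fun x => x + c) @^-1` A) = lebesgue_measure A.
Proof.
move=> mA.
have mf : measurable_fun setT (fun x : measurableTypeR R => x + c : measurableTypeR R) by exact: measurable_funD.
apply/esym; apply: (lebesgue_measure_unique (mu := measure_function_pushforward__canonical__measure_function_Measure (@lebesgue_measure R) mf)) => //= _ [[a b]] _ <-.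
rewrite /pushforward (_ : _ @^-1` _ = `]a - c, b - c]%classic); last first.
  by apply/seteqP; split=> x /=; rewrite !in_itv/= ltrBlDr lerBrDr.
by rewrite !lebesgue_measure_itv/= !lte_fin ltrD2r -!EFinB; congr (if _ then _ else _); congr EFin; ring.
Qed.

(** Induction on the dimension, through uniqueness of the product measure and invariance on the
line. *)
Lemma lebesgue_translate n (v : 'rV[R]_n) (A : set 'rV[R]_n) : measurable A ->
  lebesgue_rV n ((fun x => x + v) @^-1` A) = lebesgue_rV n A.
Proof.
elim: n v A => [|n IH] v A mA.
  rewrite /= !diracE; congr (_%:R%:E); congr nat_of_bool.
  rewrite (_ : _ @^-1` A = A)//; apply/funext => x /=.
  by congr (A _); apply/rowP => -[].
set c := v 0 0; set w := rsubmx (v : 'rV_(1 + n)).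
have mg : measurable_fun setT (fun z : measurableTypeR R * 'rV[R]_n => (z.1 + c, z.2 + w) : measurableTypeR R * 'rV[R]_n).
  apply/measurable_fun_pairP; split => /=.
    by apply: measurable_funD => //; exact: measurable_fst.
  by apply: (measurableT_comp (measurable_addv w)); exact: measurable_snd.
have -> : lebesgue_rV n.+1 ((fun x => x + v) @^-1` A) =
   ((@lebesgue_measure R) \x lebesgue_rV n)%E (@rV_cons R n @^-1` ((fun x => x + v) @^-1` A)) by [].
have -> : lebesgue_rV n.+1 A = ((@lebesgue_measure R) \x lebesgue_rV n)%E (@rV_cons R n @^-1` A) by [].
have mA' : measurable (@rV_cons R n @^-1` A).
  by rewrite -[X in measurable X]setTI; exact: measurable_rV_cons.
rewrite [RHS](product_measure_unique (m' := measure_function_pushforward__canonical__measure_function_Measure ((@lebesgue_measure R) \x lebesgue_rV n)%E mg)) //=.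
  have vE : v = rV_cons (c, w).
    apply/rowP => i; case: (@split_ordP 1 n i) => j ->; last by rewrite rV_consS mxE.
    by rewrite (ord1 j) (_ : lshift n 0 = 0) ?rV_cons0//; exact/val_inj.
  have gE z : @rV_cons R n z + v = @rV_cons R n (z.1 + c, z.2 + w).
    by rewrite vE; case: z => t x; exact: rV_consD.
  rewrite /pushforward; congr (product_measure1 _ _ _).
  by apply/seteqP; split => z /=; rewrite gE.
move=> A1 A2 mA1 mA2; rewrite /pushforward.
rewrite (_ : _ @^-1` _ = ((fun x => x + c) @^-1` A1) `*` ((fun x => x + w) @^-1` A2)); last first.
  by apply/seteqP; split.
have mB1 : measurable ((fun x => x + c) @^-1` A1 : set (measurableTypeR R)).
  by rewrite -[X in measurable X]setTI; apply: measurable_funD.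
rewrite product_measure1E//; last first.
  by rewrite -[X in measurable X]setTI; apply: measurable_addv.
rewrite IH//; congr (_ * _)%E; exact: lebesgue1_translate.
Qed.

End cube_volume.

Section ball_volume.
Context {R : realType} {n : nat}.
Local Notation E := 'rV[R]_n.
Local Notation mu := (@lebesgue_rV R n).
Lemma integral_translate (v : E) (f : E -> \bar R) : measurable_fun setT f -> (forall x, 0 <= f x)%E ->
  (\int[mu]_x f (x + v)%R = \int[mu]_x f x)%E.
Proof.
move=> mf f0.
transitivity (\int[pushforward mu (fun x : E => (x + v)%R)]_x f x)%E.
  by rewrite ge0_integral_pushforward//; exact: measurable_addv.
apply: eq_measure_integral; first exact: measurable_addv.
by move=> mphi A mA _; exact: (lebesgue_translate v mA).
Qed.

Lemma Rintegral_translate (v : E) (f : E -> R) : measurable_fun setT f ->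
  (\int[mu]_x f (x + v) = \int[mu]_x f x).
Proof.
move=> mf; rewrite /Rintegral [in LHS]integralE [in RHS]integralE.
have mf' : measurable_fun setT (EFin \o f) by exact/measurable_EFinP.
have h (g : E -> \bar R) : measurable_fun setT g -> (forall x, 0 <= g x)%E -> (\int[mu]_x g (x + v)%R = \int[mu]_x g x)%E by exact: integral_translate.
congr (fine (_ - _)%E).
  rewrite -[RHS](h _ (measurable_funepos mf')) => [|x]; last exact: funepos_ge0.
  by apply: eq_integral => x _; rewrite !funeposE.
rewrite -[RHS](h _ (measurable_funeneg mf')) => [|x]; last exact: funeneg_ge0.
by apply: eq_integral => x _; rewrite !funenegE.
Qed.

Lemma normr_cube (a : E) (l : R) x : 0 <= l -> `|x - a| <= l -> cube (a - const_mx l) (2 * l) x.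
Proof.
move=> l0 /(norm_rV_leP _ l0) h i; have := h i; rewrite !mxE ler_distl => /andP[h1 h2].
by rewrite h1/=; apply: (le_trans h2); lra.
Qed.

Lemma eball_cube (a : E) (l : R) : 0 <= l -> eball a l `<=` cube (a - const_mx l) (2 * l).
Proof. by move=> l0 x /eball_bounded/ltW; exact: normr_cube. Qed.

(** Only the order of magnitude of the volume of a ball matters, so a ball is compared with its
circumscribed cube. *)
Lemma mu_eball_le (a : E) (l : R) : 0 <= l -> (mu (eball a l) <= ((2 * l) ^+ n)%:E)%E.
Proof.
move=> l0; rewrite -(lebesgue_cube (a - const_mx l)) ?mulr_ge0//.
by apply: le_measure; rewrite ?inE; [exact: measurable_eball|exact: measurable_cube|exact: eball_cube].
Qed.

Lemma mu_eball_fin (a : E) (l : R) : (mu (eball a l) < +oo)%E.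
Proof.
have [l0|l0] := leP 0 l; first by apply: le_lt_trans (mu_eball_le a l0) (ltry _).
rewrite (_ : eball a l = set0) ?measure0// -subset0 => x /= h.
by have := lt_le_trans (le_lt_trans (enorm_ge0 (x - a)) h) (ltW l0); rewrite ltxx.
Qed.

Lemma lebesgue_cube_fine (a : E) (l : R) : 0 <= l -> fine (mu (cube a l)) = l ^+ n.
Proof. by move=> l0; rewrite lebesgue_cube. Qed.

End ball_volume.

(** * Complex valued functions and their integrals *)

Section normc_facts.
Context {R : realType}.
Implicit Types z w : R[i].
Lemma Re_add z w : complex.Re (z + w) = complex.Re z + complex.Re w.
Proof. by case: z w => a b [c e]. Qed.

Lemma Im_add z w : complex.Im (z + w) = complex.Im z + complex.Im w.
Proof. by case: z w => a b [c e]. Qed.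

Lemma Re_opp z : complex.Re (- z) = - complex.Re z.
Proof. by case: z. Qed.

Lemma Im_opp z : complex.Im (- z) = - complex.Im z.
Proof. by case: z. Qed.

Lemma Re_mul z w : complex.Re (z * w) = complex.Re z * complex.Re w - complex.Im z * complex.Im w.
Proof. by case: z w => a b [c e]. Qed.

Lemma Im_mul z w : complex.Im (z * w) = complex.Re z * complex.Im w + complex.Im z * complex.Re w.
Proof. by case: z w => a b [c e]. Qed.

Definition ReImE := (Re_add, Im_add, Re_opp, Im_opp, Re_mul, Im_mul).

(** All analysis of complex functions is done on real and imaginary parts; this is how results are
put together again. *)
Lemma complexP z w : complex.Re z = complex.Re w -> complex.Im z = complex.Im w -> z = w.
Proof. by case: z w => a b [c e] /= -> ->. Qed.

Lemma normc_ge0 z : 0 <= normc z.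
Proof. by case: z => a b; exact: sqrtr_ge0. Qed.

Lemma normc_ReIm z : normc z = Num.sqrt (complex.Re z ^+ 2 + complex.Im z ^+ 2).
Proof. by case: z. Qed.

Lemma Re_le_normc z : `|complex.Re z| <= normc z.
Proof. by rewrite normc_ReIm -sqrtr_sqr ler_wsqrtr// lerDl sqr_ge0. Qed.

Lemma Im_le_normc z : `|complex.Im z| <= normc z.
Proof. by rewrite normc_ReIm -sqrtr_sqr ler_wsqrtr// lerDr sqr_ge0. Qed.

Lemma normc_le_ReIm z : normc z <= `|complex.Re z| + `|complex.Im z|.
Proof.
rewrite normc_ReIm -[leRHS]ger0_norm ?addr_ge0// -sqrtr_sqr ler_wsqrtr//.
rewrite sqrrD !real_normK ?num_real// -addrA (addrC (_ *+ 2)) addrA lerDl.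
by rewrite mulrn_wge0// mulr_ge0.
Qed.

Lemma normcD_le z w : normc (z + w) <= normc z + normc w.
Proof. exact: le_normcD. Qed.

Lemma normcB_le z w : normc (z - w) <= normc z + normc w.
Proof. by apply: (le_trans (normcD_le _ _)); rewrite (normcN w). Qed.

Lemma normc_opp z : normc (- z) = normc z.
Proof. exact: normcN. Qed.

Lemma normc_distC z w : normc (z - w) = normc (w - z).
Proof. by rewrite -normc_opp opprB. Qed.

Lemma normc_triangle t z w : normc (z - w) <= normc (z - t) + normc (t - w).
Proof. by have -> : z - w = (z - t) + (t - w); [rewrite addrA subrK|exact: normcD_le]. Qed.

Lemma normc_real (r : R) : normc (r%:C) = `|r|.
Proof. by rewrite normc_ReIm/= expr0n addr0 sqrtr_sqr. Qed.

Lemma normc_mul z w : normc (z * w) = normc z * normc w.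
Proof. exact: normcM. Qed.

Lemma normc_0 : normc (0 : R[i]) = 0.
Proof. exact: normc0. Qed.

Lemma normc_eq0 z : normc z = 0 -> z = 0.
Proof. exact: eq0_normc. Qed.

Lemma realcD (x y : R) : (x + y)%:C = x%:C + y%:C.
Proof. by apply: complexP; rewrite ReImE /= ?addr0. Qed.

Lemma realcM (x y : R) : (x * y)%:C = x%:C * y%:C.
Proof. by apply: complexP; rewrite ReImE /=; ring. Qed.

Lemma realcN (x : R) : (- x)%:C = - x%:C.
Proof. by apply: complexP; rewrite ReImE /= ?oppr0. Qed.

End normc_facts.

Section ccvg_facts.
Context {R : realType} {I : Type} (F : set_system I) {FF : ProperFilter F}.
Implicit Types (u v : I -> R[i]).
Lemma ccvgP u l : ccvg F u l <-> ((fun j => complex.Re (u j)) @ F --> complex.Re l) /\ ((fun j => complex.Im (u j)) @ F --> complex.Im l).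
Proof.
split=> [h|[h1 h2]].
  split; apply/cvgrPdist_lt => e e0; move/cvgr0Pnorm_lt : h => /(_ e e0); apply: filterS => j /=;
    rewrite ger0_norm ?normc_ge0//; apply: le_lt_trans.
    rewrite distrC -Re_opp -Re_add; exact: Re_le_normc.
  rewrite distrC -Im_opp -Im_add; exact: Im_le_normc.
apply/cvgr0Pnorm_lt => e e0; have e2 : 0 < e / 2 by rewrite divr_gt0.
move/cvgrPdist_lt : h1 => /(_ _ e2) h1; move/cvgrPdist_lt : h2 => /(_ _ e2) h2.
near=> j; rewrite ger0_norm ?normc_ge0//.
apply: (le_lt_trans (normc_le_ReIm _)); rewrite (splitr e) !ReImE ltrD// distrC; near: j; [exact: h1|exact: h2].
Unshelve. all: by end_near. Qed.

Lemma ccvg_le u l (M : R) : (\forall j \near F, normc (u j) <= M) -> ccvg F u l -> normc l <= M.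
Proof.
move=> hM ul; apply/ler_addgt0Pr => e e0; move/cvgr0Pnorm_lt : ul => /(_ e e0) ul.
have : F (fun j => normc l <= M + e).
  near=> j; have -> : l = u j - (u j - l) by rewrite opprB addrC subrK.
  apply: (le_trans (normcB_le _ _)); apply: lerD; first by near: j.
  apply: ltW; rewrite -[ltLHS]ger0_norm ?normc_ge0//; near: j; exact: ul.
by move=> /filter_ex[].
Unshelve. all: by end_near. Qed.

Lemma ccvg_unique u l l' : ccvg F u l -> ccvg F u l' -> l = l'.
Proof.
move=> /ccvgP[h1 h2] /ccvgP[h3 h4]; apply: complexP.
  exact: (cvg_unique _ h1 h3).
exact: (cvg_unique _ h2 h4).
Qed.

Lemma ccvg_near_eq u v l : (\forall j \near F, u j = v j) -> ccvg F u l -> ccvg F v l.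
Proof.
move=> uv; rewrite /ccvg; apply: cvg_trans; apply: near_eq_cvg.
by apply: filterS uv => j /= ->.
Qed.

Lemma ccvgD u v l l' : ccvg F u l -> ccvg F v l' -> ccvg F (fun j => u j + v j) (l + l').
Proof.
move=> /ccvgP[h1 h2] /ccvgP[h3 h4]; apply/ccvgP; rewrite !ReImE.
split.
  by under eq_fun do rewrite Re_add; exact: cvgD.
by under eq_fun do rewrite Im_add; exact: cvgD.
Qed.

Lemma ccvg_cst (l : R[i]) : ccvg F (fun=> l) l.
Proof. by apply/ccvgP; split; exact: cvg_cst. Qed.

Lemma ccvgM_cst (c : R[i]) u l : ccvg F u l -> ccvg F (fun j => c * u j) (c * l).
Proof.
move=> ul; rewrite /ccvg; under eq_fun do rewrite -mulrBr normc_mul.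
have := @cvgMl_tmp R I F _ (fun j => normc (u j - l) : R) (normc c : R) 0 ul.
by rewrite mulr0 => h; exact: h.
Qed.

End ccvg_facts.

Section cmeas.
Context {R : realType} d {X : measurableType d}.
Implicit Types (D : set X) (f g : X -> R[i]).
Lemma cmeasurableD D f g : cmeasurable D f -> cmeasurable D g -> cmeasurable D (fun x => f x + g x).
Proof.
move=> [f1 f2] [g1 g2]; split.
  by under eq_fun do rewrite Re_add; exact: measurable_funD.
by under eq_fun do rewrite Im_add; exact: measurable_funD.
Qed.

Lemma cmeasurableM D f g : cmeasurable D f -> cmeasurable D g -> cmeasurable D (fun x => f x * g x).
Proof.
move=> [f1 f2] [g1 g2]; split.
  by under eq_fun do rewrite Re_mul; apply: measurable_funB; exact: measurable_funM.
by under eq_fun do rewrite Im_mul; apply: measurable_funD; exact: measurable_funM.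
Qed.

Lemma cmeasurable_cst D (c : R[i]) : cmeasurable D (fun=> c).
Proof. by split; exact: measurable_cst. Qed.

Lemma cmeasurableZ D c f : cmeasurable D f -> cmeasurable D (fun x => c * f x).
Proof. by apply: cmeasurableM; exact: cmeasurable_cst. Qed.

Lemma cmeasurableN D f : cmeasurable D f -> cmeasurable D (fun x => - f x).
Proof. by move=> /(cmeasurableZ (-1)); under eq_fun do rewrite mulN1r. Qed.

Lemma cmeasurableB D f g : cmeasurable D f -> cmeasurable D g -> cmeasurable D (fun x => f x - g x).
Proof. by move=> mf mg; apply: cmeasurableD => //; exact: cmeasurableN. Qed.

Lemma cmeasurable_real D (f : X -> R) : measurable_fun D f -> cmeasurable D (fun x => (f x)%:C).
Proof. by move=> mf; split => //; exact: measurable_cst. Qed.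

Lemma measurable_normc D f : cmeasurable D f -> measurable_fun D (fun x => normc (f x)).
Proof.
move=> [f1 f2]; under eq_fun do rewrite normc_ReIm.
pose h x : R := complex.Re (f x) ^+ 2 + complex.Im (f x) ^+ 2.
have mh : measurable_fun D h by apply: measurable_funD; exact: measurable_funX.
exact: (measurableT_comp (continuous_measurable_fun (@sqrt_continuous R)) mh).
Qed.

Lemma cmeasurable_comp d' (Y : measurableType d') (f : X -> R[i]) (h : Y -> X) (D : set Y) :
  cmeasurable setT f -> measurable_fun D h -> cmeasurable D (f \o h).
Proof. by move=> [f1 f2] mh; split; [exact: measurableT_comp f1 mh|exact: measurableT_comp f2 mh]. Qed.

Lemma cmeasurableS D D' f : measurable D -> D' `<=` D -> cmeasurable D f -> cmeasurable D' f.
Proof. by move=> mD DD [f1 f2]; split; apply: measurable_funS; eauto. Qed.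

Lemma cmeasurable_if D f : measurable D -> cmeasurable D f ->
  cmeasurable setT (fun x => if x \in D then f x else 0).
Proof.
move=> mD [f1 f2]; split.
  rewrite (_ : (fun _ => _) = (fun x => complex.Re (f x)) \_ D); last first.
    by apply/funext => x; rewrite patchE; case: ifP.
  by apply/(measurable_restrictT _ mD).
rewrite (_ : (fun _ => _) = (fun x => complex.Im (f x)) \_ D); last first.
  by apply/funext => x; rewrite patchE; case: ifP.
by apply/(measurable_restrictT _ mD).
Qed.

End cmeas.

Section real_integral.
Context {R : realType} d {X : measurableType d} (mu : {measure set X -> \bar R}).
Implicit Types (D : set X) (f g : X -> R).
Lemma integrable_dom D f g : measurable D -> measurable_fun D f ->
  (forall x, D x -> `|f x| <= g x) -> mu.-integrable D (EFin \o g) -> mu.-integrable D (EFin \o f).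
Proof.
move=> mD mf fg ig; apply: (le_integrable mD _ _ ig); first exact/measurable_EFinP.
by move=> x Dx /=; rewrite lee_fin (le_trans (fg _ Dx))// ler_norm.
Qed.

Lemma RintegrableD D f g : measurable D -> mu.-integrable D (EFin \o f) -> mu.-integrable D (EFin \o g) ->
  mu.-integrable D (EFin \o (fun x => f x + g x)).
Proof. by move=> mD i j; exact: (integrableD mD i j). Qed.

Lemma RintegrableB D f g : measurable D -> mu.-integrable D (EFin \o f) -> mu.-integrable D (EFin \o g) ->
  mu.-integrable D (EFin \o (fun x => f x - g x)).
Proof. by move=> mD i j; exact: (integrableB mD i j). Qed.

Lemma RintegrableZ D (r : R) g : measurable D -> mu.-integrable D (EFin \o g) ->
  mu.-integrable D (EFin \o (fun x => r * g x)).
Proof. by move=> mD ig; exact: (integrableZl mD r ig). Qed.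

Lemma integrable_cst D (M : R) : measurable D -> (mu D < +oo)%E -> mu.-integrable D (EFin \o (fun=> M)).
Proof.
move=> mD fD; apply/integrableP; split; first exact/measurable_EFinP/measurable_cst.
by rewrite /= integral_cst// lte_mul_pinfty.
Qed.

Lemma integrable_bounded D f (M : R) : measurable D -> (mu D < +oo)%E -> measurable_fun D f ->
  (forall x, D x -> `|f x| <= M) -> mu.-integrable D (EFin \o f).
Proof. by move=> mD fD mf fM; apply: (integrable_dom (g := fun=> M)) => //; exact: integrable_cst. Qed.

Lemma Rintegral_le_dom D f g : measurable D -> measurable_fun D f ->
  (forall x, D x -> `|f x| <= g x) -> mu.-integrable D (EFin \o g) ->
  `|\int[mu]_(x in D) f x| <= \int[mu]_(x in D) g x.
Proof.
move=> mD mf fg ig; have fi := integrable_dom mD mf fg ig.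
apply: (le_trans (le_normr_Rintegral mD fi)); apply: le_Rintegral => //.
apply: (integrable_dom mD _ _ ig); first exact: measurableT_comp.
by move=> x Dx; rewrite normr_id fg.
Qed.

Lemma integrable_mkcond D f : measurable D ->
  mu.-integrable D (EFin \o f) <-> mu.-integrable setT (EFin \o (fun x => if x \in D then f x else 0)).
Proof.
move=> mD; rewrite integrable_mkcond//.
rewrite (_ : (EFin \o f) \_ D = EFin \o (fun x => if x \in D then f x else 0))//.
by apply/funext => x; rewrite patchE/=; case: ifP.
Qed.

Lemma Rintegral_mkcondT D f :
  \int[mu]_(x in D) f x = \int[mu]_x (if x \in D then f x else 0).
Proof.
by rewrite Rintegral_mkcond; congr Rintegral; apply/funext => x; rewrite patchE.
Qed.

Lemma Rintegral_cvg D (f_ : nat -> X -> R) f g : measurable D ->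
  (forall n, measurable_fun D (f_ n)) -> 
  (forall x, D x -> f_ ^~ x @ \oo --> f x) ->
  mu.-integrable D (EFin \o g) -> (forall n x, D x -> `|f_ n x| <= g x) ->
  [/\ mu.-integrable D (EFin \o f) , (fun n => \int[mu]_(x in D) f_ n x) @ \oo --> \int[mu]_(x in D) f x
    & (fun n => \int[mu]_(x in D) `|f_ n x - f x|) @ \oo --> 0].
Proof.
move=> mD mf_ ff ig fg.
have mf : measurable_fun D f by apply: measurable_fun_cvg ff.
have fle x : D x -> `|f x| <= g x.
  by move=> Dx; apply: (cvgr_to_le (cvg_norm (ff x Dx))); near=> n; exact: fg.
have [] := @dominated_convergence _ _ _ mu D mD (fun n => EFin \o f_ n) (EFin \o f) (EFin \o g).
- by move=> n; exact/measurable_EFinP.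
- exact/measurable_EFinP.
- by apply/aeW => x Dx; apply: cvg_EFin; [exact: nearW|exact: ff].
- exact: ig.
- by apply/aeW => x n Dx; rewrite lee_fin fg.
move=> i1 i2 i3.
have ifn n : mu.-integrable D (EFin \o f_ n) by apply: integrable_dom ig => // x; exact: fg.
have ifd n : mu.-integrable D (EFin \o (fun x => `|f_ n x - f x|)).
  apply: (@integrable_dom _ _ (fun x => g x + g x)) => //.
  - by apply: measurableT_comp => //; apply: measurable_funB.
  - by move=> x Dx; rewrite normr_id (le_trans (ler_normB _ _))// lerD// ?fg// fle.
  - exact: RintegrableD.
split => //.
  move: i3; rewrite (_ : (\int[mu]_(x in D) (EFin \o f) x)%E = (\int[mu]_(x in D) f x)%:E)//.
    by move=> /fine_cvgP[].
  by rewrite /Rintegral fineK//; exact: integrable_fin_num.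
have : (fun n => (\int[mu]_(x in D) `|f_ n x - f x|)%:E) @ \oo --> (0:R)%:E.
  move: i2; apply: cvg_trans; apply: near_eq_cvg; apply: nearW => n /=.
  by rewrite /Rintegral fineK//; apply: (integrable_fin_num mD); exact: ifd.
by move=> /fine_cvgP[].
Unshelve. all: by end_near. Qed.

End real_integral.

Section cintegral_facts.
Context {R : realType} d {X : measurableType d} (mu : {measure set X -> \bar R}).
Implicit Types (D : set X) (f : X -> R[i]) (g : X -> R).
Definition cintegrable D f :=
  mu.-integrable D (EFin \o (fun x => complex.Re (f x))) /\
  mu.-integrable D (EFin \o (fun x => complex.Im (f x))).

Lemma cintegrable_dom D f g : measurable D -> cmeasurable D f ->
  (forall x, D x -> normc (f x) <= g x) -> mu.-integrable D (EFin \o g) -> cintegrable D f.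
Proof.
move=> mD [f1 f2] fg ig; split; apply: integrable_dom ig => // x Dx; apply: le_trans (fg x Dx).
  exact: Re_le_normc.
exact: Im_le_normc.
Qed.

Lemma cintegrable_bounded D f (M : R) : measurable D -> (mu D < +oo)%E -> cmeasurable D f ->
  (forall x, D x -> normc (f x) <= M) -> cintegrable D f.
Proof. by move=> mD fD mf fM; apply: (cintegrable_dom (g := fun=> M)) => //; exact: integrable_cst. Qed.

Lemma cintegrable_measurable D f : cintegrable D f -> cmeasurable D f.
Proof. by move=> [i1 i2]; split; apply/measurable_EFinP; apply: measurable_int; eauto. Qed.

Lemma cintegrable_normc D f : measurable D -> cintegrable D f -> mu.-integrable D (EFin \o (fun x => normc (f x))).
Proof.
move=> mD fi; have mf := cintegrable_measurable fi; case: fi => i1 i2.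
apply: (@integrable_dom _ _ _ _ _ _ (fun x => `|complex.Re (f x)| + `|complex.Im (f x)|)) => //.
- exact: measurable_normc.
- by move=> x _; rewrite ger0_norm ?normc_ge0 ?normc_le_ReIm.
- apply: RintegrableD => //.
    exact: (integrable_abse i1).
  exact: (integrable_abse i2).
Qed.

Lemma cintegralE D f : cintegral mu D f = (\int[mu]_(x in D) complex.Re (f x)) +i* (\int[mu]_(x in D) complex.Im (f x)).
Proof. by []. Qed.

Lemma cintegrableD D f f' : measurable D -> cintegrable D f -> cintegrable D f' -> cintegrable D (fun x => f x + f' x).
Proof.
move=> mD [i1 i2] [j1 j2]; split.
  by under eq_fun do rewrite Re_add; exact: (integrableD mD i1 j1).
by under eq_fun do rewrite Im_add; exact: (integrableD mD i2 j2).
Qed.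

Lemma cintegralD D f f' : measurable D -> cintegrable D f -> cintegrable D f' ->
  cintegral mu D (fun x => f x + f' x) = cintegral mu D f + cintegral mu D f'.
Proof.
move=> mD [i1 i2] [j1 j2]; rewrite !cintegralE; apply: complexP; rewrite ReImE /=.
  by under eq_Rintegral do rewrite Re_add; rewrite RintegralD.
by under eq_Rintegral do rewrite Im_add; rewrite RintegralD.
Qed.

Lemma cintegrableZ D c f : measurable D -> cintegrable D f -> cintegrable D (fun x => c * f x).
Proof.
move=> mD [i1 i2]; split.
  by under eq_fun do rewrite Re_mul; apply: RintegrableB => //; exact: RintegrableZ.
by under eq_fun do rewrite Im_mul; apply: RintegrableD => //; exact: RintegrableZ.
Qed.

Lemma cintegralZ D c f : measurable D -> cintegrable D f ->
  cintegral mu D (fun x => c * f x) = c * cintegral mu D f.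
Proof.
move=> mD [i1 i2]; rewrite !cintegralE; apply: complexP; rewrite ReImE /=.
  under eq_Rintegral do rewrite Re_mul; rewrite RintegralB//; try exact: RintegrableZ.
  by rewrite !RintegralZl.
under eq_Rintegral do rewrite Im_mul; rewrite RintegralD//; try exact: RintegrableZ.
by rewrite !RintegralZl.
Qed.

Lemma cintegralZr D c f : measurable D -> cintegrable D f ->
  cintegral mu D (fun x => f x * c) = cintegral mu D f * c.
Proof.
move=> mD fi; rewrite mulrC -cintegralZ//; congr cintegral; apply/funext => x; exact: mulrC.
Qed.

Lemma cintegrableN D f : measurable D -> cintegrable D f -> cintegrable D (fun x => - f x).
Proof. by move=> mD /(cintegrableZ (-1) mD); under eq_fun do rewrite mulN1r. Qed.

Lemma cintegrableB D f f' : measurable D -> cintegrable D f -> cintegrable D f' -> cintegrable D (fun x => f x - f' x).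
Proof. by move=> mD i j; apply: (cintegrableD mD i); exact: cintegrableN. Qed.

Lemma cintegralB D f f' : measurable D -> cintegrable D f -> cintegrable D f' ->
  cintegral mu D (fun x => f x - f' x) = cintegral mu D f - cintegral mu D f'.
Proof.
move=> mD i j; rewrite (cintegralD mD i (cintegrableN mD j)); congr (_ + _).
rewrite -mulN1r -cintegralZ//; congr cintegral; apply/funext => x; by rewrite mulN1r.
Qed.

(** The factor 2 comes from estimating the real and imaginary parts separately. *)
Lemma normc_cintegral_le D f g : measurable D -> cmeasurable D f ->
  (forall x, D x -> normc (f x) <= g x) -> mu.-integrable D (EFin \o g) ->
  normc (cintegral mu D f) <= 2 * \int[mu]_(x in D) g x.
Proof.
move=> mD [f1 f2] fg ig; rewrite cintegralE; apply: (le_trans (normc_le_ReIm _)) => /=.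
rewrite mulr_natl mulr2n lerD// Rintegral_le_dom// => x Dx; apply: le_trans (fg x Dx).
  exact: Re_le_normc.
exact: Im_le_normc.
Qed.

Lemma cintegrableS D D' f : measurable D -> measurable D' -> D' `<=` D -> cintegrable D f -> cintegrable D' f.
Proof. by move=> mD mD' DD [i1 i2]; split; apply: (integrableS mD). Qed.

Lemma eq_cintegral D f f' : (forall x, D x -> f x = f' x) -> cintegral mu D f = cintegral mu D f'.
Proof.
move=> h; rewrite !cintegralE; congr (_ +i* _); apply: eq_Rintegral => x /set_mem Dx; by rewrite h.
Qed.

Lemma ae_eq_cintegral D f f' : measurable D -> cmeasurable D f -> cmeasurable D f' ->
  {ae mu, forall x, D x -> f x = f' x} -> cintegral mu D f = cintegral mu D f'.
Proof.
move=> mD [f1 f2] [g1 g2] h; rewrite /cintegral; congr (fine _ +i* fine _); apply: ae_eq_integral => //;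
  try exact/measurable_EFinP; apply: filterS h => x + Dx => /(_ Dx) ->//.
Qed.

Lemma cintegral_mkcond D f : cintegral mu D f = cintegral mu setT (fun x => if x \in D then f x else 0).
Proof.
apply: complexP; rewrite !cintegralE /= [LHS]Rintegral_mkcondT; apply: eq_Rintegral => x _; by case: ifP.
Qed.

Lemma cintegrable_mkcond D f : measurable D ->
  cintegrable D f <-> cintegrable setT (fun x => if x \in D then f x else 0).
Proof.
move=> mD; split=> -[i1 i2]; split.
- by move/(integrable_mkcond _ _ mD) : i1; congr (_.-integrable _ _); apply/funext => x /=; case: ifP.
- by move/(integrable_mkcond _ _ mD) : i2; congr (_.-integrable _ _); apply/funext => x /=; case: ifP.
- by apply/(integrable_mkcond _ _ mD); move: i1; congr (_.-integrable _ _); apply/funext => x /=; case: ifP.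
- by apply/(integrable_mkcond _ _ mD); move: i2; congr (_.-integrable _ _); apply/funext => x /=; case: ifP.
Qed.

Lemma cintegral_supp D f : (forall x, ~ D x -> f x = 0) -> cintegral mu setT f = cintegral mu D f.
Proof.
move=> h; rewrite [RHS]cintegral_mkcond; congr cintegral; apply/funext => x.
by case: ifPn => // /negP; rewrite inE => /h.
Qed.

Lemma cintegrable_supp D f : measurable D -> (forall x, ~ D x -> f x = 0) -> cintegrable D f -> cintegrable setT f.
Proof.
move=> mD h /(cintegrable_mkcond _ mD); congr cintegrable; apply/funext => x.
by case: ifPn => // /negP; rewrite inE => /h.
Qed.

Lemma cintegral0 D f : (forall x, D x -> f x = 0) -> cintegral mu D f = 0.
Proof.
move=> h; rewrite (eq_cintegral (f' := fun=> 0))// cintegralE /= /Rintegral.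
by rewrite integral0.
Qed.

(** Additivity of the integral on a set and its complement in a larger one; this is how the domain
of integration of the far part is changed. *)
Lemma cintegral_setI_split D D' f : measurable D -> measurable D' -> D' `<=` D -> cintegrable D f ->
  cintegral mu D f = cintegral mu D' f + cintegral mu (D `\` D') f.
Proof.
move=> mD mD' DD fi.
have mDD : measurable (D `\` D') by exact: measurableD.
rewrite [in LHS]cintegral_mkcond [X in _ = X + _]cintegral_mkcond [X in _ = _ + X]cintegral_mkcond.
rewrite -cintegralD//.
- congr cintegral; apply/funext => x.
  case: (boolP (x \in D')) => xD'.
    have -> : x \in D by rewrite inE; apply: DD; exact: set_mem.
    have -> : x \in D `\` D' = false by apply/negP; rewrite inE => -[_]; apply; exact: set_mem.
    by rewrite addr0.
  rewrite add0r; congr (if _ then _ else _).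
  apply/idP/idP => [xD|]; last by rewrite !inE => -[].
  by rewrite !inE in xD *; split => // h; move/negP : xD'; rewrite inE.
- by apply/(cintegrable_mkcond f mD'); exact: (cintegrableS mD mD' DD fi).
- by apply/(cintegrable_mkcond f mDD); apply: (cintegrableS mD mDD _ fi) => x [].
Qed.

Lemma cintegral_cvg D (f_ : nat -> X -> R[i]) f g : measurable D ->
  (forall n, cmeasurable D (f_ n)) ->
  (forall x, D x -> ccvg \oo (f_ ^~ x) (f x)) ->
  mu.-integrable D (EFin \o g) -> (forall n x, D x -> normc (f_ n x) <= g x) ->
  cintegrable D f /\ ccvg \oo (fun n => cintegral mu D (f_ n)) (cintegral mu D f).
Proof.
move=> mD mf ff ig fg.
have [] := @Rintegral_cvg _ _ _ mu D (fun n x => complex.Re (f_ n x)) (fun x => complex.Re (f x)) g mD _ _ ig.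
- by move=> n; have [] := mf n.
- by move=> x Dx; have /ccvgP[] := ff x Dx.
- by move=> n x Dx; apply: le_trans (fg n x Dx); exact: Re_le_normc.
move=> i1 c1 _.
have [] := @Rintegral_cvg _ _ _ mu D (fun n x => complex.Im (f_ n x)) (fun x => complex.Im (f x)) g mD _ _ ig.
- by move=> n; have [] := mf n.
- by move=> x Dx; have /ccvgP[] := ff x Dx.
- by move=> n x Dx; apply: le_trans (fg n x Dx); exact: Im_le_normc.
move=> i2 c2 _; split; first by split; [exact: i1|exact: i2].
by apply/ccvgP.
Qed.

End cintegral_facts.

Section fubini.
Context {R : realType} d1 d2 {X : measurableType d1} {Y : measurableType d2}
  (m1 : {sigma_finite_measure set X -> \bar R}) (m2 : {sigma_finite_measure set Y -> \bar R}).
Lemma Rfubini (f : X * Y -> R) : (m1 \x m2)%E.-integrable setT (EFin \o f) ->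
  [/\ \int[(m1 \x m2)%E]_z f z = \int[m1]_x \int[m2]_y f (x, y),
      \int[(m1 \x m2)%E]_z f z = \int[m2]_y \int[m1]_x f (x, y),
      m1.-integrable setT (EFin \o (fun x => \int[m2]_y f (x, y))) &
      m2.-integrable setT (EFin \o (fun y => \int[m1]_x f (x, y)))].
Proof.
move=> fi.
have mF := measurable_fubini_F fi; have mG := measurable_fubini_G fi.
have iF := integrable_fubini_F fi.
have mf : measurable_fun setT (EFin \o f) by case/integrableP : fi.
have iG : m2.-integrable setT (fubini_G m1 (EFin \o f)).
  apply/integrableP; split => //.
  apply: le_lt_trans ((integrable21ltyP m1 m2 mf).1 fi).
  apply: ge0_le_integral => //.
  - exact: measurableT_comp.
  - have m3 : measurable_fun setT (abse \o (EFin \o f)) by exact: measurableT_comp.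
    exact: (measurable_fun_fubini_tonelli_G (m1 := m1) _ m3 (fun=> abse_ge0 _)).
  - by move=> y _; apply: le_abse_integral => //; exact: measurableT_comp.
have aF : {ae m1, forall x, setT x -> fubini_F m2 (EFin \o f) x = (\int[m2]_y f (x, y))%:E}.
  by apply: filterS (integrable_ae measurableT iF) => x h _; rewrite /Rintegral fineK// h.
have aG : {ae m2, forall y, setT y -> fubini_G m1 (EFin \o f) y = (\int[m1]_x f (x, y))%:E}.
  by apply: filterS (integrable_ae measurableT iG) => x h _; rewrite /Rintegral fineK// h.
have mF' : measurable_fun setT (fun x => (\int[m2]_y f (x, y))%:E).
  by apply/measurable_EFinP; apply: measurableT_comp mF => //; exact: fine_measurable.
have mG' : measurable_fun setT (fun y => (\int[m1]_x f (x, y))%:E).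
  by apply/measurable_EFinP; apply: measurableT_comp mG => //; exact: fine_measurable.
split.
- by rewrite {1 2}/Rintegral -(@ae_eq_integral _ _ _ m1 setT _ _ measurableT mF mF' aF) integral12_prod_meas1.
- by rewrite {1 2}/Rintegral -(@ae_eq_integral _ _ _ m2 setT _ _ measurableT mG mG' aG) integral21_prod_meas1.
- apply/integrableP; split => //; case/integrableP : iF => _; apply: le_lt_trans.
  rewrite le_eqVlt; apply/orP; left; apply/eqP/ae_eq_integral => //; try exact: measurableT_comp.
  by apply: filterS aF => x /= h _; rewrite h.
- apply/integrableP; split => //; case/integrableP : iG => _; apply: le_lt_trans.
  rewrite le_eqVlt; apply/orP; left; apply/eqP/ae_eq_integral => //; try exact: measurableT_comp.
  by apply: filterS aG => x /= h _; rewrite h.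
Qed.

(** Fubini, with the integrability of the partial integrals, which are defined everywhere since the
real valued integral is total. *)
Lemma cfubini (f : X * Y -> R[i]) : cintegrable (m1 \x m2)%E setT f ->
  [/\ cintegral (m1 \x m2)%E setT f = cintegral m1 setT (fun x => cintegral m2 setT (fun y => f (x, y))),
      cintegral (m1 \x m2)%E setT f = cintegral m2 setT (fun y => cintegral m1 setT (fun x => f (x, y))),
      cintegrable m1 setT (fun x => cintegral m2 setT (fun y => f (x, y))) &
      cintegrable m2 setT (fun y => cintegral m1 setT (fun x => f (x, y)))].
Proof.
by move=> [/Rfubini[a1 a2 a3 a4] /Rfubini[b1 b2 b3 b4]]; split; rewrite ?cintegralE /= ?a1 ?b1 -?a1 -?b1 ?a2 ?b2.
Qed.

End fubini.

(** * Smooth functions *)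

Section smooth_calculus.
Context {R : realType} {n : nat}.
Local Notation E := 'rV[R]_n.
Implicit Types (u v : E -> R) (x y a : E) (i : 'I_n).
Local Notation e_ i := (delta_mx 0 i : E).
(** Smoothness by coinduction: a class of continuous functions that have partial derivatives in the
same class consists of smooth functions. This avoids formulas for iterated derivatives of products,
compositions and convolutions. *)
Lemma smooth_coind (P : (E -> R) -> Prop) :
  (forall u, P u -> continuous u /\ forall i, (forall x, derivable u x (e_ i)) /\ P (fun x => 'D_(e_ i) u x)) ->
  forall u, P u -> smooth u.
Proof.
move=> H u Pu.
have K s : P (iter_partial s u) by elim: s => [//|i s IH] /=; have [_ /(_ i)[]] := H _ IH.
by move=> s; have [h1 h2] := H _ (K s); split => // i x; have [] := h2 i.
Qed.

Lemma smooth_continuous u : smooth u -> continuous u.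
Proof. by move=> /(_ [::])[]. Qed.

Lemma smooth_derivable u i x : smooth u -> derivable u x (e_ i).
Proof. by move=> /(_ [::])[_ /(_ i x)]. Qed.

Lemma iter_partial_rcons s i u : iter_partial (rcons s i) u = iter_partial s (fun x => 'D_(e_ i) u x).
Proof. by elim: s => //= j s ->. Qed.

Lemma smooth_partial u i : smooth u -> smooth (fun x => 'D_(e_ i) u x).
Proof. by move=> su s; rewrite -iter_partial_rcons; exact: su. Qed.

Lemma is_derive_line u x (e : E) (t : R) : derivable u (t *: e + x) e ->
  is_derive t (1 : R) (fun h : R => u (h *: e + x)) ('D_e u (t *: e + x)).
Proof.
move=> du.
have h : (fun h : R => h^-1 *: (u ((h *: (1 : R) + t) *: e + x) - u (t *: e + x))) =
         (fun h : R => h^-1 *: (u (h *: e + (t *: e + x)) - u (t *: e + x))).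
  by apply/funext => h; rewrite [h *: 1]mulr1 scalerDl -addrA.
split; last by rewrite /derive /= h.
by rewrite /derivable /= h.
Qed.

(** Partial derivatives are derivatives of one variable functions along coordinate lines, which
gives access to the mean value theorem and to the chain rule. *)
Lemma is_derive_line0 u x (e : E) (l : R) : is_derive (0 : R) (1 : R) (fun h : R => u (h *: e + x)) l ->
  is_derive x e u l.
Proof.
have h : (fun h : R => h^-1 *: (u ((h *: (1 : R) + 0) *: e + x) - u ((0 : R) *: e + x))) =
         (fun h : R => h^-1 *: (u (h *: e + x) - u x)).
  by apply/funext => h; rewrite [h *: 1]mulr1 addr0 scale0r add0r.
by move=> [d1 d2]; split; [move: d1; rewrite /derivable /= h|move: d2; rewrite /derive /= h].
Qed.

Lemma smooth_cst (c : R) : smooth (fun _ : E => c).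
Proof.
apply: (smooth_coind (P := fun u => exists c : R, u = (fun=> c))); last by exists c.
move=> _ [b ->]; split; first exact: cst_continuous.
move=> i; split=> [x|]; first exact: derivable_cst.
by exists 0; apply/funext => x; exact: derive_cst.
Qed.

(** Sums of products of smooth functions. A class stable under partial derivatives has to be closed
under both operations because of the product rule. *)
Inductive smooth_alg : (E -> R) -> Prop :=
| smooth_alg_base u of smooth u : smooth_alg u
| smooth_alg_add u v of smooth_alg u & smooth_alg v : smooth_alg (fun x => u x + v x)
| smooth_alg_mul u v of smooth_alg u & smooth_alg v : smooth_alg (fun x => u x * v x).

Lemma smooth_algP u : smooth_alg u -> smooth u.
Proof.
apply: smooth_coind => {}u; elim=> {u} [u su|u v _ [cu du] _ [cv dv]|u v au [cu du] av [cv dv]].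
- split; first exact: smooth_continuous.
  by move=> i; split => [x|]; [exact: smooth_derivable|exact/smooth_alg_base/smooth_partial].
- split; first by move=> x; exact: (cvgD (cu x) (cv x)).
  move=> i; have [du1 du2] := du i; have [dv1 dv2] := dv i; split.
    by move=> x; exact: derivableD.
  rewrite (_ : (fun x => _) = (fun x => 'D_(e_ i) u x + 'D_(e_ i) v x)); first exact: smooth_alg_add.
  by apply/funext => x; exact: deriveD.
- split; first by move=> x; exact: (cvgM (cu x) (cv x)).
  move=> i; have [du1 du2] := du i; have [dv1 dv2] := dv i; split.
    by move=> x; exact: derivableM.
  rewrite (_ : (fun x => _) = (fun x => u x * 'D_(e_ i) v x + v x * 'D_(e_ i) u x)).
    by apply: smooth_alg_add; exact: smooth_alg_mul.
  by apply/funext => x; exact: deriveM.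
Qed.

Lemma smoothD u v : smooth u -> smooth v -> smooth (fun x => u x + v x).
Proof. by move=> su sv; apply/smooth_algP/smooth_alg_add; exact: smooth_alg_base. Qed.

Lemma smoothM u v : smooth u -> smooth v -> smooth (fun x => u x * v x).
Proof. by move=> su sv; apply/smooth_algP/smooth_alg_mul; exact: smooth_alg_base. Qed.

Lemma smoothZ (c : R) u : smooth u -> smooth (fun x => c * u x).
Proof. by apply: smoothM; exact: smooth_cst. Qed.

Lemma smoothN u : smooth u -> smooth (fun x => - u x).
Proof. by move=> /(smoothZ (-1)); under eq_fun do rewrite mulN1r. Qed.

Lemma smoothB u v : smooth u -> smooth v -> smooth (fun x => u x - v x).
Proof. move=> su sv; exact: (smoothD su (smoothN sv)). Qed.

Lemma smooth_prod (I : Type) (r : seq I) (F : I -> E -> R) : (forall k, smooth (F k)) ->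
  smooth (fun x => \prod_(k <- r) F k x).
Proof.
move=> sF; elim: r => [|k r IH].
  by under eq_fun do rewrite big_nil; exact: smooth_cst.
by under eq_fun do rewrite big_cons; exact: (smoothM (sF k) IH).
Qed.

Lemma is_derive_affine u (c : R) a i x : smooth u ->
  is_derive x (e_ i) (fun x => u (c *: x + a)) (c * 'D_(e_ i) u (c *: x + a)).
Proof.
move=> su; apply: is_derive_line0.
rewrite (_ : (fun h : R => _) = (fun k : R => u (k *: e_ i + (c *: x + a))) \o (fun h : R => c *: h)); last first.
  by apply/funext => h /=; rewrite scalerDr scalerA addrA.
rewrite mulrC; apply: is_derive1_comp.
  have := @is_derive_line u (c *: x + a) (e_ i) (c *: 0) (@smooth_derivable u i _ su).
  by rewrite scaler0 scale0r add0r.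
have := @is_deriveZ R R R id c 0 1 1 (is_derive_id _ _).
by rewrite [c *: (1 : R)]mulr1.
Qed.

(** Closed under derivation up to a constant factor, hence the constants [b] in the coinductive
class. *)
Lemma smooth_affine u (c : R) a : smooth u -> smooth (fun x => u (c *: x + a)).
Proof.
move=> su.
apply: (smooth_coind (P := fun w => exists b v, smooth v /\ w = fun x => b * v (c *: x + a))); last first.
  by exists 1, u; split => //; apply/funext => x; rewrite mul1r.
move=> _ [b [v [sv ->]]]; split.
  move=> x; apply: (@cvgM _ _ (nbhs x) _ (fun=> b) (fun x => v (c *: x + a))); first exact: cvg_cst.
  apply: (@continuous_comp _ _ _ (fun x => c *: x + a) v).
    exact: (@cvgD _ _ _ (nbhs x) _ (fun x => c *: x) (fun=> a) _ _ (@scaler_continuous _ _ c x) (cvg_cst _)).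
  exact: (smooth_continuous sv).
move=> i; have h x : is_derive x (e_ i) (fun x => b * v (c *: x + a)) (b * (c * 'D_(e_ i) v (c *: x + a))).
  by apply: is_deriveZ; exact: is_derive_affine.
split; first by move=> x; have [] := h x.
exists (b * c), (fun x => 'D_(e_ i) v x); split; first exact: smooth_partial.
by apply/funext => x; rewrite (@derive_val _ _ _ _ _ _ _ (h x)) mulrA.
Qed.

Lemma smooth_shift u a : smooth u -> smooth (fun x => u (x + a)).
Proof. by move=> /(smooth_affine 1 a); under eq_fun do rewrite scale1r. Qed.

End smooth_calculus.

Section smooth_bounded_support.
Context {R : realType} {n : nat}.
Local Notation E := 'rV[R]_n.
Implicit Types (u v : E -> R) (x y a : E) (i : 'I_n).
Local Notation e_ i := (delta_mx 0 i : E).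
Lemma closed_normball (r : R) : closed [set x : E | `|x| <= r].
Proof.
have -> : [set x : E | `|x| <= r] = (fun x : E => `|x|) @^-1` [set t | t <= r] by [].
apply: closed_comp; last exact: closed_le.
by move=> x _; exact: norm_continuous.
Qed.

Lemma compact_normball (r : R) : compact [set x : E | `|x| <= r].
Proof.
apply: bounded_closed_compact; last exact: closed_normball.
by exists r; split; [exact: num_real|move=> M rM x /= xr; exact: (le_trans xr (ltW rM))].
Qed.

Definition supported u (r : R) := forall x, r < `|x| -> u x = 0.

Lemma bounded_supported u r : continuous u -> supported u r -> exists2 M : R, 0 <= M & forall x, `|u x| <= M.
Proof.
move=> cu su.
have : compact (u @` [set x : E | `|x| <= r]).
  apply: continuous_compact; last exact: compact_normball.
  exact: continuous_subspaceT.
move=> /compact_bounded[M [_ hM]].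
exists (`|M| + 1); first by rewrite addr_ge0.
move=> x; have [xr|xr] := leP `|x| r; last by rewrite su// normr0 addr_ge0.
apply: (hM (`|M| + 1)); last by exists x.
by rewrite (le_lt_trans (ler_norm M))// ltrDl.
Qed.

Lemma partial_supported u r i : supported u r -> supported (fun x => 'D_(e_ i) u x) r.
Proof.
move=> su x rx.
have : \forall y \near x, (fun=> 0 : R) y = u y.
  have : open [set y : E | r < `|y|].
    have -> : [set y : E | r < `|y|] = (fun x : E => `|x|) @^-1` [set t | r < t] by [].
    by apply: open_comp; [move=> z _; exact: norm_continuous|exact: open_gt].
  move=> oU; have : nbhs x [set y : E | r < `|y|] by apply: open_nbhs_nbhs; split.
  by apply: filterS => y /= /su ->.
by move=> /near_eq_derive <-; rewrite derive_cst.
Qed.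

Lemma MVT_coord u i x (h M : R) : smooth u -> (forall y, `|'D_(e_ i) u y| <= M) ->
  `|u (h *: e_ i + x) - u x| <= M * `|h|.
Proof.
move=> su hM.
pose g (t : R) := u (t *: e_ i + x).
have dg (t : R) : is_derive t (1 : R) g ('D_(e_ i) u (t *: e_ i + x)).
  by apply: is_derive_line; exact: smooth_derivable.
have cg : continuous g by move=> t; apply/differentiable_continuous/derivable1_diffP; case: (dg t).
have main (a b : R) : a <= b -> `|g b - g a| <= M * (b - a).
  move=> ab; have [|c _ ->] := MVT_segment ab (fun t _ => dg t).
    exact: continuous_subspaceT.
  by rewrite normrM (ger0_norm (_ : 0 <= b - a)) ?subr_ge0// ler_wpM2r ?subr_ge0.
have -> : u (h *: e_ i + x) - u x = g h - g 0 by rewrite /g scale0r add0r.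
have [h0|h0] := leP 0 h.
  by apply: (le_trans (main _ _ h0)); rewrite subr0 ger0_norm.
by rewrite distrC; apply: (le_trans (main _ _ (ltW h0))); rewrite sub0r ltr0_norm.
Qed.

Lemma partial_bounded u r : smooth u -> supported u r ->
  exists2 M : R, 0 <= M & forall i x, `|'D_(e_ i) u x| <= M.
Proof.
move=> su sr.
have /choice[M hM] : forall i, exists M : R, 0 <= M /\ forall x, `|'D_(e_ i) u x| <= M.
  move=> i; have [M M0 h] := bounded_supported (smooth_continuous (smooth_partial i su)) (partial_supported i sr).
  by exists M.
exists (\sum_i M i); first by apply: sumr_ge0 => i _; case: (hM i).
move=> i x; have [_ h] := hM i; apply: (le_trans (h x)).
by rewrite (bigD1 i)//= lerDl; apply: sumr_ge0 => j _; case: (hM j).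
Qed.

(** The point [y] is joined to [x] by changing one coordinate at a time. *)
Lemma smooth_lipschitz u r : smooth u -> supported u r ->
  exists2 L : R, 0 <= L & forall x y, `|u x - u y| <= L * `|x - y|.
Proof.
move=> su sr; have [M M0 hM] := partial_bounded su sr.
exists (n%:R * M); first exact: mulr_ge0.
move=> x y.
(* The first [k] coordinates are those of [x], the other ones those of [y]. *)
pose z k : E := \row_j (if (j < k)%N then x 0 j else y 0 j).
have z0 : z 0%N = y by apply/rowP => j; rewrite mxE.
have zn : z n = x by apply/rowP => j; rewrite mxE ltn_ord.
have step k : (k < n)%N -> `|u (z k.+1) - u (z k)| <= M * `|x - y|.
  move=> kn; pose i := Ordinal kn.
  have -> : z k.+1 = (x 0 i - y 0 i) *: e_ i + z k.
    apply/rowP => j; rewrite !mxE eqxx /= ltnS leq_eqVlt.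
    have [->|ji] := eqVneq j i; first by rewrite /= eqxx ltnn /= mulr1 subrK.
    have -> : (nat_of_ord j == k) = false by apply/negP => /eqP jk; move/eqP: ji; apply; exact/val_inj.
    by rewrite mulr0 add0r.
  apply: (le_trans (MVT_coord _ _ su (hM i))); rewrite ler_wpM2l//.
  by have := coord_le_norm (x - y) i; rewrite !mxE.
have main k : (k <= n)%N -> `|u (z k) - u (z 0%N)| <= k%:R * (M * `|x - y|).
  elim: k => [_|k IH kn]; first by rewrite subrr normr0 mul0r.
  have -> : u (z k.+1) - u (z 0%N) = (u (z k.+1) - u (z k)) + (u (z k) - u (z 0%N)) by rewrite addrA subrK.
  apply: (le_trans (ler_normD _ _)); rewrite -natr1 mulrDl mul1r addrC lerD//; last exact: step.
  by apply: IH; exact: ltnW.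
by have := main n (leqnn n); rewrite z0 zn mulrA.
Qed.

End smooth_bounded_support.

(** * Bump functions and mollifiers *)

Section bump1.
Context {R : realType}.
Implicit Types (q : {poly R}) (s t : R).
(** The functions [q(1/s) exp(-1/s)] for [s > 0], extended by zero. With [q] a polynomial, this
class is stable under derivation, see [is_derive_expinv]. *)
Definition expinv q s : R := if 0 < s then q.[s^-1] * expR (- s^-1) else 0.

(** Termwise comparison with the exponential series. *)
Lemma poly_le_expR q : exists2 C : R, 0 <= C & forall t, 0 <= t -> `|q.[t]| <= C * expR t.
Proof.
exists (\sum_(i < size q) `|q`_i| * (i`!)%:R).
  by apply: sumr_ge0 => i _; rewrite mulr_ge0.
move=> t t0; rewrite horner_coef; apply: (le_trans (ler_norm_sum _ _ _)).
rewrite mulr_suml; apply: ler_sum => i _; rewrite normrM -mulrA ler_wpM2l//.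
rewrite ger0_norm ?exprn_ge0// -ler_pdivrMl ?ltr0n ?fact_gt0//.
case: (nat_of_ord i) => [|k]; first by rewrite expr0 fact0 invr1 mul1r (le_trans _ (expR_ge1Dx t))// lerDl.
apply: le_trans (expR_ge1Dxn k t0); rewrite mulrC; lra.
Qed.

(** Quadratic vanishing at zero makes the derivative at zero exist and be zero. *)
Lemma expinv_quad q : exists2 C : R, 0 <= C & forall s, `|expinv q s| <= C * s ^+ 2.
Proof.
have [C C0 hC] := poly_le_expR ('X^2 * q); exists C => // s.
rewrite /expinv; case: ltP => s0; last by rewrite normr0 mulr_ge0 ?sqr_ge0.
have := hC s^-1 (ltW (_ : 0 < s^-1)); rewrite invr_gt0 => /(_ s0).
rewrite hornerM hornerXn normrM (ger0_norm (exprn_ge0 _ _)) ?invr_ge0 ?(ltW s0)// => h.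
rewrite normrM (ger0_norm (expR_ge0 _)) expRN -ler_pdivlMr ?invr_gt0 ?expR_gt0// invrK.
rewrite -mulrA (mulrC (s ^+ 2)) mulrA -ler_pdivrMr ?exprn_gt0//.
by rewrite mulrC -exprVn.
Qed.

(** Derivation sends [q(1/s) exp(-1/s)] to a function of the same form, the polynomial becoming [X^2
(q - q')]; at zero this is the quadratic bound. *)
Lemma is_derive_expinv q s : is_derive s 1 (expinv q) (expinv ('X^2 * (q - q^`())) s).
Proof.
have [s0|s0|s0] := ltgtP s 0.
- have -> : expinv ('X^2 * (q - q^`())) s = 0 by rewrite /expinv ltNge (ltW s0).
  apply: (@near_eq_is_derive _ _ _ (cst 0)).
    near=> t; rewrite /expinv ltNge (_ : t <= 0)//; apply: ltW; near: t.
    exact: (@open_nbhs_nbhs _ s [set t | t < 0] (conj (@open_lt R 0) s0)).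
- have -> : expinv ('X^2 * (q - q^`())) s = q.[s^-1] * (expR (- s^-1) * - - s ^- 2) + expR (- s^-1) * (q^`().[s^-1] * - s ^- 2).
    rewrite /expinv s0 hornerM hornerXn hornerD hornerN exprVn; ring.
  have dV : is_derive s (1 : R) (fun t : R => t^-1) (- s ^- 2).
    have := @is_deriveV R id s 1 1 (lt0r_neq0 s0) (is_derive_id _ _).
    by rewrite [_ *: _]mulr1.
  have d1 := is_derive1_comp (is_derive_poly q _) dV.
  have d2 := is_derive1_comp (is_derive_expR _) (is_deriveN dV).
  have := is_deriveM d1 d2; apply: near_eq_is_derive.
  near=> t; rewrite /expinv (_ : 0 < t)//; near: t; exact: lt_nbhsr.
- subst s.
  have -> : expinv ('X^2 * (q - q^`())) 0 = 0 by rewrite /expinv ltxx.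
  have [C C0 hC] := expinv_quad q.
  have lim0 : h^-1 *: (expinv q (h *: (1 : R) + 0) - expinv q 0) @[h --> (0 : R)^'] --> (0 : R).
    apply/cvgr0Pnorm_le => e e0.
    have k0 : 0 < e / (C + 1) by rewrite divr_gt0// ltr_wpDl.
    near=> h.
    rewrite [h *: 1]mulr1 addr0 {2}/expinv ltxx subr0 [_ *: _]mulrC normrM normfV.
    rewrite ler_pdivrMr; last by rewrite normr_gt0; near: h; exact: nbhs_dnbhs_neq.
    apply: (le_trans (hC h)).
    have -> : h ^+ 2 = `|h| * `|h| by rewrite -expr2 real_normK ?num_real.
    rewrite mulrA ler_wpM2r//.
    have hk : `|h| <= e / (C + 1).
      near: h; apply: dnbhs0_le => //.
    have : C * `|h| <= C * (e / (C + 1)) by rewrite ler_wpM2l.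
    move=> /le_trans; apply; rewrite mulrA ler_pdivrMr ?ltr_wpDl//; nra.
  by split; [apply/cvg_ex; exists 0|exact/cvg_lim].
Unshelve. all: by end_near. Qed.

Lemma continuous_expinv q : continuous (expinv q).
Proof.
move=> s; apply/differentiable_continuous/derivable1_diffP.
by case: (is_derive_expinv q s).
Qed.

Lemma expinv1_ge0 s : 0 <= expinv 1 s.
Proof. by rewrite /expinv; case: ifP => //; rewrite hornerC mul1r expR_ge0. Qed.

Lemma expinv1_le1 s : expinv 1 s <= 1.
Proof.
rewrite /expinv; case: ifP => // s0; rewrite hornerC mul1r -expR0 ler_expR.
by rewrite oppr_le0 invr_ge0 ltW.
Qed.

Lemma expinv1_ge s : 2^-1 <= s -> expR (-2) <= expinv 1 s.
Proof.
move=> s2; have s0 : 0 < s by apply: lt_le_trans s2; rewrite invr_gt0.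
rewrite /expinv s0 hornerC mul1r ler_expR lerN2 -[leRHS]invrK lef_pV2 ?posrE//.
Qed.

Lemma expinv_le0 q s : s <= 0 -> expinv q s = 0.
Proof. by rewrite /expinv leNgt => /negbTE ->. Qed.

End bump1.

Section bump.
Context {R : realType} {n : nat}.
Local Notation E := 'rV[R]_n.
Implicit Types (u v : E -> R) (x y a : E) (i : 'I_n).
Local Notation e_ i := (delta_mx 0 i : E).
Local Notation mu := (@lebesgue_rV R n).
Lemma smooth_expinv_coord q (c s : R) i : smooth (fun x => expinv q (c + s * x 0 i)).
Proof.
apply: (smooth_coind (P := fun w => exists b q, w = fun x => b * expinv q (c + s * x 0 i))); last first.
  by exists 1, q; apply/funext => x; rewrite mul1r.
move=> _ [b [{}q ->]]; split.
  move=> x; apply: (@cvgM _ _ (nbhs x) _ (fun=> b) (fun x => expinv q (c + s * x 0 i))); first exact: cvg_cst.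
  apply: (@continuous_comp _ _ _ (fun x => c + s * x 0 i) (expinv q)); last exact: continuous_expinv.
  apply: (@cvgD _ _ _ (nbhs x) _ (fun=> c) (fun x => s * x 0 i)); first exact: cvg_cst.
  by apply: (@cvgM _ _ (nbhs x) _ (fun=> s) (fun x => x 0 i)); [exact: cvg_cst|exact: coord_continuous].
move=> j.
pose k := s * (e_ j) 0 i.
have h x : is_derive x (e_ j) (fun x => b * expinv q (c + s * x 0 i)) (b * (expinv ('X^2 * (q - q^`())) (c + s * x 0 i) * k)).
  apply: is_deriveZ; apply: is_derive_line0.
  rewrite (_ : (fun h : R => _) = expinv q \o (fun h : R => k *: h + (c + s * x 0 i))); last first.
    by apply/funext => t /=; rewrite !mxE /k !mxE; congr expinv; rewrite /GRing.scale/=; ring.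
  apply: is_derive1_comp; first by rewrite scaler0 add0r; exact: is_derive_expinv.
  have := @is_deriveD R R R _ _ 0 1 _ _ (@is_deriveZ R R R id k 0 1 1 (is_derive_id _ _)) (is_derive_cst (c + s * x 0 i) (0 : R) (1 : R)).
  by rewrite addr0 [k *: (1 : R)]mulr1.
split; first by move=> x; have [] := h x.
exists (b * k), ('X^2 * (q - q^`())).
by apply/funext => x; rewrite (@derive_val _ _ _ _ _ _ _ (h x)); ring.
Qed.

(** A product over the coordinates, so that it is supported in a cube, the unit ball of the norm of
the space. *)
Definition bump x : R := \prod_i (expinv 1 (1 - x 0 i) * expinv 1 (1 + x 0 i)).

Lemma smooth_bump : smooth bump.
Proof.
apply: smooth_prod => i; apply: smoothM.
  have := smooth_expinv_coord 1 1 (-1) i.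
  by under eq_fun do rewrite mulN1r.
have := smooth_expinv_coord 1 1 1 i.
by under eq_fun do rewrite mul1r.
Qed.

Lemma bump_ge0 x : 0 <= bump x.
Proof. by apply: prodr_ge0 => i _; rewrite mulr_ge0 ?expinv1_ge0. Qed.

Lemma bump_le1 x : bump x <= 1.
Proof.
suff /andP[] : 0 <= bump x <= 1 by [].
apply: (big_ind (fun p : R => 0 <= p <= 1)); first by rewrite ler01 lexx.
  by move=> p q /andP[p0 p1] /andP[q0 q1]; rewrite mulr_ge0//= mulr_ile1.
by move=> i _; rewrite mulr_ge0 ?expinv1_ge0//= mulr_ile1 ?expinv1_ge0 ?expinv1_le1.
Qed.

Lemma bump_even x : bump (- x) = bump x.
Proof. by apply: eq_bigr => i _; rewrite mxE opprK mulrC. Qed.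

Lemma bump_supp x : 1 <= `|x| -> bump x = 0.
Proof.
move=> x1.
have [i xi] : exists i, 1 <= `|x 0 i|.
  have x0 : mx_norm x != 0.
    by apply/negP => /eqP x0; move: x1; have -> : `|x| = mx_norm x by []; rewrite x0 ler10.
  have [[a i] /= hx] := mx_norm_neq0 x0; exists i.
  by move: x1; have -> : `|x| = mx_norm x by []; rewrite hx (ord1 a).
rewrite /bump (bigD1 i)//=.
have [x0|x0] := leP 0 (x 0 i).
  by rewrite (expinv_le0 _ (_ : 1 - x 0 i <= 0)) ?mul0r// subr_le0 -(ger0_norm x0).
rewrite (expinv_le0 1 (_ : 1 + x 0 i <= 0)) ?mulr0 ?mul0r//.
by move: xi; rewrite ltr0_norm// => xi; lra.
Qed.

(** A lower bound on a small cube bounds the integral of the bump from below, hence its normalized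
version from above. *)
Lemma bump_ge x : `|x| <= 2^-1 -> expR (-2) ^+ (n * 2) <= bump x.
Proof.
move=> /(norm_rV_leP _ (ltW (_ : 0 < 2^-1 :> R))); rewrite invr_gt0 => /(_ ltac:(by [])) h.
rewrite mulnC exprM -[X in _ ^+ X <= _](card_ord n) -prodr_const; apply: ler_prod => i _.
rewrite exprn_ge0 ?expR_ge0//= expr2 ler_pM ?expR_ge0// expinv1_ge//.
  by have := h i; rewrite ler_norml => /andP[_ ?]; lra.
by have := h i; rewrite ler_norml => /andP[? _]; lra.
Qed.

End bump.

Definition nball {R : realType} {n} (a : 'rV[R]_n) (r : R) : set 'rV[R]_n := [set x | `|x - a| <= r].

Section mollifier.
Context {R : realType} {n : nat}.
Local Notation E := 'rV[R]_n.
Implicit Types (u v : E -> R) (x y a : E) (i : 'I_n).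
Local Notation mu := (@lebesgue_rV R n).
Lemma measurable_smooth u : smooth u -> measurable_fun setT u.
Proof. by move=> su; apply: continuous_measurable_rV; exact: smooth_continuous. Qed.

Lemma measurable_normball a (r : R) : measurable (nball a r).
Proof.
apply: closed_measurable_rV.
rewrite /nball; have -> : [set x : E | `|x - a| <= r] = (fun x => x - a) @^-1` [set x | `|x| <= r] by [].
by apply: closed_comp; [move=> x _; exact: continuous_addv|exact: closed_normball].
Qed.

Lemma mu_normball_le a (r : R) : 0 <= r -> (mu (nball a r) <= ((2 * r) ^+ n)%:E)%E.
Proof.
move=> r0; rewrite -(lebesgue_cube (a - const_mx r)) ?mulr_ge0//.
by apply: le_measure; rewrite ?inE; [exact: measurable_normball|exact: measurable_cube|move=> x /=; exact: normr_cube].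
Qed.

Lemma mu_normball_fin a (r : R) : (mu (nball a r) < +oo)%E.
Proof.
have [r0|r0] := leP 0 r; first by apply: le_lt_trans (mu_normball_le a r0) (ltry _).
rewrite (_ : nball a r = set0) ?measure0// -subset0 => x /= h.
by have := lt_le_trans r0 (le_trans (normr_ge0 _) h); rewrite ltxx.
Qed.

Lemma Rintegral_supp (D : set E) u : (forall x, ~ D x -> u x = 0) -> \int[mu]_x u x = \int[mu]_(x in D) u x.
Proof.
move=> h; rewrite [RHS]Rintegral_mkcondT; apply: eq_Rintegral => x _.
by case: ifPn => // /negP; rewrite inE => /h.
Qed.

Lemma integrable_supp (D : set E) u : measurable D -> (forall x, ~ D x -> u x = 0) -> mu.-integrable D (EFin \o u) -> mu.-integrable setT (EFin \o u).
Proof.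
move=> mD h; move/(integrable_mkcond _ _ mD); congr (_.-integrable _ _); apply/funext => x /=.
by case: ifPn => // /negP; rewrite inE => /h ->.
Qed.

Lemma supported_integrable u (r : R) : smooth u -> supported u r -> mu.-integrable setT (EFin \o u).
Proof.
move=> su sr; have [M M0 hM] := bounded_supported (smooth_continuous su) sr.
have mB := measurable_normball 0 r.
apply: (integrable_supp mB).
  by move=> x /negP; rewrite /= subr0 -ltNge => /sr.
apply: (integrable_bounded (M := M) mB) => //; first exact: mu_normball_fin.
exact: measurable_funS (measurable_smooth su).
Qed.

Definition scaled_bump (e : R) x := bump (e^-1 *: x).

Definition moll (e : R) x := (\int[mu]_x scaled_bump e x)^-1 * scaled_bump e x.

Definition bump_const : R := (expR (-2) ^+ (n * 2))^-1.

Lemma bump_const_gt0 : 0 < bump_const.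
Proof. by rewrite invr_gt0 exprn_gt0 ?expR_gt0. Qed.

Lemma smooth_scaled_bump e : smooth (scaled_bump e).
Proof. by have := smooth_affine e^-1 0 (@smooth_bump R n); under eq_fun do rewrite addr0. Qed.

Lemma scaled_bump_supp e x : 0 < e -> e <= `|x| -> scaled_bump e x = 0.
Proof.
move=> e0 ex; apply: bump_supp; rewrite normrZ normfV gtr0_norm//.
by rewrite mulrC ler_pdivlMr// mul1r.
Qed.

Lemma scaled_bump_int e : 0 < e -> e ^+ n / bump_const <= \int[mu]_x scaled_bump e x.
Proof.
move=> e0.
have mC : measurable (cube (0 - const_mx (e / 2)) e : set E) by exact: measurable_cube.
have iT : mu.-integrable setT (EFin \o scaled_bump e).
  apply: (@supported_integrable _ e); first exact: smooth_scaled_bump.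
  by move=> x /ltW; exact: scaled_bump_supp.
have iC := integrableS measurableT mC (@subsetT _ _) iT.
have -> : e ^+ n / bump_const = \int[mu]_(x in cube (0 - const_mx (e / 2)) e) bump_const^-1.
  by rewrite Rintegral_cst// lebesgue_cube_fine ?(ltW e0)// mulrC.
apply: (@le_trans _ _ (\int[mu]_(x in cube (0 - const_mx (e / 2)) e) scaled_bump e x)).
  apply: le_Rintegral => //; first by apply: integrable_cst => //=; rewrite [X in (X < _)%E](lebesgue_cube _ (ltW e0)) ltry.
  move=> x hx; rewrite /bump_const invrK; apply: bump_ge.
  rewrite normrZ normfV gtr0_norm// mulrC ler_pdivrMr//.
  apply/norm_rV_leP => [|i]; first by rewrite mulr_ge0// ltW.
  by have := hx i; rewrite !mxE ler_norml => /andP[? ?]; apply/andP; split; lra.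
rewrite [leLHS]Rintegral_mkcondT; apply: le_Rintegral => //.
  by have /(integrable_mkcond _ _ mC) := iC.
by move=> x _; case: ifP => // _; exact: bump_ge0.
Qed.

Lemma scaled_bump_int_gt0 e : 0 < e -> 0 < \int[mu]_x scaled_bump e x.
Proof. by move=> e0; apply: lt_le_trans (scaled_bump_int e0); rewrite divr_gt0 ?exprn_gt0// bump_const_gt0. Qed.

Lemma smooth_moll e : smooth (moll e).
Proof. by apply: smoothZ; exact: smooth_scaled_bump. Qed.

Lemma moll_ge0 e x : 0 < e -> 0 <= moll e x.
Proof. by move=> e0; rewrite mulr_ge0 ?bump_ge0// invr_ge0 ltW// scaled_bump_int_gt0. Qed.

Lemma moll_supp e x : 0 < e -> e <= `|x| -> moll e x = 0.
Proof. by move=> e0 ex; rewrite /moll scaled_bump_supp// mulr0. Qed.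

Lemma moll_even e x : moll e (- x) = moll e x.
Proof. by rewrite /moll /scaled_bump scalerN bump_even. Qed.

Lemma moll_evenB e x y : moll e (x - y) = moll e (y - x).
Proof. by rewrite -moll_even opprB. Qed.

(** The constant does not depend on [e]: oscillation estimates are applied to mollifiers of
arbitrarily small scale. *)
Lemma moll_le e x : 0 < e -> moll e x <= bump_const / e ^+ n.
Proof.
move=> e0; rewrite /moll -[leRHS]mulr1 ler_pM ?bump_ge0 ?bump_le1//.
  by rewrite invr_ge0 ltW// scaled_bump_int_gt0.
rewrite -[bump_const]invrK -invfM lef_pV2 ?posrE ?scaled_bump_int_gt0//.
  by rewrite mulrC scaled_bump_int.
by rewrite mulr_gt0 ?exprn_gt0// invr_gt0 bump_const_gt0.
Qed.

Lemma moll_int e x : 0 < e -> \int[mu]_y moll e (y - x) = 1.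
Proof.
move=> e0; have mm := measurable_smooth (smooth_moll e).
rewrite (Rintegral_translate (- x) mm) /moll RintegralZl//.
  by rewrite mulVf// gt_eqF// scaled_bump_int_gt0.
apply: (@supported_integrable _ e); first exact: smooth_scaled_bump.
by move=> y /ltW; exact: scaled_bump_supp.
Qed.

Lemma moll_supported e : 0 < e -> supported (moll e) e.
Proof. by move=> e0 x /ltW; exact: moll_supp. Qed.

End mollifier.

(** * Convolution with smooth functions *)

Section convolution.
Context {R : realType} {n : nat}.
Local Notation E := 'rV[R]_n.
Implicit Types (u v w : E -> R) (x y a : E) (i : 'I_n).
Local Notation e_ i := (delta_mx 0 i : E).
Local Notation mu := (@lebesgue_rV R n).
(** Taylor formula of order one, which bounds difference quotients uniformly. *)
Lemma taylor_coord u i x (h L : R) : smooth u ->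
  (forall y z, `|'D_(e_ i) u y - 'D_(e_ i) u z| <= L * `|y - z|) -> 0 <= L ->
  `|u (h *: e_ i + x) - u x - h * 'D_(e_ i) u x| <= L * h ^+ 2.
Proof.
move=> su hL L0.
pose k := 'D_(e_ i) u x.
pose g (t : R) := u (t *: e_ i + x) - t * k.
have dg (t : R) : is_derive t (1 : R) g ('D_(e_ i) u (t *: e_ i + x) - k).
  apply: is_deriveB; first by apply: is_derive_line; exact: smooth_derivable.
  have := @is_deriveZ R R R id k t 1 1 (is_derive_id _ _).
  by rewrite [k *: (1 : R)]mulr1; congr (is_derive _ _ _ _); apply/funext => s; rewrite mulrC.
have cg : continuous g by move=> t; apply/differentiable_continuous/derivable1_diffP; case: (dg t).
have ne : `|e_ i : E| <= 1.
  by apply/norm_rV_leP => // j; rewrite mxE; case: (_ && _); rewrite ?normr1 ?normr0.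
have bd (t : R) : `|t| <= `|h| -> `|'D_(e_ i) u (t *: e_ i + x) - k| <= L * `|h|.
  move=> th; apply: (le_trans (hL _ _)); rewrite addrK normrZ ler_wpM2l//.
  by apply: le_trans th; rewrite ler_piMr.
have main (p q : R) : p <= q -> `|p| <= `|h| -> `|q| <= `|h| -> `|g q - g p| <= L * `|h| * (q - p).
  move=> pq ph qh; have [|c] := MVT_segment pq (fun t _ => dg t).
    exact: continuous_subspaceT.
  rewrite in_itv/= => /andP[pc cq] ->.
  rewrite normrM (ger0_norm (_ : 0 <= q - p)) ?subr_ge0// ler_wpM2r ?subr_ge0// bd//.
  move: ph qh; rewrite !ler_norml => /andP[? ?] /andP[? ?]; apply/andP; split; lra.
have -> : u (h *: e_ i + x) - u x - h * 'D_(e_ i) u x = g h - g 0.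
  by rewrite /g scale0r add0r mul0r subr0 addrAC.
have -> : L * h ^+ 2 = L * `|h| * `|h| by rewrite -mulrA -expr2 real_normK ?num_real.
have [h0|h0] := leP 0 h.
  by apply: (le_trans (main _ _ h0 _ _)); rewrite ?normr0// subr0 ger0_norm.
by rewrite distrC; apply: (le_trans (main _ _ (ltW h0) _ _)); rewrite ?normr0// sub0r ltr0_norm.
Qed.

Definition locint u := measurable_fun setT u /\ forall a r, mu.-integrable (nball a r) (EFin \o u).

Lemma locint_integrable u w a (r M : R) : locint u -> measurable_fun setT w -> 0 <= M ->
  (forall y, `|w y| <= `|u y| * M) -> (forall y, ~ nball a r y -> w y = 0) ->
  mu.-integrable setT (EFin \o w).
Proof.
move=> [mu_ iu] mw M0 wu w0; have mB := @measurable_normball R n a r.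
have iB : mu.-integrable (nball a r) (EFin \o (fun y => M * `|u y|)).
  by apply: RintegrableZ => //; exact: (integrable_abse (iu a r)).
have mwB : measurable_fun (nball a r) w by exact: measurable_funS mw.
apply: (integrable_supp mB w0).
by apply: (integrable_dom mB mwB _ iB) => y _; rewrite mulrC.
Qed.

(** The estimate of a convolution and of its difference quotients: the second factor is bounded and
the integral is over one ball. *)
Lemma locint_le u w a (r M : R) : locint u -> measurable_fun setT w -> 0 <= M ->
  (forall y, `|w y| <= `|u y| * M) -> (forall y, ~ nball a r y -> w y = 0) ->
  `|\int[mu]_y w y| <= \int[mu]_(y in nball a r) `|u y| * M.
Proof.
move=> [mu_ iu] mw M0 wu w0; have mB := @measurable_normball R n a r.
have iB : mu.-integrable (nball a r) (EFin \o (fun y => M * `|u y|)).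
  by apply: RintegrableZ => //; exact: (integrable_abse (iu a r)).
have mwB : measurable_fun (nball a r) w by exact: measurable_funS mw.
rewrite (Rintegral_supp w0).
rewrite -[X in _ <= X]mulrC -RintegralZl//; last exact: (integrable_abse (iu a r)).
by apply: Rintegral_le_dom => // y _; rewrite mulrC.
Qed.

(** The reflected convolution: with an even mollifier it is the usual one. *)
Definition conv u (w : E -> R) x : R := \int[mu]_y (u y * w (y - x)).

Lemma measurable_conv_in u w x : measurable_fun setT u -> continuous w -> measurable_fun setT (fun y => u y * w (y - x)).
Proof.
move=> mu_ cw; apply: measurable_funM => //.
by apply: (measurableT_comp (continuous_measurable_rV cw)); exact: measurable_addv.
Qed.

Lemma conv_integrable u w x (r : R) : locint u -> continuous w -> supported w r ->
  mu.-integrable setT (EFin \o (fun y => u y * w (y - x))).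
Proof.
move=> lu cw sw; have [M M0 hM] := bounded_supported cw sw.
apply: (@locint_integrable u (fun y => u y * w (y - x)) x r M lu _ M0).
- by apply: measurable_conv_in => //; case: lu.
- by move=> y; rewrite normrM ler_wpM2l.
- by move=> y /negP; rewrite /nball/= -ltNge => /sw ->; rewrite mulr0.
Qed.

Lemma continuous_lipschitz_loc (f : E -> R) : (forall x, exists2 L : R, 0 <= L & forall y, `|y - x| <= 1 -> `|f y - f x| <= L * `|y - x|) ->
  continuous f.
Proof.
move=> h; suff H (x : E) : f y @[y --> x] --> f x by move=> x; exact: H.
have [L L0 hL] := h x.
apply/(@cvgrPdist_le R R E (nbhs x) (nbhs_filter x) f (f x)) => e e0; have k0 : 0 < Num.min 1 (e / (L + 1)).
  by rewrite lt_min ltr01 divr_gt0// ltr_wpDl.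
near=> y.
have yx : `|y - x| <= Num.min 1 (e / (L + 1)).
  rewrite distrC; near: y.
  have := @cvgr_dist_le R E E (nbhs x) (nbhs_filter x) id x (fun A => id) _ k0; exact.
move: yx; rewrite le_min => /andP[y1 y2].
rewrite distrC; apply: (le_trans (hL _ y1)).
have : L * `|y - x| <= L * (e / (L + 1)) by rewrite ler_wpM2l.
move=> /le_trans; apply; rewrite mulrA ler_pdivrMr ?ltr_wpDl//; nra.
Unshelve. all: by end_near. Qed.

(** Derivatives fall on the smooth factor, with a sign: [D_i (u * w) = u * (- D_i w)]. The class of
all [u * w] with [w] smooth of bounded support is therefore stable under partial derivatives. *)
Lemma smooth_conv u w (r : R) : locint u -> smooth w -> supported w r -> smooth (conv u w).
Proof.
move=> lu sw wr.
have [mu_ _] := lu.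
apply: (smooth_coind (P := fun f => exists w, [/\ smooth w, supported w r & f = conv u w])); last by exists w.
move=> _ [{sw wr}w [sw wr ->]].
have cw := smooth_continuous sw.
split.
  have [L L0 hL] := smooth_lipschitz sw wr.
  apply: continuous_lipschitz_loc => x.
  exists (\int[mu]_(y in nball x (r + 1)) `|u y| * L).
    by rewrite mulr_ge0// Rintegral_ge0.
  move=> x' xx'; rewrite /conv -RintegralB//; try exact: (@conv_integrable _ _ _ r).
  apply: (le_trans (@locint_le u (fun y => u y * w (y - x') - u y * w (y - x)) x (r + 1) (L * `|x' - x|) lu _ _ _ _)).
  - by apply: measurable_funB; exact: measurable_conv_in.
  - by rewrite mulr_ge0.
  - move=> y; rewrite -mulrBr normrM ler_wpM2l//; apply: (le_trans (hL _ _)).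
    by rewrite opprB addrC addrA subrK distrC.
  - move=> y /negP; rewrite /nball/= -ltNge => yx.
    have yx1 : r < `|y - x| by apply: lt_trans yx; rewrite ltrDl.
    rewrite (wr _ yx1) wr ?mulr0 ?subrr//.
    have : `|y - x| <= `|y - x'| + `|x' - x| by rewrite (_ : y - x = (y - x') + (x' - x)) ?ler_normD// addrA subrK.
    by lra.
  by rewrite mulrA.
move=> i.
pose w' y := - 'D_(e_ i) w y.
have sw' : smooth w' by exact/smoothN/smooth_partial.
have wr' : supported w' r by move=> y ry; rewrite /w' (partial_supported i wr) ?oppr0.
have [L L0 hL] := smooth_lipschitz sw' wr'.
have hL' y z : `|'D_(e_ i) w y - 'D_(e_ i) w z| <= L * `|y - z|.
  by have := hL y z; rewrite /w' -opprD normrN.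
have ne : `|e_ i : E| <= 1.
  by apply/norm_rV_leP => // j; rewrite mxE; case: (_ && _); rewrite ?normr1 ?normr0.
have key x : (fun h : R => h^-1 *: (conv u w (h *: e_ i + x) - conv u w x)) @ (0 : R)^' --> conv u w' x.
  pose I := \int[mu]_(y in nball x (r + 1)) `|u y|.
  have I0 : 0 <= I by exact: Rintegral_ge0.
  apply/cvgrPdist_le => e e0.
  have k0 : 0 < Num.min 1 (e / (I * L + 1)).
    by rewrite lt_min ltr01 divr_gt0// ltr_wpDl ?mulr_ge0.
  near=> h.
  have h0 : h != 0 by near: h; exact: nbhs_dnbhs_neq.
  have : `|h| <= Num.min 1 (e / (I * L + 1)) by near: h; exact: dnbhs0_le.
  rewrite le_min => /andP[h1 h2].
  have hx : `|h *: e_ i| <= `|h| by rewrite normrZ ler_piMr.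
  rewrite [_ *: _]mulrC distrC -(mulfK h0 (conv u w' x)) -mulrBl normrM normfV ler_pdivrMr ?normr_gt0//.
  rewrite [conv u w' x * h]mulrC /conv -RintegralZl//; last exact: (@conv_integrable u w' x r lu (smooth_continuous sw') wr').
  have i1 := @conv_integrable u w (h *: e_ i + x) r lu cw wr.
  have i2 := @conv_integrable u w x r lu cw wr.
  have i3 := RintegrableZ h measurableT (@conv_integrable u w' x r lu (smooth_continuous sw') wr').
  rewrite -RintegralB// -RintegralB//; last exact: RintegrableB.
  apply: (le_trans (@locint_le u (fun y => u y * w (y - (h *: e_ i + x)) - u y * w (y - x) - h * (u y * w' (y - x))) x (r + 1) (L * h ^+ 2) lu _ _ _ _)).
  - apply: measurable_funB; first by apply: measurable_funB; exact: measurable_conv_in.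
    by apply: measurable_funM => //; apply: measurable_conv_in => //; exact: smooth_continuous.
  - by rewrite mulr_ge0 ?sqr_ge0.
  - move=> y; have := @taylor_coord w i (y - x) (- h) L sw hL' L0.
    rewrite sqrrN => /(ler_wpM2l (normr_ge0 (u y))); apply: le_trans; rewrite -normrM.
    have -> : - h *: e_ i + (y - x) = y - (h *: e_ i + x) by rewrite opprD scaleNr addrCA addrA.
    by rewrite le_eqVlt; apply/orP; left; apply/eqP; congr `| _ |; rewrite /w'; ring.
  - move=> y /negP; rewrite /nball/= -ltNge => yx.
    have yx1 : r < `|y - x| by apply: lt_trans yx; rewrite ltrDl.
    rewrite (wr _ yx1) (wr' _ yx1) wr ?mulr0 ?subrr//.
    have : `|y - x| <= `|y - (h *: e_ i + x)| + `|h *: e_ i|.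
      by rewrite -[X in X <= _](_ : `|(y - (h *: e_ i + x)) + h *: e_ i| = _) ?ler_normD// opprD addrA addrAC subrK.
    by lra.
  rewrite -/I.
  rewrite -(real_normK (num_real h)) expr2 !mulrA ler_wpM2r//.
  have : I * L * `|h| <= I * L * (e / (I * L + 1)) by rewrite ler_wpM2l// mulr_ge0.
  have IL : 0 <= I * L by rewrite mulr_ge0.
  move=> /le_trans; apply; rewrite mulrA ler_pdivrMr ?ltr_wpDl//; nra.
split; first by move=> x; apply/cvg_ex; exists (conv u w' x); exact: key.
exists w'; split => //; apply/funext => x; apply/cvg_lim => //; exact: key.
Unshelve. all: by end_near. Qed.

End convolution.

(** * Test functions *)

Section supports.
Context {R : realType} {n : nat}.
Local Notation E := 'rV[R]_n.
Implicit Types (f g : E -> R[i]) (u v w : E -> R) (x y a : E) (i : 'I_n).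
Local Notation mu := (@lebesgue_rV R n).
(** The support is a closure, so it is enough to control the points where the function does not
vanish. *)
Lemma csupp_sub f (A : set E) : closed A -> (forall x, ~ A x -> f x = 0) -> csupp f `<=` A.
Proof.
move=> cA fA; rewrite /csupp; move/closure_id : cA => ->; apply: closure_subset => x /= /eqP fx.
by apply: contrapT => /fA.
Qed.

Lemma csupp_out f x : ~ csupp f x -> f x = 0.
Proof. by move=> h; apply: contrapT => /eqP fx; apply: h; exact: subset_closure. Qed.

Definition csupported f (r : R) := forall x, r < `|x| -> f x = 0.

Lemma csupported_ReIm f r : csupported f r -> supported (fun x => complex.Re (f x)) r /\ supported (fun x => complex.Im (f x)) r.
Proof. by move=> h; split=> x /h ->. Qed.

Lemma test_csmooth f : test f -> csmooth f.
Proof. by case. Qed.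

Lemma test_supported f : test f -> exists2 r : R, 0 <= r & csupported f r.
Proof.
move=> [_ /compact_bounded[M [_ hM]]]; exists (`|M| + 1); first by rewrite addr_ge0.
move=> x rx; apply: csupp_out => /(hM (`|M| + 1)) h.
have /h : M < `|M| + 1 by rewrite (le_lt_trans (ler_norm M))// ltrDl.
by move=> /(lt_le_trans rx); rewrite ltxx.
Qed.

(** Compact support is bounded support, in finite dimension. *)
Lemma testP f (r : R) : csmooth f -> csupported f r -> test f.
Proof.
move=> sf fr; split => //.
apply: (subclosed_compact _ (@compact_normball R n r)); first exact: closed_closure.
apply: csupp_sub; first exact: closed_normball.
by move=> x /negP; rewrite /= -ltNge => /fr.
Qed.

Lemma csmooth_real u : smooth u -> csmooth (fun x => (u x)%:C).
Proof. move=> su; split; [exact: su|exact: smooth_cst]. Qed.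

Lemma csmoothD f g : csmooth f -> csmooth g -> csmooth (fun x => f x + g x).
Proof.
move=> [f1 f2] [g1 g2]; split.
  by under eq_fun do rewrite Re_add; exact: (smoothD f1 g1).
by under eq_fun do rewrite Im_add; exact: (smoothD f2 g2).
Qed.

Lemma csmoothM f g : csmooth f -> csmooth g -> csmooth (fun x => f x * g x).
Proof.
move=> [f1 f2] [g1 g2]; split.
  by under eq_fun do rewrite Re_mul; exact: (smoothB (smoothM f1 g1) (smoothM f2 g2)).
by under eq_fun do rewrite Im_mul; exact: (smoothD (smoothM f1 g2) (smoothM f2 g1)).
Qed.

Lemma csmooth_cst (c : R[i]) : csmooth (fun _ : E => c).
Proof. by split; exact: smooth_cst. Qed.

Lemma csmooth_affine f (c : R) a : csmooth f -> csmooth (fun x => f (c *: x + a)).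
Proof. by move=> [f1 f2]; split; [exact: smooth_affine f1|exact: smooth_affine f2]. Qed.

Lemma test_real u (r : R) : smooth u -> supported u r -> test (fun x => (u x)%:C).
Proof. by move=> su ur; apply: (@testP _ r); [exact: csmooth_real|move=> x /ur ->]. Qed.

Lemma testD f g : test f -> test g -> test (fun x => f x + g x).
Proof.
move=> tf tg; have [r r0 hr] := test_supported tf; have [s s0 hs] := test_supported tg.
apply: (@testP _ (r + s)); first by apply: csmoothD; exact: test_csmooth.
by move=> x rsx; rewrite hr ?hs ?addr0//; apply: le_lt_trans rsx; [rewrite lerDr|rewrite lerDl].
Qed.

Lemma testM f g : csmooth f -> test g -> test (fun x => f x * g x).
Proof.
move=> sf tg; have [r r0 hr] := test_supported tg.
apply: (@testP _ r); first exact: (csmoothM sf (test_csmooth tg)).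
by move=> x /hr ->; rewrite mulr0.
Qed.

Lemma testZ (c : R[i]) f : test f -> test (fun x => c * f x).
Proof. exact: (testM (csmooth_cst c)). Qed.

Lemma testB f g : test f -> test g -> test (fun x => f x - g x).
Proof.
by move=> tf /(testZ (-1)) tg; have := testD tf tg; under [X in test X -> _]eq_fun do rewrite mulN1r.
Qed.

Lemma test_cmeasurable f : csmooth f -> cmeasurable setT f.
Proof. by move=> [f1 f2]; split; [exact: (measurable_smooth f1)|exact: (measurable_smooth f2)]. Qed.

Lemma test_bounded f : test f -> exists2 M : R, 0 <= M & forall x, normc (f x) <= M.
Proof.
move=> tf; have [r r0 /csupported_ReIm[h1 h2]] := test_supported tf; have [s1 s2] := test_csmooth tf.
have [M1 M10 b1] := bounded_supported (smooth_continuous s1) h1.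
have [M2 M20 b2] := bounded_supported (smooth_continuous s2) h2.
exists (M1 + M2); first exact: addr_ge0.
by move=> x; apply: (le_trans (normc_le_ReIm _)); exact: lerD.
Qed.

Lemma test_integrable f : test f -> cintegrable mu setT f.
Proof.
move=> tf; have [r r0 /csupported_ReIm[h1 h2]] := test_supported tf; have [s1 s2] := test_csmooth tf.
by split; [exact: (supported_integrable s1 h1)|exact: (supported_integrable s2 h2)].
Qed.

Lemma test_lipschitz f : test f -> exists2 L : R, 0 <= L & forall x y, normc (f x - f y) <= L * `|x - y|.
Proof.
move=> tf; have [r r0 /csupported_ReIm[h1 h2]] := test_supported tf; have [s1 s2] := test_csmooth tf.
have [M1 M10 b1] := smooth_lipschitz s1 h1.
have [M2 M20 b2] := smooth_lipschitz s2 h2.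
exists (M1 + M2); first exact: addr_ge0.
move=> x y; apply: (le_trans (normc_le_ReIm _)); rewrite !ReImE mulrDl; exact: lerD.
Qed.

Lemma iter_partial_supported u (r : R) s : supported u r -> supported (iter_partial s u) r.
Proof. by move=> ur; elim: s => [//|i s IH]; exact: partial_supported. Qed.

Lemma iter_partial_bounded u (r : R) N : smooth u -> supported u r ->
  exists2 M : R, 0 <= M & forall s, (size s <= N)%N -> forall x, `|iter_partial s u x| <= M.
Proof.
elim: N u => [|N IH] u su ur.
  have [M M0 hM] := bounded_supported (smooth_continuous su) ur.
  by exists M => // s; rewrite leqn0 size_eq0 => /eqP ->.
have /choice[M hM] : forall i, exists M : R, 0 <= M /\ forall s, (size s <= N)%N -> forall x, `|iter_partial s (fun x => 'D_(delta_mx 0 i) u x) x| <= M.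
  by move=> i; have [M M0 hM] := IH _ (smooth_partial i su) (partial_supported i ur); exists M.
have [M0 M00 hM0] := bounded_supported (smooth_continuous su) ur.
have S0 : 0 <= \sum_i M i by apply: sumr_ge0 => i _; case: (hM i).
exists (M0 + \sum_i M i); first exact: addr_ge0.
elim/last_ind => [_ x|s i _]; first by apply: (le_trans (hM0 x)); rewrite lerDl.
rewrite size_rcons ltnS => sN x; rewrite iter_partial_rcons.
have [_ /(_ s sN x) h] := hM i; apply: (le_trans h).
rewrite (bigD1 i)//= addrCA lerDl addr_ge0//; apply: sumr_ge0 => j _; case: (hM j) => //.
Qed.

(** A bounded support bounds both the weight and the derivatives. *)
Lemma test_schwartz f : test f -> schwartz f.
Proof.
move=> tf; split; first exact: test_csmooth.
move=> N; have [r r0 /csupported_ReIm[h1 h2]] := test_supported tf; have [s1 s2] := test_csmooth tf.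
have [M1 M10 b1] := iter_partial_bounded N s1 h1.
have [M2 M20 b2] := iter_partial_bounded N s2 h2.
apply: (@le_lt_trans _ _ ((1 + n%:R * r) ^+ N * (M1 + M2))%:E); last exact: ltry.
apply: ge_ereal_sup => _ [[s x] /= sN <-]; rewrite lee_fin.
have K0 : 0 <= (1 + n%:R * r) ^+ N by rewrite exprn_ge0// addr_ge0// mulr_ge0.
have [xr|rx] := leP `|x| r; last first.
  rewrite /citer_partial (iter_partial_supported s h1 rx) (iter_partial_supported s h2 rx).
  by rewrite expr0n /= addr0 sqrtr0 mulr0 mulr_ge0// addr_ge0.
apply: ler_pM; first by rewrite exprn_ge0// addr_ge0// enorm_ge0.
- exact: sqrtr_ge0.
- apply: lerXn2r; rewrite ?nnegrE ?addr_ge0 ?enorm_ge0 ?mulr_ge0//.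
  by rewrite lerD2l (le_trans (enorm_le x))// ler_wpM2l.
- by apply: (le_trans (normc_le_ReIm (_ +i* _))); apply: lerD; [exact: b1|exact: b2].
Qed.

End supports.

Section coordinate_projection.
Context {R : realType} {n N : nat} (sigma : 'I_n -> 'I_N).
Hypothesis sigma_inj : injective sigma.
Local Notation E := 'rV[R]_n.
Local Notation F := 'rV[R]_N.
(** Selection of coordinates along [sigma]; both block projections of [R^(n + m)] have this form. *)
Definition proj (z : F) : E := \row_j z 0 (sigma j).

Lemma proj_norm (z : F) : `|proj z| <= `|z|.
Proof. by apply/norm_rV_leP => // i; rewrite mxE; exact: coord_le_norm. Qed.

Lemma projB y z : proj (y - z) = proj y - proj z.
Proof. by apply/rowP => i; rewrite !mxE. Qed.

Lemma continuous_proj : continuous proj.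
Proof.
suff H (z : F) : proj y @[y --> z] --> proj z by move=> z; exact: H.
apply/(@cvgrPdist_le R _ _ (nbhs z) (nbhs_filter z) proj (proj z)) => e e0.
have := @cvgr_dist_le R _ _ (nbhs z) (nbhs_filter z) id z (fun A => id) _ e0.
by apply: filterS => y h; apply: le_trans h; rewrite -projB; exact: proj_norm.
Qed.

(** A partial derivative of a function of some of the coordinates is again such a function: a
derivative of the original function for a selected coordinate, and zero for the others. *)
Lemma smooth_proj (u : E -> R) : smooth u -> smooth (fun z => u (proj z)).
Proof.
move=> su.
apply: (smooth_coind (P := fun w => exists u, smooth u /\ w = fun z => u (proj z))); last by exists u.
move=> _ [{su}u [su ->]]; split.
  by move=> z; apply: (@continuous_comp _ _ _ proj u); [exact: continuous_proj|exact: (smooth_continuous su)].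
move=> k.
have lineE z (h : R) : proj (h *: delta_mx 0 k + z) = h *: proj (delta_mx 0 k) + proj z.
  by apply/rowP => j; rewrite !mxE.
have [/existsP[i /eqP ik]|] := boolP [exists i, sigma i == k].
  have pk : proj (delta_mx 0 k) = delta_mx 0 i.
    by apply/rowP => j; rewrite !mxE -ik (inj_eq sigma_inj).
  have h z : is_derive z (delta_mx 0 k) (fun z => u (proj z)) ('D_(delta_mx 0 i) u (proj z)).
    apply: is_derive_line0; rewrite (_ : (fun h : R => _) = (fun h : R => u (h *: delta_mx 0 i + proj z))).
      have := @is_derive_line R n u (proj z) (delta_mx 0 i) 0 (@smooth_derivable _ _ u i _ su).
      by rewrite scale0r add0r.
    by apply/funext => h; rewrite lineE pk.
  split; first by move=> z; case: (h z).
  exists (fun x => 'D_(delta_mx 0 i) u x); split; first exact: (smooth_partial i su).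
  by apply/funext => z; rewrite (@derive_val _ _ _ _ _ _ _ (h z)).
rewrite negb_exists => /forallP nk.
have pk : proj (delta_mx 0 k) = 0.
  by apply/rowP => j; rewrite !mxE (negbTE (nk j)) andbF.
have h z : is_derive z (delta_mx 0 k) (fun z => u (proj z)) 0.
  apply: is_derive_line0; rewrite (_ : (fun h : R => _) = (fun h : R => u (proj z))); first exact: is_derive_cst.
  by apply/funext => h; rewrite lineE pk scaler0 add0r.
split; first by move=> z; case: (h z).
exists (fun=> 0); split; first exact: smooth_cst.
by apply/funext => z; rewrite (@derive_val _ _ _ _ _ _ _ (h z)).
Qed.

Lemma csmooth_proj (f : E -> R[i]) : csmooth f -> csmooth (fun z => f (proj z)).
Proof. by move=> [f1 f2]; split; [exact: (smooth_proj f1)|exact: (smooth_proj f2)]. Qed.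

End coordinate_projection.

Section tensor.
Context {R : realType} {n m : nat}.
Lemma lsubmx_proj (z : 'rV[R]_(n + m)) : lsubmx z = proj (@lshift n m) z.
Proof. by apply/rowP => j; rewrite !mxE. Qed.

Lemma rsubmx_proj (z : 'rV[R]_(n + m)) : rsubmx z = proj (@rshift n m) z.
Proof. by apply/rowP => j; rewrite !mxE. Qed.

Lemma norm_lrsubmx (z : 'rV[R]_(n + m)) (r : R) : `|lsubmx z| <= r -> `|rsubmx z| <= r -> `|z| <= r.
Proof.
move=> h1 h2; have r0 : 0 <= r by exact: le_trans h1.
apply/(norm_rV_leP _ r0) => k; case: (split_ordP k) => i ->.
  by apply: le_trans h1; have := coord_le_norm (lsubmx z) i; rewrite mxE.
by apply: le_trans h2; have := coord_le_norm (rsubmx z) i; rewrite mxE.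
Qed.

(** Tensor products of test functions are the functions on which the kernel of an operator is
tested. *)
Lemma test_tensor (g : 'rV[R]_n -> R[i]) (f : 'rV[R]_m -> R[i]) : test g -> test f ->
  test (fun z : 'rV[R]_(n + m) => g (lsubmx z) * f (rsubmx z)).
Proof.
move=> tg tf; have [r r0 hr] := test_supported tg; have [s s0 hs] := test_supported tf.
apply: (@testP _ _ _ (r + s)).
  apply: csmoothM.
    under eq_fun do rewrite lsubmx_proj.
    exact: (csmooth_proj (@lshift_inj n m) (test_csmooth tg)).
  under eq_fun do rewrite rsubmx_proj.
  exact: (csmooth_proj (@rshift_inj n m) (test_csmooth tf)).
move=> z hz; have [h1|h1] := leP `|lsubmx z| r; last by rewrite hr ?mul0r.
have [h2|h2] := leP `|rsubmx z| s; last by rewrite hs ?mulr0.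
suff : `|z| <= r + s by rewrite leNgt hz.
by apply: norm_lrsubmx; [apply: (le_trans h1); rewrite lerDl|apply: (le_trans h2); rewrite lerDr].
Qed.

End tensor.

(** * Smooth approximations of indicator functions *)

Section urysohn.
Context {R : realType} {n : nat}.
Local Notation E := 'rV[R]_n.
Local Notation mu := (@lebesgue_rV R n).
Implicit Types (U : set E) (x y : E) (e : R).
(** Points whose distance to the complement of [U] is at least [e], for the norm of the space. *)
Definition inner U e : set E := [set x | forall y, `|y - x| < e -> U y].

Lemma closed_inner U e : closed (inner U e).
Proof.
rewrite -openC openE => x /existsNP[y /not_implyP[yx nUy]].
have k0 : 0 < e - `|y - x| by rewrite subr_gt0.
have := @cvgr_dist_lt R _ _ (nbhs x) (nbhs_filter x) id x (fun A => id) _ k0.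
apply: filterS => z /= hz; apply/existsNP; exists y; apply/not_implyP; split => //.
by rewrite (_ : y - z = (y - x) + (x - z)) ?(le_lt_trans (ler_normD _ _))//; [lra|rewrite addrA subrK].
Qed.

Lemma inner_sub U e : 0 < e -> inner U e `<=` U.
Proof. by move=> e0 x; apply; rewrite subrr normr0. Qed.

Lemma inner_near U x : open U -> U x -> exists2 e0 : R, 0 < e0 & forall e, e <= e0 -> inner U e x.
Proof.
move=> oU Ux; have /nbhs_ballP[e0 /= e00 h] : nbhs x U by exact: open_nbhs_nbhs.
exists e0 => // e ee y yx; apply: h; rewrite -ball_normE /=.
by rewrite distrC (lt_le_trans yx).
Qed.

Definition indic U y : R := if y \in U then 1 else 0.

Lemma measurable_indic_fun U : measurable U -> measurable_fun setT (indic U).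
Proof.
move=> mU; have := cmeasurable_if mU (cmeasurable_cst U (1 : R[i])).
by move=> [+ _]; congr measurable_fun; apply/funext => x; rewrite /indic; case: ifP.
Qed.

Lemma bounded_locint (u : E -> R) (M : R) : measurable_fun setT u -> (forall x, `|u x| <= M) -> locint u.
Proof.
move=> mu_ hM; split => // a r.
apply: (@integrable_bounded _ _ _ _ _ _ M) => //; first exact: measurable_normball.
  exact: mu_normball_fin.
exact: measurable_funS mu_.
Qed.

Lemma indic_locint U : measurable U -> locint (indic U).
Proof.
move=> mU; apply: (@bounded_locint _ 1); first exact: measurable_indic_fun.
by move=> x; rewrite /indic; case: ifP; rewrite ?normr1 ?normr0.
Qed.

(** The indicator function of the points of depth [2 e], mollified at scale [e]: it equals one at
depth [3 e] and vanishes at depth less than [e], so its support stays in [U]. *)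
Definition urysohn_test U e : E -> R := conv (indic (inner U (2 * e))) (moll e).

Section urysohn_spec.
Variables (U : set E) (e : R).
Hypothesis e0 : 0 < e.
Let F := inner U (2 * e).

Let lF : locint (indic F).
Proof. by apply: indic_locint; apply: closed_measurable_rV; exact: closed_inner. Qed.

Lemma smooth_urysohn : smooth (urysohn_test U e).
Proof. exact: (smooth_conv lF (smooth_moll e) (moll_supported e0)). Qed.

Let iI x : mu.-integrable setT (EFin \o (fun y => indic F y * moll e (y - x))).
Proof. exact: (conv_integrable x lF (smooth_continuous (smooth_moll e)) (moll_supported e0)). Qed.

Let iM x : mu.-integrable setT (EFin \o (fun y => moll e (y - x))).
Proof. apply: (@supported_integrable _ _ _ (e + `|x|)); first exact: (smooth_shift (- x) (smooth_moll e)).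
move=> y h; apply: moll_supp => //.
have := lerB_dist y x.
lra. Qed.

Lemma urysohn_ge0 x : 0 <= urysohn_test U e x.
Proof.
apply: Rintegral_ge0 => y _; rewrite mulr_ge0 ?moll_ge0//.
by rewrite /indic; case: ifP.
Qed.

Lemma urysohn_le1 x : urysohn_test U e x <= 1.
Proof.
rewrite -(@moll_int R n e x e0); apply: le_Rintegral => // y _.
by rewrite /indic; case: ifP => _; rewrite ?mul1r// mul0r moll_ge0.
Qed.

Lemma urysohn_eq1 x : inner U (3 * e) x -> urysohn_test U e x = 1.
Proof.
move=> hx; rewrite -(@moll_int R n e x e0); apply: eq_Rintegral => y _; rewrite /indic.
have [yx|yx] := leP e `|y - x|; first by rewrite moll_supp// mulr0.
rewrite mem_set ?mul1r// => z zy; apply: hx.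
rewrite (_ : z - x = (z - y) + (y - x)); last by rewrite addrA subrK.
by rewrite (le_lt_trans (ler_normD _ _))//; lra.
Qed.

Lemma urysohn_out x : ~ inner U e x -> urysohn_test U e x = 0.
Proof.
move=> hx; rewrite /urysohn_test /conv (@eq_Rintegral _ _ _ mu setT (fun=> 0)) ?Rintegral_cst ?mul0r//.
move=> y _; have [yx|yx] := leP e `|y - x|; first by rewrite moll_supp// mulr0.
rewrite /indic; case: ifPn => [/set_mem Fy|_]; last by rewrite mul0r.
exfalso; apply: hx => z zx; apply: Fy.
rewrite (_ : z - y = (z - x) + (x - y)); last by rewrite addrA subrK.
by rewrite (le_lt_trans (ler_normD _ _))// (distrC x y); lra.
Qed.

Lemma urysohn_csupp : csupp (fun x => (urysohn_test U e x)%:C) `<=` U.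
Proof.
apply: (subset_trans (csupp_sub (closed_inner (U := U) (e := e)) _)); last exact: inner_sub.
by move=> x /urysohn_out ->.
Qed.

Lemma urysohn_supported (r : R) : (forall x, U x -> `|x| <= r) -> supported (urysohn_test U e) r.
Proof.
move=> hU x rx; apply: urysohn_out => /(inner_sub e0)/hU; by rewrite leNgt rx.
Qed.

End urysohn_spec.

End urysohn.

Section fundamental_lemma.
Context {R : realType} {n : nat}.
Local Notation E := 'rV[R]_n.
Local Notation mu := (@lebesgue_rV R n).
Implicit Types (U B : set E) (x y : E) (e : R) (u : E -> R).
Lemma Rintegral_indic B u : \int[mu]_x (u x * indic B x) = \int[mu]_(x in B) u x.
Proof.
rewrite [RHS]Rintegral_mkcondT; apply: eq_Rintegral => x _; rewrite /indic.
by case: ifP; rewrite ?mulr1 ?mulr0.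
Qed.

Lemma urysohn_cvg U x : open U -> urysohn_test U (k.+1%:R^-1) x @[k --> \oo] --> indic U x.
Proof.
move=> oU; apply: cvg_near_cst.
have [Ux|nUx] := pselect (U x); last first.
  apply: nearW => k; rewrite /indic memNset// urysohn_out// => /inner_sub Ux; apply: nUx.
  by apply: Ux; rewrite invr_gt0.
have [e0 e00 he] := inner_near oU Ux.
have e3 : 0 < e0 / 3 by rewrite divr_gt0.
near=> k; rewrite /indic mem_set// urysohn_eq1//; apply: he.
have /ltW : k.+1%:R^-1 < e0 / 3 by near: k; exact: (near_infty_natSinv_lt (PosNum e3)).
by rewrite ler_pdivlMr// mulrC.
Unshelve. all: by end_near. Qed.

(** The integral of [u] over an open subset is a limit of integrals against smoothed indicator
functions, hence zero. Sets over which the integral of [u] vanishes form a lambda-system, so it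
contains all Borel sets. *)
Lemma fundamental_lemma B u : open B -> (exists r, forall x, B x -> `|x| <= r) ->
  measurable_fun setT u -> mu.-integrable B (EFin \o u) ->
  (forall g (r : R), smooth g -> supported g r -> (forall x, 0 <= g x <= 1) ->
     csupp (fun x => (g x)%:C) `<=` B -> \int[mu]_x (u x * g x) = 0) ->
  {ae mu, forall x, B x -> u x = 0}.
Proof.
move=> oB [r hB] mu_ iu H.
have mB := open_measurable_rV oB.
have Hopen U : open U -> \int[mu]_(x in U `&` B) u x = 0.
  move=> oU; have oUB : open (U `&` B) by exact: openI.
  pose g k := urysohn_test (U `&` B) (k.+1%:R^-1).
  have k0 k : 0 < k.+1%:R^-1 :> R by rewrite invr_gt0.
  have zero k : \int[mu]_x (u x * g k x) = 0.
    apply: (H _ r).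
    - exact: smooth_urysohn.
    - by apply: urysohn_supported => // x [_ /hB].
    - by move=> x; rewrite urysohn_ge0 ?urysohn_le1.
    - by apply: (subset_trans (urysohn_csupp _)) => // x [].
  have iB : mu.-integrable setT (EFin \o (fun x => if x \in B then `|u x| else 0)).
    by apply/(integrable_mkcond _ _ mB); exact: (integrable_abse iu).
  have [||||_ + _] := @Rintegral_cvg _ _ _ mu setT (fun k x => u x * g k x) (fun x => u x * indic (U `&` B) x)
    (fun x => if x \in B then `|u x| else 0) measurableT.
  - move=> k; apply: measurable_funM => //; apply: measurable_smooth; exact: smooth_urysohn.
  - move=> x _; apply: cvgM; first exact: cvg_cst.
    exact: urysohn_cvg.
  - exact: iB.
  - move=> k x _; case: ifPn => [_|/negP xB].
      rewrite normrM ler_piMr// ger0_norm ?urysohn_le1 ?urysohn_ge0//.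
    rewrite /g urysohn_out ?mulr0 ?normr0// => /(inner_sub (k0 k))[_ Bx].
    by apply: xB; exact: mem_set.
  under eq_cvg do rewrite zero.
  by rewrite Rintegral_indic => /(cvg_unique _ (cvg_cst _)) <-.
have main A : measurable A -> \int[mu]_(x in A `&` B) u x = 0.
  pose HH := [set A : set E | measurable A /\ \int[mu]_(x in A `&` B) u x = 0].
  suff : measurable `<=` HH by move=> h /h[].
  rewrite measurable_rV_open.
  apply: (@lambda_system_subset _ open _ setT HH) => //.
  - by move=> U V oU oV; exact: openI.
  - split.
    + by [].
    + split => //; apply: Hopen; exact: openT.
    + move=> A1 A2 A21 [mA1 h1] [mA2 h2]; split; first exact: measurableD.
      have e1 : A1 `&` B = (A2 `&` B) `|` ((A1 `\` A2) `&` B).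
        apply/seteqP; split=> x; last by move=> [[/A21 ? ?]|[[? _] ?]].
        by move=> [A1x Bx]; have [A2x|nA2x] := pselect (A2 x); [left|right].
      have m1 : measurable (A2 `&` B) by exact: measurableI.
      have m2 : measurable ((A1 `\` A2) `&` B) by apply: measurableI => //; exact: measurableD.
      have : \int[mu]_(x in A1 `&` B) u x = \int[mu]_(x in A2 `&` B) u x + \int[mu]_(x in (A1 `\` A2) `&` B) u x.
        rewrite e1; apply: Rintegral_setU => //.
          by rewrite -e1; apply: (integrableS mB _ _ iu); [exact: measurableI|move=> x []].
        by apply/disj_setPS => x [[? _] [[_ ?] _]].
      by rewrite h1 h2 add0r => <-.
    + move=> F ndF hF; have mF i : measurable (F i) by case: (hF i).
      split; first exact: bigcupT_measurable.
      have [||||_ + _] := @Rintegral_cvg _ _ _ mu B (fun k x => if x \in F k then u x else 0) (fun x => if x \in \bigcup_i F i then u x else 0)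
         (fun x => `|u x|) mB.
      * move=> k; apply: (@measurable_funS _ _ _ _ setT) => //.
        rewrite (_ : (fun x => _) = u \_ (F k)); last by apply/funext => x; rewrite patchE.
        by apply/(measurable_restrictT _ (mF k)); exact: measurable_funS mu_.
      * move=> x Bx; apply: cvg_near_cst.
        have [[k _ Fkx]|nF] := pselect ((\bigcup_i F i) x).
          near=> m; rewrite !mem_set//; first by exists k.
          have km : (k <= m)%N by near: m; exists k.
          by move: Fkx; exact/subsetPset/ndF.
        near=> m; rewrite !memNset// => Fmx; apply: nF; by exists m.
      * exact: (integrable_abse iu).
      * by move=> k x _; case: ifP => // _; rewrite normr0.
      have e1 A' : measurable A' -> \int[mu]_(x in B) (if x \in A' then u x else 0) = \int[mu]_(x in A' `&` B) u x.
        move=> mA'; rewrite [RHS]Rintegral_mkcondT [LHS]Rintegral_mkcondT; apply: eq_Rintegral => x _.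
        by rewrite in_setI; case: (x \in A'); case: (x \in B).
      under eq_cvg do rewrite e1//.
      rewrite e1; last exact: bigcupT_measurable.
      have -> : (fun k => \int[mu]_(x in F k `&` B) u x) = (fun=> 0) by apply/funext => k; case: (hF k).
      by move=> /(cvg_unique _ (cvg_cst _)) <-.
  - by move=> U oU; split; [exact: open_measurable_rV|exact: Hopen].
have mc : measurable_fun B (cst 0%E : E -> \bar R) by exact: measurable_cst.
have := @integral_ae_eq _ _ _ mu B mB (cst 0%E) (EFin \o u) iu mc.
have H2 : forall A, A `<=` B -> measurable A -> (\int[mu]_(x in A) (EFin \o u) x = \int[mu]_(x in A) cst 0 x)%E.
  move=> A AB mA; rewrite integral0.
  have := main _ mA; rewrite (setIidl AB) /Rintegral => h.
  rewrite -[LHS]fineK; last exact: (integrable_fin_num mA (integrableS mB mA AB iu)).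
  by rewrite h.
move=> /(_ H2); apply: filterS => x /= h /h [].
Unshelve. all: by end_near. Qed.

End fundamental_lemma.

(** * Estimates in L^p and integrals of power tails *)

Section Lp_facts.
Context {R : realType} {n : nat}.
Local Notation E := 'rV[R]_n.
Local Notation mu := (@lebesgue_rV R n).
Implicit Types (f g h v : E -> R[i]) (p : R) (D : set E).
Local Notation cnorm p f := (Lnorm mu p%:E (fun x => (normc (f x))%:E)).
Lemma LnormE p f : cnorm p f = ((\int[mu]_x ((normc (f x)) `^ p)%:E) `^ p^-1)%E.
Proof.
rewrite unlock /=; congr (_ `^ _)%E; apply: eq_integral => x _ /=.
by rewrite ger0_norm ?normc_ge0.
Qed.

(** Hoelder inequality against an indicator function. *)
Lemma Lp_integral p v D : 1 < p -> in_Lp p v -> measurable D -> (mu D < +oo)%E ->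
  mu.-integrable D (EFin \o (fun x => normc (v x))) /\
  ((\int[mu]_(x in D) normc (v x))%:E <= cnorm p v * (mu D `^ (1 - p^-1)))%E.
Proof.
move=> p1 [mv fv] mD fD.
have p0 : 0 < p by apply: lt_trans p1.
have pV1 : p^-1 < 1 by rewrite invf_lt1.
pose q := (1 - p^-1)^-1.
have q0 : 0 < q by rewrite invr_gt0 subr_gt0.
have pq : p^-1 + q^-1 = 1 by rewrite invrK addrC subrK.
have mnv := measurable_normc mv.
have := hoelder mu mnv (measurable_indic_fun mD) p0 q0 pq.
rewrite Lnorm1.
have -> : ('N[mu]_q%:E[EFin \o indic D] = mu D `^ (1 - p^-1))%E.
  rewrite unlock /=; rewrite {2}/q invrK; congr (_ `^ _)%E.
  rewrite -[RHS]mul1e -integral_cst// [RHS]integral_mkcond; apply: eq_integral => x _ /=.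
  rewrite patchE /indic; case: ifP => _; first by rewrite normr1 powR1.
  by rewrite normr0 powR0 ?gt_eqF.
have -> : (\int[mu]_x `|(EFin \o (fun x => normc (v x)) \* indic D)%R x| = \int[mu]_(x in D) (normc (v x))%:E)%E.
  rewrite [RHS]integral_mkcond; apply: eq_integral => x _ /=; rewrite patchE /indic.
  by case: ifP => _; rewrite ?mulr1 ?mulr0 ?normr0// ger0_norm ?normc_ge0.
move=> hh.
have fin : (\int[mu]_(x in D) (normc (v x))%:E < +oo)%E.
  apply: (le_lt_trans hh); apply: lte_mul_pinfty; [exact: Lnorm_ge0| |].
    by rewrite ge0_fin_numE ?Lnorm_ge0.
  by apply: poweR_lty.
have iD : mu.-integrable D (EFin \o (fun x => normc (v x))).
  apply/integrableP; split; first by apply/measurable_EFinP; exact: measurable_funS mnv.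
  by under eq_integral do rewrite /= ger0_norm ?normc_ge0//.
split => //; rewrite /Rintegral fineK//; exact: (integrable_fin_num mD iD).
Qed.

Lemma Lp_bounded p h D (M : R) : 1 < p -> measurable D -> (mu D < +oo)%E -> cmeasurable setT h -> 0 <= M ->
  (forall x, normc (h x) <= M * indic D x) ->
  in_Lp p h /\ (cnorm p h <= M%:E * (mu D `^ p^-1))%E.
Proof.
move=> p1 mD fD mh M0 hM.
have p0 : 0 < p by apply: lt_trans p1.
have le : (cnorm p h <= M%:E * (mu D `^ p^-1))%E.
  rewrite LnormE.
  have -> : (M%:E * mu D `^ p^-1 = ((M `^ p)%:E * mu D) `^ p^-1)%E.
    rewrite poweRM ?lee_fin ?powR_ge0// poweR_EFin -powRrM mulfV ?gt_eqF// powRr1//.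
  apply: gt0_ler_poweR; rewrite ?invr_ge0 ?(ltW p0)//.
  - by rewrite in_itv/= leey andbT integral_ge0// => x _; rewrite lee_fin powR_ge0.
  - by rewrite in_itv/= leey andbT mule_ge0// lee_fin powR_ge0.
  rewrite -integral_cst// [leRHS]integral_mkcond; apply: ge0_le_integral => //.
  - by move=> x _; rewrite lee_fin powR_ge0.
  - apply/measurable_EFinP; apply: (measurableT_comp (measurable_powR p)); exact: measurable_normc.
  - by apply/(measurable_restrictT _ mD); exact: measurable_cst.
  - move=> x _; rewrite patchE; have := hM x; rewrite /indic; case: ifP => _.
      by rewrite mulr1 => h1; rewrite lee_fin; apply: ge0_ler_powR; rewrite ?nnegrE ?normc_ge0// ltW.
    rewrite mulr0 => h1; have -> : normc (h x) = 0 by apply/eqP; rewrite eq_le h1 normc_ge0.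
    by rewrite powR0 ?gt_eqF.
split => //; split => //; apply: (le_lt_trans le); apply: lte_mul_pinfty => //.
exact: poweR_lty.
Qed.

(** Dominated convergence in [L^p]. It replaces density arguments: bounded functions are
approximated by test functions pointwise, with a common bound and a common bounded support. *)
Lemma Lp_small p D (M : R) (h_ : nat -> E -> R[i]) (e : R) : 1 < p -> measurable D -> (mu D < +oo)%E ->
  (forall k, cmeasurable setT (h_ k)) -> 0 <= M -> (forall k x, normc (h_ k x) <= M * indic D x) ->
  (forall x, normc (h_ k x) @[k --> \oo] --> (0 : R)) -> 0 < e ->
  \forall k \near \oo, (cnorm p (h_ k) <= e%:E)%E.
Proof.
move=> p1 mD fD mh M0 hM h0 e0.
have p0 : 0 < p by apply: lt_trans p1.
have mk k : measurable_fun setT (fun x => normc (h_ k x) `^ p).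
  by apply: (measurableT_comp (measurable_powR p)); exact: measurable_normc.
have hb k x : `|normc (h_ k x) `^ p| <= if x \in D then M `^ p else 0.
  rewrite ger0_norm ?powR_ge0//; have := hM k x; rewrite /indic; case: ifP => _.
    by rewrite mulr1 => h1; apply: ge0_ler_powR; rewrite ?nnegrE ?normc_ge0// ltW.
  rewrite mulr0 => h1; have -> : normc (h_ k x) = 0 by apply/eqP; rewrite eq_le h1 normc_ge0.
  by rewrite powR0 ?gt_eqF.
have ib : mu.-integrable setT (EFin \o (fun x => if x \in D then M `^ p else 0)).
  by apply/(integrable_mkcond mu (fun=> M `^ p) mD); exact: integrable_cst.
have h0p x : normc (h_ k x) `^ p @[k --> \oo] --> (0 : R).
  apply/cvgr0Pnorm_lt => t t0; have tp : 0 < t `^ p^-1 by rewrite powR_gt0.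
  move/cvgr0Pnorm_lt : (h0 x) => /(_ _ tp); apply: filterS => k.
  rewrite ger0_norm ?normc_ge0// ger0_norm ?powR_ge0// => hk.
  rewrite -[t]powRr1 ?ltW// -(mulVf (lt0r_neq0 p0)) powRrM.
  by apply: gt0_ltr_powR; rewrite ?nnegrE ?normc_ge0 ?powR_ge0.
have [_ + _] := @Rintegral_cvg _ _ _ mu setT (fun k x => normc (h_ k x) `^ p) (fun=> 0) _ measurableT mk (fun x _ => h0p x) ib (fun k x _ => hb k x).
rewrite Rintegral_cst// mul0r => /cvgr0Pnorm_le/(_ (e `^ p)); rewrite powR_gt0// => /(_ isT).
apply: filterS => k hk.
have ik : mu.-integrable setT (EFin \o (fun x => normc (h_ k x) `^ p)).
  exact: (integrable_dom measurableT (mk k) (fun x _ => hb k x) ib).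
rewrite LnormE.
have -> : (\int[mu]_x (normc (h_ k x) `^ p)%:E = (\int[mu]_x normc (h_ k x) `^ p)%:E)%E.
  by rewrite /Rintegral fineK//; exact: (integrable_fin_num measurableT ik).
have I0 : 0 <= \int[mu]_x normc (h_ k x) `^ p by apply: Rintegral_ge0 => x _; exact: powR_ge0.
rewrite poweR_EFin lee_fin -[leRHS]powRr1 ?(ltW e0)// -(mulfV (lt0r_neq0 p0)) powRrM.
apply: ge0_ler_powR; rewrite ?invr_ge0 ?nnegrE ?powR_ge0// ?(ltW p0)//.
by move: hk; rewrite ger0_norm.
Qed.

End Lp_facts.

Section tail_integral.
Context {R : realType} {n : nat}.
Local Notation E := 'rV[R]_n.
Local Notation mu := (@lebesgue_rV R n).
(** The decay of a kernel difference, cut at distance [rho]. *)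
Definition tail (a : E) (rho s : R) (y : E) : R :=
  if rho <= enorm (y - a) then (enorm (y - a) `^ (n%:R + s))^-1 else 0.

Definition tail_const (s : R) : R := 4 ^+ n / (1 - 2 `^ (- s)).

Lemma measurable_enormB (a : E) : measurable_fun setT (fun y : E => enorm (y - a)).
Proof. by apply: (measurableT_comp measurable_enorm); exact: measurable_addv. Qed.

Lemma measurable_off_eball (a : E) (rho : R) : measurable (~` eball a rho).
Proof. by apply: measurableC; exact: measurable_eball. Qed.

Lemma tailE a rho s y : tail a rho s y = if y \in ~` eball a rho then (enorm (y - a) `^ (n%:R + s))^-1 else 0.
Proof.
rewrite /tail; congr (if _ then _ else _).
by apply/idP/idP; rewrite inE /eball /= => h; [apply/negP; rewrite -leNgt|rewrite leNgt; apply/negP].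
Qed.

Lemma measurable_tail a rho s : measurable_fun setT (tail a rho s).
Proof.
pose g (y : E) : R := (enorm (y - a) `^ (n%:R + s))^-1.
have mg : measurable_fun setT g.
  rewrite /g; under eq_fun do rewrite -powRN.
  exact: (measurableT_comp (measurable_powR _) (measurable_enormB a)).
rewrite (_ : tail a rho s = g \_ (~` eball a rho)); last by apply/funext => y; rewrite patchE tailE.
by apply/(measurable_restrictT _ (measurable_off_eball a rho)); exact: measurable_funS mg.
Qed.

Lemma tail_ge0 a rho s y : 0 <= tail a rho s y.
Proof. by rewrite /tail; case: ifP => //; rewrite invr_ge0 powR_ge0. Qed.

Lemma powR2N_lt1 (s : R) : 0 < s -> 2 `^ (- s) < 1 :> R.
Proof.
move=> s0; rewrite powRN invf_lt1 ?powR_gt0//.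
have := @gt0_ltr_powR R s s0 1 2; rewrite powR1 !nnegrE => h.
by apply: h; rewrite ?ltr1n.
Qed.

Lemma tail_const_gt0 s : 0 < s -> 0 < tail_const s.
Proof.
by move=> s0; rewrite divr_gt0// subr_gt0 powR2N_lt1.
Qed.

(** Dyadic decomposition: on [2^k rho <= |y - a| < 2^(k + 1) rho] the integrand is at most [(2^k
rho)^(- n - s)], the volume is at most [(2^(k + 2) rho)^n], and the series in [k] is geometric. *)
Lemma tail_integral a rho s : 0 < rho -> 0 < s ->
  mu.-integrable setT (EFin \o tail a rho s) /\ \int[mu]_y tail a rho s y <= tail_const s * (rho `^ s)^-1.
Proof.
move=> r0 s0.
pose c k : R := ((2 ^+ k * rho) `^ (n%:R + s))^-1.
pose B k : set E := eball a (2 ^+ k.+1 * rho).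
have q1 : 2 `^ (- s) < 1 :> R by exact: powR2N_lt1.
have c0 k : 0 <= c k by rewrite invr_ge0 powR_ge0.
have ptw y : ((tail a rho s y)%:E <= \sum_(0 <= k <oo) (c k * indic (B k) y)%:E)%E.
  rewrite /tail; case: ifP => [ry|_]; last first.
    by apply: nneseries_ge0 => k _ _; rewrite lee_fin mulr_ge0// /indic; case: ifP.
  pose t := enorm (y - a) / rho.
  have t1 : 1 <= t by rewrite ler_pdivlMr ?mul1r.
  have ex : exists k, t < 2 ^+ k.+1.
    exists (Num.truncn t); have := truncnS_gt t; move=> /lt_le_trans; apply.
    rewrite -natrX ler_nat; exact: ltnW (ltn_expl _ _).
  case: (ex_minnP ex) => k tk hmin.
  have kt : 2 ^+ k <= t.
    case: k hmin {tk} => [//|k] hmin; rewrite leNgt; apply/negP => h.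
    by have := hmin _ h; rewrite ltnn.
  apply: (@le_trans _ _ (c k * indic (B k) y)%:E); last first.
    apply: (le_trans _ (@nneseries_lim_ge R (fun k => (c k * indic (B k) y)%:E) xpredT 0 k.+1 _)); last first.
      by move=> j _ _; rewrite lee_fin mulr_ge0// /indic; case: ifP.
    by rewrite big_nat_recr//= leeDr// sume_ge0// => j _; rewrite lee_fin mulr_ge0// /indic; case: ifP.
  rewrite lee_fin /indic mem_set ?mulr1; last by rewrite /B /eball /= -ltr_pdivrMr.
  rewrite lef_pV2 ?posrE ?powR_gt0 ?mulr_gt0 ?exprn_gt0 ?(lt_le_trans r0 ry)//.
  apply: ge0_ler_powR; rewrite ?nnegrE ?addr_ge0 ?(ltW s0) ?mulr_ge0 ?(ltW r0) ?exprn_ge0 ?enorm_ge0//.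
  by rewrite -ler_pdivlMr.
have bd : (\int[mu]_y (tail a rho s y)%:E <= (tail_const s * (rho `^ s)^-1)%:E)%E.
  apply: (@le_trans _ _ (\int[mu]_y (\sum_(0 <= k <oo) (c k * indic (B k) y)%:E))%E).
    apply: ge0_le_integral => //.
    - by move=> y _; rewrite lee_fin tail_ge0.
    - by apply/measurable_EFinP; exact: measurable_tail.
    - apply: ge0_emeasurable_sum => [k y _ _|k _]; first by rewrite lee_fin mulr_ge0// /indic; case: ifP.
      by apply/measurable_EFinP; apply: measurable_funM => //; apply: measurable_indic_fun; exact: measurable_eball.
  rewrite integral_nneseries//; last 2 first.
    by move=> k; apply/measurable_EFinP; apply: measurable_funM => //; apply: measurable_indic_fun; exact: measurable_eball.
    by move=> k y _; rewrite lee_fin mulr_ge0// /indic; case: ifP.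
  have term k : (\int[mu]_y (c k * indic (B k) y)%:E <= (4 ^+ n * (rho `^ s)^-1 * (2 `^ (- s)) ^+ k)%:E)%E.
    have -> : (\int[mu]_y (c k * indic (B k) y)%:E = (c k)%:E * mu (B k))%E.
      rewrite -integral_cst; last exact: measurable_eball.
      rewrite [RHS]integral_mkcond; apply: eq_integral => y _; rewrite patchE /indic.
      by case: ifP; rewrite ?mulr1 ?mulr0.
    apply: (@le_trans _ _ ((c k)%:E * ((2 * (2 ^+ k.+1 * rho)) ^+ n)%:E)%E).
      by apply: lee_wpmul2l; rewrite ?lee_fin//; apply: mu_eball_le; rewrite mulr_ge0 ?exprn_ge0// ltW.
    rewrite -EFinM lee_fin le_eqVlt; apply/orP; left; apply/eqP.
    have k0 : 0 < 2 ^+ k * rho by rewrite mulr_gt0 ?exprn_gt0.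
    have e2 : ((2 ^+ k) `^ s)^-1 = (2 `^ (- s)) ^+ k.
      rewrite -powR_mulrn ?powR_ge0// -powRrM -powR_mulrn// -powRrM -powRN; congr (_ `^ _); ring.
    have e3 : ((2 ^+ k * rho) `^ s)^-1 = (2 `^ (- s)) ^+ k * (rho `^ s)^-1.
      by rewrite powRM ?exprn_ge0 ?(ltW r0)// invfM e2.
    rewrite /c powRD; last by apply/implyP => _; rewrite gt_eqF.
    rewrite powR_mulrn ?(ltW k0)// invfM e3.
    have -> : 2 * (2 ^+ k.+1 * rho) = 4 * (2 ^+ k * rho) by rewrite exprS; ring.
    have K0 : (2 ^+ k * rho) ^+ n != 0 by rewrite gt_eqF// exprn_gt0.
    rewrite (exprMn _ 4) ; move: K0; set K := (2 ^+ k * rho) ^+ n => K0; set a1 := _ ^+ k; set a2 := (rho `^ s)^-1.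
    by field.
  apply: (@le_trans _ _ (\sum_(0 <= k <oo) (4 ^+ n * (rho `^ s)^-1 * (2 `^ (- s)) ^+ k)%:E)%E).
    by apply: lee_nneseries => // k _ _; apply: integral_ge0 => y _; rewrite lee_fin mulr_ge0// /indic; case: ifP.
  have G0 : 0 <= 4 ^+ n * (rho `^ s)^-1 by rewrite mulr_ge0 ?exprn_ge0// invr_ge0 powR_ge0.
  apply: lime_le.
    by apply: is_cvg_nneseries => k _ _; rewrite lee_fin mulr_ge0// exprn_ge0// powR_ge0.
  apply: nearW => N; rewrite sumEFin lee_fin -mulr_sumr.
  have -> : tail_const s * (rho `^ s)^-1 = 4 ^+ n * (rho `^ s)^-1 * (1 - 2 `^ (- s))^-1 by rewrite /tail_const; ring.
  rewrite ler_wpM2l// -[leRHS]mul1r ler_pdivlMr ?subr_gt0//.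
  rewrite mulrC big_mkord -opprB mulNr -subrX1 opprB.
  by rewrite lerBlDr lerDl exprn_ge0// powR_ge0.
have it : mu.-integrable setT (EFin \o tail a rho s).
  apply/integrableP; split; first by apply/measurable_EFinP; exact: measurable_tail.
  under eq_integral do rewrite /= ger0_norm ?tail_ge0//.
  by apply: (le_lt_trans bd); exact: ltry.
split => //.
by rewrite -lee_fin /Rintegral fineK//; exact: (integrable_fin_num measurableT it).
Qed.

End tail_integral.

(** * The kernel away from the diagonal *)

Section truncation.
Context {R : realType} {n : nat}.
Local Notation E := 'rV[R]_n.
Local Notation mu := (@lebesgue_rV R n).
(** The real test functions suffice: they separate real and imaginary parts. *)
Lemma fundamental_lemma_c (B : set E) (v : E -> R[i]) : open B -> (exists r, forall x, B x -> `|x| <= r) ->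
  cmeasurable setT v -> cintegrable mu B v ->
  (forall g (r : R), smooth g -> supported g r -> (forall x, 0 <= g x <= 1) ->
     csupp (fun x => (g x)%:C) `<=` B -> cintegral mu setT (fun x => v x * (g x)%:C) = 0) ->
  {ae mu, forall x, B x -> v x = 0}.
Proof.
move=> oB hB [mv1 mv2] [iv1 iv2] H.
have h1 : {ae mu, forall x, B x -> complex.Re (v x) = 0}.
  apply: fundamental_lemma => // g r sg sr g01 gB.
  have := congr1 (@complex.Re R) (H g r sg sr g01 gB); rewrite cintegralE /=.
  by under eq_Rintegral do rewrite Re_mul /= mulr0 subr0.
have h2 : {ae mu, forall x, B x -> complex.Im (v x) = 0}.
  apply: fundamental_lemma => // g r sg sr g01 gB.
  have := congr1 (@complex.Im R) (H g r sg sr g01 gB); rewrite cintegralE /=.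
  by under eq_Rintegral do rewrite Im_mul /= mulr0 add0r.
by apply: filterS2 h1 h2 => x a b Bx; apply: complexP; [exact: a|exact: b].
Qed.

Lemma normc_indic (f : E -> R[i]) (D : set E) (M : R) : 0 <= M ->
  (forall x, D x -> normc (f x) <= M) -> (forall x, ~ D x -> f x = 0) -> forall x, normc (f x) <= M * indic D x.
Proof.
move=> M0 h1 h2 x; rewrite /indic; case: ifPn => [/set_mem/h1|/negP nD]; first by rewrite mulr1.
by rewrite h2 ?normc_0 ?mulr0// => Dx; apply: nD; exact: mem_set.
Qed.

Lemma restr_in (D : set E) (f : E -> R[i]) x : D x -> restr D f x = f x.
Proof. by move=> Dx; rewrite /restr mem_set. Qed.

Lemma restr_out (D : set E) (f : E -> R[i]) x : ~ D x -> restr D f x = 0.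
Proof. by move=> Dx; rewrite /restr memNset. Qed.

Lemma cmeasurable_restr (D : set E) (f : E -> R[i]) : measurable D -> cmeasurable setT f -> cmeasurable setT (restr D f).
Proof. by move=> mD mf; apply: cmeasurable_if => //; exact: cmeasurableS mf. Qed.

Lemma integrable_indic_cst (D : set E) (M : R) : measurable D -> (mu D < +oo)%E -> mu.-integrable setT (EFin \o (fun x => M * indic D x)).
Proof.
move=> mD fD; have := (integrable_mkcond mu (fun=> M) mD).1 (integrable_cst M mD fD).
by congr (_.-integrable _ _); apply/funext => x /=; rewrite /indic; case: ifP; rewrite ?mulr1 ?mulr0.
Qed.

End truncation.

Section kernel.
Context {R : realType} {d : nat}.
Local Notation E := 'rV[R]_d.
Local Notation mu := (@lebesgue_rV R d).
Context (K : E -> E -> R[i]) (A delta : R).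
Hypothesis A0 : 0 < A.
Hypothesis delta01 : 0 < delta <= 1.
Hypothesis mK : cmeasurable (~` @Pilot.Defs.diagonal R d) (fun z : E * E => K z.1 z.2).
Hypothesis Ksize : forall x y, x != y -> normc (K x y) <= A / enorm (x - y) ^+ d.
Hypothesis Ksmooth : forall x x' y, enorm (x - x') < 2^-1 * enorm (x - y) ->
              normc (K x y - K x' y) + normc (K y x - K y x') <=
              A * (enorm (x - x') `^ delta / enorm (x - y) `^ (d%:R + delta)).
Implicit Types (x y : E) (r : R).
Let delta0 : 0 < delta. Proof. by case/andP : delta01. Qed.

Lemma measurable_offdiag : measurable (~` @Pilot.Defs.diagonal R d).
Proof.
apply: measurableC.
have -> : @Pilot.Defs.diagonal R d = (fun z : E * E => enorm (z.1 - z.2)) @^-1` [set 0].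
  apply/seteqP; split=> -[x y] /=; first by rewrite /Pilot.Defs.diagonal /= => ->; rewrite subrr enorm0.
  move=> h; apply/eqP; rewrite -subr_eq0; apply: contraT => /enorm_gt0.
  by rewrite h ltxx.
rewrite -[X in measurable X]setTI.
have m : measurable_fun setT (fun z : E * E => enorm (z.1 - z.2)).
  apply: (measurableT_comp measurable_enorm); apply: measurable_fun_rVP => i.
  under eq_fun do rewrite !mxE.
  apply: measurable_funB.
    exact: (measurableT_comp (measurable_rV_coord i) measurable_fst).
  exact: (measurableT_comp (measurable_rV_coord i) measurable_snd).
exact: m.
Qed.

(** The kernel extended by zero to the diagonal, so that it is measurable on the whole product. *)
Definition Kz (z : E * E) : R[i] := if z \in ~` @Pilot.Defs.diagonal R d then K z.1 z.2 else 0.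

Lemma KzE x y : x != y -> Kz (x, y) = K x y.
Proof. by move=> xy; rewrite /Kz mem_set// => h; move: xy; rewrite (h : x = y) eqxx. Qed.

Lemma measurable_Kz : cmeasurable setT Kz.
Proof. by apply: cmeasurable_if => //; exact: measurable_offdiag. Qed.

Lemma measurable_pair1 x : measurable_fun setT (fun y : E => (x, y)).
Proof. by apply/measurable_fun_pairP; split; [exact: (measurable_cst x)|exact: measurable_id]. Qed.

Lemma measurable_pair2 y : measurable_fun setT (fun x : E => (x, y)).
Proof. by apply/measurable_fun_pairP; split; [exact: measurable_id|exact: (measurable_cst y)]. Qed.

Lemma measurable_Kz1 x : cmeasurable setT (fun y => Kz (x, y)).
Proof. exact: (cmeasurable_comp measurable_Kz (measurable_pair1 x)). Qed.

Lemma measurable_Kz2 y : cmeasurable setT (fun x => Kz (x, y)).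
Proof. exact: (cmeasurable_comp measurable_Kz (measurable_pair2 y)). Qed.

Lemma sep_neq x0 r x y : enorm (x - x0) < r -> r <= enorm (y - x0) -> x != y.
Proof. by move=> h1 h2; apply/eqP => xy; move: (lt_le_trans h1 h2); rewrite xy ltxx. Qed.

Lemma sep_neq0 x0 r y : 0 < r -> r <= enorm (y - x0) -> x0 != y.
Proof. by move=> r0; apply: sep_neq; rewrite subrr enorm0. Qed.

(** The smoothness condition, for two points of a ball and a third point outside its double. *)
Lemma kernel_diff_le x0 r x y : enorm (x - x0) < r -> 2 * r <= enorm (y - x0) ->
  normc (K x y - K x0 y) <= A * r `^ delta * (enorm (y - x0) `^ (d%:R + delta))^-1.
Proof.
move=> xr yr; have r0 : 0 < r by exact: le_lt_trans (enorm_ge0 _) xr.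
have h : enorm (x0 - x) < 2^-1 * enorm (x0 - y).
  rewrite enormC (lt_le_trans xr)// (enormC x0 y).
  by rewrite -ler_pdivrMl ?invr_gt0// invrK.
rewrite normc_distC; apply: (@le_trans _ _ (normc (K x0 y - K x y) + normc (K y x0 - K y x))).
  by rewrite lerDl normc_ge0.
apply: (le_trans (Ksmooth h)); rewrite -mulrA.
apply: ler_wpM2l; first exact: (ltW A0).
rewrite (enormC x0 y); apply: ler_wpM2r; first by rewrite invr_ge0 powR_ge0.
by apply: ge0_ler_powR; rewrite ?nnegrE ?enorm_ge0 ?(ltW r0) ?(ltW delta0)// enormC ltW.
Qed.

(** Bound of the kernel between a ball of radius [r] and the complement of the concentric ball of
radius [2 r]. *)
Definition Kbound r : R := A / (2 * r) ^+ d + A * r `^ delta * ((2 * r) `^ (d%:R + delta))^-1.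

Lemma Kbound_ge0 r : 0 < r -> 0 <= Kbound r.
Proof.
move=> r0; rewrite addr_ge0// ?divr_ge0 ?exprn_ge0 ?mulr_ge0 ?powR_ge0 ?invr_ge0 ?powR_ge0 ?(ltW A0) ?(ltW r0)//.
Qed.

(** On a ball, seen from outside its double, the kernel is bounded: it is so at the centre, and it
varies little. *)
Lemma kernel_le x0 r x y : enorm (x - x0) < r -> 2 * r <= enorm (y - x0) -> normc (K x y) <= Kbound r.
Proof.
move=> xr yr; have r0 : 0 < r by exact: le_lt_trans (enorm_ge0 _) xr.
have r20 : 0 < 2 * r by rewrite mulr_gt0.
have yp := lt_le_trans r20 yr.
have -> : K x y = K x0 y + (K x y - K x0 y) by rewrite addrC subrK.
apply: (le_trans (normcD_le _ _)); apply: lerD.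
  apply: (le_trans (Ksize (sep_neq0 r20 yr))).
  rewrite ler_wpM2l ?(ltW A0)// enormC lef_pV2 ?posrE ?exprn_gt0//.
  by apply: lerXn2r; rewrite ?nnegrE ?(ltW r20) ?(ltW yp).
apply: (le_trans (kernel_diff_le xr yr)).
rewrite ler_wpM2l ?mulr_ge0 ?powR_ge0 ?(ltW A0)// lef_pV2 ?posrE ?powR_gt0//.
by apply: ge0_ler_powR; rewrite ?nnegrE ?addr_ge0 ?(ltW delta0) ?(ltW r20) ?(ltW yp).
Qed.

Section separated.
Context (x0 : E) (r : R) (h g : E -> R[i]) (D : set E) (M G : R).
Hypothesis r0 : 0 < r.
Hypothesis mD : measurable D.
Hypothesis fD : (mu D < +oo)%E.
Hypothesis M0 : 0 <= M.
Hypothesis G0 : 0 <= G.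
Hypothesis mh : cmeasurable setT h.
Hypothesis mg : cmeasurable setT g.
Hypothesis hM : forall y, normc (h y) <= M * indic D y.
Hypothesis hfar : forall y, enorm (y - x0) < 2 * r -> h y = 0.
Hypothesis gG : forall x, normc (g x) <= G * indic (eball x0 r) x.
Let S : set (E * E) := eball x0 r `*` D.

Let mS : measurable S. Proof. by apply: measurableX => //; exact: measurable_eball. Qed.

Let fS : ((mu \x mu)%E S < +oo)%E.
Proof.
rewrite /S product_measure1E//; last exact: measurable_eball.
by rewrite lte_mul_pinfty// ?ge0_fin_numE//; exact: mu_eball_fin.
Qed.

Lemma sep_bound z : normc (Kz z * h z.2 * g z.1) <= if z \in S then Kbound r * M * G else 0.
Proof.
case: z => x y /=; rewrite !normc_mul.
have KB := Kbound_ge0 r0.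
have [xB|xB] := pselect (eball x0 r x); last first.
  have -> : normc (g x) = 0.
    by apply/eqP; rewrite eq_le normc_ge0 andbT; have := gG x; rewrite /indic memNset ?mulr0.
  by rewrite mulr0; case: ifP => // _; rewrite !mulr_ge0.
have [yD|yD] := pselect (D y); last first.
  have -> : normc (h y) = 0.
    by apply/eqP; rewrite eq_le normc_ge0 andbT; have := hM y; rewrite /indic memNset ?mulr0.
  by rewrite mulr0 mul0r; case: ifP => // _; rewrite !mulr_ge0.
rewrite mem_set//.
have [yr|yr] := ltP (enorm (y - x0)) (2 * r); first by rewrite hfar// normc_0 mulr0 mul0r !mulr_ge0.
have xy : x != y by apply: (sep_neq xB); apply: le_trans yr; rewrite ler_peMl ?ltW// ltr1n.
rewrite KzE//; apply: ler_pM; rewrite ?mulr_ge0 ?normc_ge0//; last by have := gG x; rewrite /indic mem_set ?mulr1.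
apply: ler_pM; rewrite ?normc_ge0//; first exact: (kernel_le xB yr).
by have := hM y; rewrite /indic mem_set ?mulr1.
Qed.

Lemma sep_measurable : cmeasurable setT (fun z : E * E => Kz z * h z.2 * g z.1).
Proof.
apply: cmeasurableM; last exact: (cmeasurable_comp mg measurable_fst).
by apply: cmeasurableM; [exact: measurable_Kz|exact: (cmeasurable_comp mh measurable_snd)].
Qed.

Lemma sep_integrable : cintegrable (mu \x mu)%E setT (fun z : E * E => Kz z * h z.2 * g z.1).
Proof.
apply: (cintegrable_dom (g := fun z => if z \in S then Kbound r * M * G else 0)) => //.
- exact: sep_measurable.
- by move=> z _; exact: sep_bound.
- by apply/(integrable_mkcond _ (fun=> Kbound r * M * G) mS); exact: integrable_cst.
Qed.

(** Separation of the supports makes the kernel bounded where the integrand does not vanish, so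
Fubini applies. *)
Lemma sep_fubini :
  cintegral (mu \x mu)%E setT (fun z : E * E => Kz z * h z.2 * g z.1) =
    cintegral mu setT (fun x => cintegral mu setT (fun y => Kz (x, y) * h y) * g x) /\
  cintegrable mu setT (fun x => cintegral mu setT (fun y => Kz (x, y) * h y) * g x).
Proof.
have inner x : cintegral mu setT (fun y => Kz (x, y) * h y * g x) = cintegral mu setT (fun y => Kz (x, y) * h y) * g x.
  have [xB|xB] := pselect (eball x0 r x); last first.
    have -> : g x = 0.
      apply: normc_eq0; apply/eqP; rewrite eq_le normc_ge0 andbT.
      by have := gG x; rewrite /indic memNset ?mulr0.
    by rewrite mulr0 cintegral0// => y _; rewrite mulr0.
  apply: cintegralZr => //.
  apply: (cintegrable_dom (g := fun y => Kbound r * M * indic D y)) => //.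
  - by apply: cmeasurableM => //; exact: measurable_Kz1.
  - move=> y _; rewrite normc_mul.
    have [yr|yr] := ltP (enorm (y - x0)) (2 * r).
      rewrite hfar// normc_0 mulr0 !mulr_ge0 ?Kbound_ge0//.
      by rewrite /indic; case: ifP.
    have xy : x != y by apply: (sep_neq xB); apply: le_trans yr; rewrite ler_peMl ?ltW// ltr1n.
    rewrite KzE// -mulrA; apply: ler_pM; rewrite ?normc_ge0//; exact: (kernel_le xB yr).
  - exact: integrable_indic_cst.
have [e1 _ i1 _] := cfubini sep_integrable; split.
  by rewrite e1; apply: eq_cintegral => x _; exact: inner.
by move: i1; congr cintegrable; apply/funext => x; exact: inner.
Qed.

End separated.

(** Subtracting [K x0 y] makes the integral converge for every bounded [f]; this costs a constant,
which is invisible in [BMO]. *)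
Definition far (f : E -> R[i]) x0 r x : R[i] :=
  cintegral mu (~` eball x0 (4 * r)) (fun y => (K x y - K x0 y) * f y).

Section far_part.
Context (x0 : E) (r rho : R) (f : E -> R[i]) (M : R).
Hypothesis r0 : 0 < r.
Hypothesis rrho : 2 * r <= rho.
Hypothesis mf : cmeasurable setT f.
Hypothesis M0 : 0 <= M.
Hypothesis fM : forall y, normc (f y) <= M.
Let rho0 : 0 < rho. Proof. by apply: lt_le_trans rrho; rewrite mulr_gt0. Qed.

Let mO : measurable (~` eball x0 rho). Proof. exact: measurable_off_eball. Qed.

Lemma off_le y : (~` eball x0 rho) y -> rho <= enorm (y - x0).
Proof. by move=> h; rewrite leNgt; apply/negP. Qed.

Lemma tail_off y : (~` eball x0 rho) y -> tail x0 rho delta y = (enorm (y - x0) `^ (d%:R + delta))^-1.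
Proof. by move=> /off_le h; rewrite /tail h. Qed.

Lemma far_integrand_le x y : enorm (x - x0) < r -> (~` eball x0 rho) y ->
  normc ((K x y - K x0 y) * f y) <= A * r `^ delta * M * tail x0 rho delta y.
Proof.
move=> xr yo; rewrite tail_off// normc_mul mulrAC.
apply: ler_pM; rewrite ?normc_ge0//; apply: kernel_diff_le => //.
by apply: (le_trans rrho); exact: off_le.
Qed.

Let Kfar x y : enorm (x - x0) < r -> (~` eball x0 rho) y -> K x y = Kz (x, y).
Proof.
move=> xr /off_le yo; rewrite KzE//; apply: (sep_neq xr); apply: le_trans yo.
by apply: le_trans rrho; rewrite ler_peMl ?ltW// ltr1n.
Qed.

Let K0far y : (~` eball x0 rho) y -> K x0 y = Kz (x0, y).
Proof. by move=> /off_le yo; rewrite KzE//; exact: sep_neq0 yo. Qed.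

Lemma far_measurable x : enorm (x - x0) < r -> cmeasurable (~` eball x0 rho) (fun y => (K x y - K x0 y) * f y).
Proof.
move=> xr.
have m : cmeasurable setT (fun y => (Kz (x, y) - Kz (x0, y)) * f y).
  by apply: cmeasurableM => //; apply: cmeasurableB; exact: measurable_Kz1.
have [m1 m2] := cmeasurableS (D' := ~` eball x0 rho) measurableT (@subsetT _ _) m.
split.
  by apply: eq_measurable_fun m1 => y /set_mem yo; rewrite (Kfar xr yo) (K0far yo).
by apply: eq_measurable_fun m2 => y /set_mem yo; rewrite (Kfar xr yo) (K0far yo).
Qed.

Lemma tail_integrable : mu.-integrable (~` eball x0 rho) (EFin \o (fun y => A * r `^ delta * M * tail x0 rho delta y)).
Proof.
apply: RintegrableZ => //; have [it _] := tail_integral x0 rho0 delta0.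
exact: (integrableS measurableT mO (@subsetT _ _) it).
Qed.

Lemma far_integrable x : enorm (x - x0) < r -> cintegrable mu (~` eball x0 rho) (fun y => (K x y - K x0 y) * f y).
Proof.
move=> xr; apply: (cintegrable_dom mO (far_measurable xr) _ tail_integrable) => y yo.
exact: far_integrand_le.
Qed.

(** The tail integral of the kernel difference has a bound that does not depend on the radius of the
ball. *)
Lemma far_le x : enorm (x - x0) < r ->
  normc (cintegral mu (~` eball x0 rho) (fun y => (K x y - K x0 y) * f y)) <= 2 * A * M * tail_const (n := d) delta.
Proof.
move=> xr; apply: (le_trans (normc_cintegral_le mO (far_measurable xr) (fun y yo => far_integrand_le xr yo) tail_integrable)).
have [it tle] := tail_integral x0 rho0 delta0.
have it' := integrableS measurableT mO (@subsetT _ _) it.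
rewrite RintegralZl//.
have -> : \int[mu]_(x in ~` eball x0 rho) tail x0 rho delta x = \int[mu]_x tail x0 rho delta x.
  by rewrite Rintegral_mkcondT; apply: eq_Rintegral => y _; rewrite tailE; case: (_ \in _).
have c0 : 0 <= A * r `^ delta * M by rewrite !mulr_ge0 ?powR_ge0// ltW.
apply: (@le_trans _ _ (2 * (A * r `^ delta * M * (tail_const (n := d) delta / rho `^ delta)))).
  by rewrite ler_wpM2l// ler_wpM2l.
have -> : 2 * (A * r `^ delta * M * (tail_const (n := d) delta / rho `^ delta)) = 2 * A * M * tail_const (n := d) delta * (r `^ delta / rho `^ delta) by ring.
have tc0 := ltW (@tail_const_gt0 R d delta delta0).
apply: ler_piMr; first by apply: mulr_ge0 => //; rewrite !mulr_ge0// ltW.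
rewrite ler_pdivrMr ?powR_gt0// mul1r; apply: ge0_ler_powR; rewrite ?nnegrE ?(ltW r0) ?(ltW rho0) ?(ltW delta0)//.
by apply: le_trans rrho; rewrite ler_peMl ?ltW// ltr1n.
Qed.

(** Obtained from Fubini: an integral that depends on a parameter is measurable when the integrand
is integrable on the product. *)
Lemma far_measurable_x : cmeasurable setT
  (restr (eball x0 r) (fun x => cintegral mu (~` eball x0 rho) (fun y => (K x y - K x0 y) * f y))).
Proof.
have mB : measurable (eball x0 r) by exact: measurable_eball.
pose F (z : E * E) := (if z.1 \in eball x0 r then (if z.2 \in ~` eball x0 rho then (Kz z - Kz (x0, z.2)) * f z.2 else 0) else 0).
have mF : cmeasurable setT F.
  have m0 : cmeasurable setT (fun z : E * E => (Kz z - Kz (x0, z.2)) * f z.2).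
    apply: cmeasurableM; last exact: (cmeasurable_comp mf measurable_snd).
    apply: cmeasurableB; first exact: measurable_Kz.
    exact: (cmeasurable_comp (measurable_Kz1 x0) measurable_snd).
  have mS : measurable (eball x0 r `*` (~` eball x0 rho)) by exact: measurableX.
  have := cmeasurable_if mS (cmeasurableS measurableT (@subsetT _ _) m0).
  congr cmeasurable; apply/funext => -[x y] /=; rewrite /F /= in_setX.
  by case: (x \in _); case: (y \in _).
have bF z : normc (F z) <= indic (eball x0 r) z.1 * (A * r `^ delta * M * tail x0 rho delta z.2).
  case: z => x y; rewrite /F /indic /=; case: ifPn => [/set_mem xB|_]; last by rewrite normc_0 mul0r.
  rewrite mul1r; case: ifPn => [/set_mem yo|_].
    by rewrite -(Kfar xB yo) -(K0far yo); exact: far_integrand_le.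
  by rewrite normc_0 !mulr_ge0 ?powR_ge0 ?tail_ge0 ?(ltW A0).
have iF : cintegrable (mu \x mu)%E setT F.
  apply: (cintegrable_dom measurableT mF (fun z _ => bF z)).
  pose G (z : E * E) := (indic (eball x0 r) z.1 * (A * r `^ delta * M * tail x0 rho delta z.2))%:E.
  have mG : measurable_fun setT G.
    apply/measurable_EFinP; apply: measurable_funM.
      exact: (measurableT_comp (measurable_indic_fun mB) measurable_fst).
    apply: measurable_funM => //.
    exact: (measurableT_comp (measurable_tail x0 rho delta) measurable_snd).
  apply/(integrable12ltyP mu mu mG).
  have c0 : 0 <= A * r `^ delta * M by rewrite !mulr_ge0 ?powR_ge0// ltW.
  have [it _] := tail_integral x0 rho0 delta0.
  have fin1 : (\int[mu]_y (A * r `^ delta * M * tail x0 rho delta y)%:E < +oo)%E.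
    have /integrableP[_] := RintegrableZ (A * r `^ delta * M) measurableT it.
    by under eq_integral do rewrite /= ger0_norm ?mulr_ge0 ?tail_ge0 ?powR_ge0 ?(ltW A0)//.
  pose I := (\int[mu]_y (A * r `^ delta * M * tail x0 rho delta y)%:E)%E.
  have I0 : (0 <= I)%E by apply: integral_ge0 => y _; rewrite lee_fin mulr_ge0 ?tail_ge0.
  have inner x : (\int[mu]_y `|G (x, y)| = (indic (eball x0 r) x)%:E * I)%E.
    rewrite /I -ge0_integralZl//.
    - apply: eq_integral => y _; rewrite /G /= ger0_norm// mulr_ge0// ?mulr_ge0 ?powR_ge0 ?tail_ge0 ?(ltW A0)//.
      by rewrite /indic; case: ifP.
    - by apply/measurable_EFinP; apply: measurable_funM => //; exact: measurable_tail.
    - by move=> y _; rewrite lee_fin mulr_ge0 ?tail_ge0.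
    - by rewrite lee_fin /indic; case: ifP.
  under eq_integral do rewrite inner.
  rewrite ge0_integralZr//; last 2 first.
    by apply/measurable_EFinP; exact: measurable_indic_fun.
    by move=> x _; rewrite lee_fin /indic; case: ifP.
  have fi : (\int[mu]_x (indic (eball x0 r) x)%:E < +oo)%E.
    have -> : (\int[mu]_x (indic (eball x0 r) x)%:E = mu (eball x0 r))%E.
      rewrite -[RHS]mul1e -integral_cst// [RHS]integral_mkcond; apply: eq_integral => x _.
      by rewrite patchE /indic; case: ifP.
    exact: mu_eball_fin.
  apply: lte_mul_pinfty => //; first by apply: integral_ge0 => x _; rewrite lee_fin /indic; case: ifP.
  by rewrite ge0_fin_numE//; apply: integral_ge0 => x _; rewrite lee_fin /indic; case: ifP.
have [_ _ i1 _] := cfubini iF.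
have := cintegrable_measurable i1; congr cmeasurable; apply/funext => x.
rewrite /restr; case: ifPn => [xB|xB]; last by rewrite cintegral0// => y _; rewrite /F /= (negbTE xB).
rewrite [RHS]cintegral_mkcond; congr cintegral; apply/funext => y; rewrite /F /= xB.
by case: ifPn => // /set_mem yo; rewrite -(Kfar (set_mem xB) yo) -(K0far yo).
Qed.

End far_part.

End kernel.

(** * Continuous functions vanishing at infinity *)

Section C0_approximation.
Context {R : realType} {n : nat}.
Local Notation E := 'rV[R]_n.
Local Notation mu := (@lebesgue_rV R n).
Implicit Types (f : E -> R[i]) (x y : E).
Lemma ccontinuous_dist f x (e : R) : ccontinuous f -> 0 < e -> \forall y \near x, normc (f y - f x) < e.
Proof.
move=> [c1 c2] e0; have e2 : 0 < e / 2 by rewrite divr_gt0.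
have h1 := @cvgr_dist_lt R _ _ (nbhs x) (nbhs_filter x) _ _ (c1 x) _ e2.
have h2 := @cvgr_dist_lt R _ _ (nbhs x) (nbhs_filter x) _ _ (c2 x) _ e2.
apply: filterS2 h1 h2 => y a b; apply: (le_lt_trans (normc_le_ReIm _)).
by rewrite !ReImE (splitr e) ltrD// distrC.
Qed.

Lemma near_ball x (P : E -> Prop) : (\forall y \near x, P y) -> exists2 e : R, 0 < e & forall y, `|y - x| < e -> P y.
Proof.
move=> /nbhs_ballP[e /= e0 h]; exists e => // y yx; apply: h.
by rewrite -ball_normE /= distrC.
Qed.

Lemma heine f (r e : R) : ccontinuous f -> 0 < e ->
  exists2 eta : R, 0 < eta & forall x y, `|x| <= r -> `|y - x| < eta -> normc (f y - f x) < e.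
Proof.
move=> cf e0; have e2 : 0 < e / 2 by rewrite divr_gt0.
have := @compact_normball R n r; move/compact_near_coveringP.
move=> /(_ R (0 : R)^'+ (fun eta x => forall y, `|y - x| < eta -> normc (f y - f x) < e)) H.
have : \forall eta \near (0 : R)^'+, [set x : E | `|x| <= r] `<=` (fun x => forall y, `|y - x| < eta -> normc (f y - f x) < e).
  apply: H => x xr.
  have [t t0 ht] := near_ball (ccontinuous_dist x cf e2).
  have t2 : 0 < t / 2 by rewrite divr_gt0.
  exists ([set x' | `|x' - x| < t / 2], [set eta | eta <= t / 2]) => /=.
    split; last by exact: nbhs_right_le.
    by apply: (@filterS _ _ _ (ball x (t / 2))) => [z|]; [rewrite -ball_normE /= distrC|exact: nbhsx_ballx].
  move=> [x' eta] /= [h1 h2] y yx.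
  apply: (le_lt_trans (normc_triangle (f x) _ _)).
  rewrite (splitr e) (normc_distC (f x)) ltrD// ht//; last by apply: (lt_trans h1); rewrite ltr_pdivrMr// mulr2n mulrDr mulr1 ltrDl.
  rewrite (_ : y - x = (y - x') + (x' - x)); last by rewrite addrA subrK.
  apply: (le_lt_trans (ler_normD _ _)); rewrite (splitr t); apply: ltr_leD; last exact: ltW.
  exact: (lt_le_trans yx).
move=> h; have [eta [eta0 H2]] : exists eta : R, 0 < eta /\ [set x : E | `|x| <= r] `<=` (fun x => forall y, `|y - x| < eta -> normc (f y - f x) < e).
  have : \forall eta \near (0 : R)^'+, 0 < eta /\ [set x : E | `|x| <= r] `<=` (fun x => forall y, `|y - x| < eta -> normc (f y - f x) < e).
    by apply: filterS2 (nbhs_right_gt (0 : R)) h => eta a b.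
  by move=> /filter_ex.
by exists eta => // x y xr; exact: H2.
Qed.

Lemma ccontinuous_measurable f : ccontinuous f -> cmeasurable setT f.
Proof. by move=> [c1 c2]; split; [exact: (continuous_measurable_rV c1)|exact: (continuous_measurable_rV c2)]. Qed.

Definition cconv f (w : E -> R) x : R[i] :=
  conv (fun y => complex.Re (f y)) w x +i* conv (fun y => complex.Im (f y)) w x.

Definition clocint f := locint (fun y => complex.Re (f y)) /\ locint (fun y => complex.Im (f y)).

Lemma cconvE f w x : cconv f w x = cintegral mu setT (fun y => f y * (w (y - x))%:C).
Proof.
rewrite cintegralE; congr (_ +i* _); apply: eq_Rintegral => y _; rewrite ReImE /=; ring.
Qed.

Lemma csmooth_cconv f w (r : R) : clocint f -> smooth w -> supported w r -> csmooth (cconv f w).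
Proof. by move=> [l1 l2] sw wr; split; [exact: (smooth_conv l1 sw wr)|exact: (smooth_conv l2 sw wr)]. Qed.

Lemma cbounded_clocint f (M : R) : cmeasurable setT f -> (forall x, normc (f x) <= M) -> clocint f.
Proof.
move=> [m1 m2] hM; split; apply: (@bounded_locint _ _ _ M) => // x; apply: le_trans (hM x).
  exact: Re_le_normc.
exact: Im_le_normc.
Qed.

Lemma cconv_integrable f w x (r : R) : clocint f -> smooth w -> supported w r ->
  cintegrable mu setT (fun y => f y * (w (y - x))%:C).
Proof.
move=> [l1 l2] sw wr; split.
  have := conv_integrable x l1 (smooth_continuous sw) wr.
  by congr (_.-integrable _ _); apply/funext => y /=; rewrite ReImE /=; congr EFin; ring.
have := conv_integrable x l2 (smooth_continuous sw) wr.
by congr (_.-integrable _ _); apply/funext => y /=; rewrite ReImE /=; congr EFin; ring.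
Qed.

Lemma moll_shift_integrable (e : R) x : 0 < e -> mu.-integrable setT (EFin \o (fun y : E => moll e (y - x))).
Proof.
move=> e0; apply: (@supported_integrable _ _ _ (e + `|x|)); first exact: (smooth_shift (- x) (smooth_moll e)).
move=> y h; apply: moll_supp => //.
have := lerB_dist y x.
lra.
Qed.

Lemma cmoll_int (e : R) x : 0 < e -> cintegral mu setT (fun y : E => (moll e (y - x))%:C) = 1.
Proof.
move=> e0; rewrite cintegralE /= moll_int//; apply: complexP => //=.
by rewrite /Rintegral integral0.
Qed.

(** A mollification is an average over a ball of radius [e]. *)
Lemma cmoll_dist f (e eps : R) x : clocint f -> 0 < e -> 0 <= eps ->
  (forall y, `|y - x| < e -> normc (f y - f x) <= eps) ->
  normc (cconv f (moll e) x - f x) <= 2 * eps.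
Proof.
move=> lf e0 eps0 h.
have im := moll_shift_integrable x e0.
have icm : cintegrable mu setT (fun y : E => (moll e (y - x))%:C).
  split => //=; apply: (integrable_dom measurableT _ (g := fun y => moll e (y - x))) => //.
  by move=> y _; rewrite normr0 moll_ge0.
have -> : cconv f (moll e) x - f x = cintegral mu setT (fun y => f y * (moll e (y - x))%:C - f x * (moll e (y - x))%:C).
  rewrite cintegralB//; last exact: cintegrableZ.
    by rewrite cconvE cintegralZ// cmoll_int// mulr1.
  exact: (cconv_integrable x lf (smooth_moll e) (moll_supported e0)).
have i2 : mu.-integrable setT (EFin \o (fun y : E => eps * moll e (y - x))) by exact: RintegrableZ.
apply: (le_trans (normc_cintegral_le measurableT _ _ i2)).
- apply: (@cintegrable_measurable _ _ _ mu); apply: cintegrableB => //; last exact: cintegrableZ.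
  exact: (cconv_integrable x lf (smooth_moll e) (moll_supported e0)).
- move=> y _; rewrite -mulrBl normc_mul normc_real ger0_norm ?moll_ge0//.
  have [ye|ye] := ltP `|y - x| e; first by rewrite ler_wpM2r ?moll_ge0// h.
  by rewrite moll_supp// !mulr0.
- by rewrite RintegralZl// moll_int// mulr1.
Qed.

Lemma cutoff_exists (r : R) : exists u : E -> R,
  [/\ smooth u, supported u (r + 4), (forall x, 0 <= u x <= 1) & forall x, `|x| <= r -> u x = 1].
Proof.
pose U := [set x : E | `|x| < r + 4].
exists (urysohn_test U 1); split.
- exact: smooth_urysohn.
- by apply: urysohn_supported => // x; exact: ltW.
- by move=> x; rewrite urysohn_ge0 ?urysohn_le1.
- move=> x xr; apply: urysohn_eq1 => // y; rewrite mulr1 => yx.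
  rewrite /U /= (_ : y = (y - x) + x); last by rewrite subrK.
  by apply: (le_lt_trans (ler_normD _ _)); lra.
Qed.

Lemma C0_decay f (e : R) : C0 f -> 0 < e -> exists2 r : R, 0 <= r & forall x, r < `|x| -> normc (f x) < e.
Proof.
move=> [_ h] e0; have [r hr] := h _ e0; exists `|r| => // x rx; apply: hr.
by apply: lt_le_trans (norm_le_enorm x); apply: le_lt_trans rx; exact: ler_norm.
Qed.

Lemma C0_bounded f : C0 f -> exists2 M : R, 0 <= M & forall x, normc (f x) <= M.
Proof.
move=> f0; have [r r0 hr] := C0_decay f0 (@ltr01 R).
have [cf _] := f0; have [c1 c2] := cf.
have bd (u : E -> R) : continuous u -> exists2 M : R, 0 <= M & forall x, `|x| <= r -> `|u x| <= M.
  move=> cu.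
  have : compact (u @` [set x : E | `|x| <= r]).
    apply: continuous_compact; last exact: compact_normball.
    exact: continuous_subspaceT.
  move=> /compact_bounded[M [_ hM]].
  exists (`|M| + 1); first by rewrite addr_ge0.
  move=> x xr; apply: (hM (`|M| + 1)); last by exists x.
  by rewrite (le_lt_trans (ler_norm M))// ltrDl.
have [M1 M10 b1] := bd _ c1; have [M2 M20 b2] := bd _ c2.
exists (M1 + M2 + 1); first by rewrite !addr_ge0.
move=> x; have [xr|xr] := leP `|x| r; last by apply: (le_trans (ltW (hr _ xr))); rewrite lerDr addr_ge0.
apply: (le_trans (normc_le_ReIm _)); apply: (@le_trans _ _ (M1 + M2)); last by rewrite lerDl.
by apply: lerD; [exact: b1|exact: b2].
Qed.

(** Mollify and cut off: mollification is uniformly close to [f] on a large ball by uniform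
continuity, and outside of it both functions are small. *)
Lemma C0_approx f (e : R) : C0 f -> 0 < e -> exists2 phi : E -> R[i], test phi & forall x, normc (f x - phi x) <= e.
Proof.
move=> f0 e0; have [cf _] := f0.
have [M M0 hM] := C0_bounded f0.
have [r r0 hr] := C0_decay f0 e0.
have e2 : 0 < e / 2 by rewrite divr_gt0.
have [eta eta0 heta] := heine (r + 4) cf e2.
have [u [su ur u01 u1]] := cutoff_exists r.
have lf : clocint f by apply: (cbounded_clocint _ hM); exact: ccontinuous_measurable.
pose m := cconv f (moll eta).
have sm : csmooth m := csmooth_cconv lf (smooth_moll eta) (moll_supported eta0).
exists (fun x => m x * (u x)%:C); first exact: (testM sm (test_real su ur)).
move=> x; have /andP[ux0 ux1] := u01 x.
have [xr|xr] := leP `|x| r.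
  rewrite u1// mulr1 normc_distC; apply: (le_trans (cmoll_dist lf eta0 (ltW e2) _)); last by rewrite mulrC divfK.
  by move=> y yx; apply: ltW; apply: heta => //; apply: (le_trans xr); rewrite lerDl.
have [xr4|xr4] := leP `|x| (r + 4); last first.
  by rewrite ur// mulr0 subr0; apply: ltW; exact: hr.
have -> : f x - m x * (u x)%:C = (1 - u x)%:C * f x + (u x)%:C * (f x - m x).
  rewrite realcD realcN (_ : 1%:C = 1)//; ring.
apply: (le_trans (normcD_le _ _)); rewrite !normc_mul !normc_real !ger0_norm ?subr_ge0//.
have a1 : normc (f x) <= e by apply: ltW; exact: hr.
have a2 : normc (f x - m x) <= e.
  rewrite normc_distC; apply: (le_trans (cmoll_dist lf eta0 (ltW e2) _)); last by rewrite mulrC divfK.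
  by move=> y yx; apply: ltW; exact: heta.
have : (1 - u x) * normc (f x) + u x * normc (f x - m x) <= (1 - u x) * e + u x * e.
  by apply: lerD; rewrite ler_wpM2l ?subr_ge0.
by rewrite -mulrDl subrK mul1r.
Qed.

Lemma test_C0 f : test f -> C0 f.
Proof.
move=> tf; have [s1 s2] := test_csmooth tf; have [r r0 hr] := test_supported tf.
split; first by split; [exact: (smooth_continuous s1)|exact: (smooth_continuous s2)].
move=> e e0; exists (n%:R * r) => x hx; rewrite hr ?normc_0//.
rewrite ltNge; apply/negP => xr; move: hx; rewrite ltNge => /negP; apply.
by apply: (le_trans (enorm_le x)); rewrite ler_wpM2l.
Qed.

(** A weak form of the triangle inequality, from [(a + b)^2 <= 2 a^2 + 2 b^2] in every coordinate;
the constant 2 is absorbed in all applications. *)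
Lemma enormD_sqr x y : enorm (x + y) ^+ 2 <= 2 * enorm x ^+ 2 + 2 * enorm y ^+ 2.
Proof.
have S0 (z : E) : 0 <= \sum_i z 0 i ^+ 2 by apply: sumr_ge0 => i _; exact: sqr_ge0.
rewrite /enorm !sqr_sqrtr// !mulr_sumr -big_split /=; apply: ler_sum => i _.
rewrite mxE; have := sqr_ge0 (x 0 i - y 0 i); rewrite !expr2; nra.
Qed.

Lemma enormD_le (x y : E) : enorm (x + y) <= 2 * (enorm x + enorm y).
Proof.
rewrite -(ler_pXn2r (n := 2))// ?nnegrE ?mulr_ge0 ?addr_ge0 ?enorm_ge0//.
apply: (le_trans (enormD_sqr x y)); have := enorm_ge0 x; have := enorm_ge0 y.
have : 0 <= enorm x * enorm y by rewrite mulr_ge0 ?enorm_ge0.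
rewrite exprMn sqrrD !expr2; move: (enorm x) (enorm y) => a b ab a0 b0.
have := sqr_ge0 a; have := sqr_ge0 b; rewrite !expr2; lra.
Qed.

Lemma csmooth_continuous (f : E -> R[i]) : csmooth f -> ccontinuous f.
Proof. by case=> h1 h2; exact: (conj (smooth_continuous h1) (smooth_continuous h2)). Qed.

End C0_approximation.

(** * Mean oscillation *)

Section mean_oscillation.
Context {R : realType} {d : nat}.
Local Notation E := 'rV[R]_d.
Local Notation mu := (@lebesgue_rV R d).
Implicit Types (v w : E -> R[i]) (a x : E).
(** The mean distance of [v] to some constant is at most [M] on every cube. The constant is free,
unlike in the definition of the norm of [BMO], which makes this easy to add and to prove. *)
Definition osc v (M : R) := forall a (l : R), 0 < l -> exists c : R[i],
  mu.-integrable (cube a l) (EFin \o (fun x => normc (v x - c))) /\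
  \int[mu]_(x in cube a l) normc (v x - c) <= M * l ^+ d.

Lemma mu_cube_fin a (l : R) : 0 < l -> (mu (cube a l) < +oo)%E.
Proof. by move=> l0; rewrite lebesgue_cube ?ltry// ltW. Qed.

Lemma cmeasurable_shift v (c : R[i]) D : measurable D -> cmeasurable setT v -> cmeasurable D (fun x => v x - c).
Proof.
by move=> mD mv; apply: cmeasurableB; [exact: cmeasurableS mv|exact: cmeasurable_cst].
Qed.

Lemma oscD v w (M N : R) : cmeasurable setT v -> cmeasurable setT w -> osc v M -> osc w N -> osc (fun x => v x + w x) (M + N).
Proof.
move=> mv mw hv hw a l l0; have [c [i1 h1]] := hv a l l0; have [c' [i2 h2]] := hw a l l0.
have mQ := @measurable_cube R d a l.
have i := RintegrableD mQ i1 i2.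
have ptw x : cube a l x -> `|normc (v x + w x - (c + c'))| <= normc (v x - c) + normc (w x - c').
  move=> _; rewrite ger0_norm ?normc_ge0//; apply: (le_trans _ (normcD_le _ _)).
  by rewrite le_eqVlt; apply/orP; left; apply/eqP; congr normc; ring.
have m : measurable_fun (cube a l) (fun x => normc (v x + w x - (c + c'))).
  by apply: measurable_normc; apply: cmeasurable_shift => //; exact: cmeasurableD.
exists (c + c'); split; first exact: (integrable_dom mQ m ptw i).
apply: (le_trans (ler_norm _)); apply: (le_trans (Rintegral_le_dom mQ m ptw i)).
by rewrite RintegralD// mulrDl; apply: lerD.
Qed.

Lemma osc_bounded w (N : R) : cmeasurable setT w -> 0 <= N -> {ae mu, forall x, normc (w x) <= N} -> osc w N.
Proof.
move=> mw N0 h a l l0; exists 0; have mQ := @measurable_cube R d a l; have fQ := mu_cube_fin a l0.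
have mn : measurable_fun setT (fun x => normc (w x - 0)) by apply: measurable_normc; exact: cmeasurable_shift.
have mn' : measurable_fun (cube a l) (fun x => normc (w x - 0)) by exact: measurable_funS mn.
have bd : (\int[mu]_(x in cube a l) (normc (w x - 0))%:E <= (N * l ^+ d)%:E)%E.
  have -> : ((N * l ^+ d)%:E = \int[mu]_(x in cube a l) (cst N%:E x))%E.
    transitivity (N%:E * mu (cube a l))%E; last by rewrite integral_cst.
    by rewrite lebesgue_cube ?(ltW l0)// EFinM.
  apply: ae_ge0_le_integral => //.
  - by move=> x _; rewrite lee_fin normc_ge0.
  - exact/measurable_EFinP.
  - by apply: filterS h => x h _; rewrite subr0 lee_fin.
have i : mu.-integrable (cube a l) (EFin \o (fun x => normc (w x - 0))).
  apply/integrableP; split; first exact/measurable_EFinP.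
  apply: le_lt_trans (ltry (N * l ^+ d)); apply: le_trans bd.
  by rewrite le_eqVlt; apply/orP; left; apply/eqP; apply: eq_integral => x _ /=; rewrite ger0_norm ?normc_ge0.
split => //; rewrite -lee_fin /Rintegral fineK//; exact: integrable_fin_num.
Qed.

(** The mean of [v] on a cube is itself within [2 M] of the constant [c]. *)
Lemma osc_bmo_norm v (M : R) : cmeasurable setT v -> osc v M -> (bmo_norm v <= (3 * M)%:E)%E.
Proof.
move=> mv h; apply: ge_ereal_sup => _ [[a l] /= l0 <-].
have [c [i1 h1]] := h a l l0; set Q := cube a l.
have mQ : measurable Q by exact: measurable_cube.
have fQ : (mu Q < +oo)%E by exact: mu_cube_fin.
have muQ : fine (mu Q) = l ^+ d by rewrite lebesgue_cube_fine// ltW.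
have l0' : 0 < l ^+ d by rewrite exprn_gt0.
set I := \int[mu]_(x in Q) normc (v x - c).
have ic : cintegrable mu Q (fun x => v x - c).
  by apply: (cintegrable_dom mQ _ _ i1) => //; exact: cmeasurable_shift.
have ave_c : normc (c - ave Q v) <= 2 * (I / l ^+ d).
  have ik : cintegrable mu Q (fun=> c).
    by apply: (cintegrable_bounded (M := normc c)) => //; exact: cmeasurable_cst.
  have e : cintegral mu Q (fun x => v x - c) = cintegral mu Q v - (l ^+ d)%:C * c.
    have iv : cintegrable mu Q v.
      by have := cintegrableD mQ ic ik; congr cintegrable; apply/funext => x; rewrite subrK.
    rewrite cintegralB//; congr (_ - _).
    rewrite cintegralE !Rintegral_cst// muQ; apply: complexP; rewrite !ReImE /=; ring.
  have -> : c - ave Q v = - ((l ^+ d)^-1%:C * cintegral mu Q (fun x => v x - c)).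
    have l1 : ((l ^+ d)^-1)%:C * (l ^+ d)%:C = 1 :> R[i] by rewrite -realcM mulVf// gt_eqF.
    by rewrite e /ave muQ mulrBr mulrA l1 mul1r opprB.
  rewrite normc_opp normc_mul normc_real ger0_norm ?invr_ge0 ?(ltW l0')//.
  rewrite mulrA mulrC ler_wpM2r ?invr_ge0 ?(ltW l0')//.
  by apply: (normc_cintegral_le mQ _ _ i1) => //; exact: cmeasurable_shift.
have icst := integrable_cst (2 * (I / l ^+ d)) mQ fQ.
have i2 := RintegrableD mQ i1 icst.
have m : measurable_fun Q (fun x => normc (v x - ave Q v)) by apply: measurable_normc; exact: cmeasurable_shift.
have ptw x : Q x -> `|normc (v x - ave Q v)| <= normc (v x - c) + 2 * (I / l ^+ d).
  by move=> _; rewrite ger0_norm ?normc_ge0//; apply: (le_trans (normc_triangle c _ _)); rewrite lerD2l.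
have i3 := integrable_dom mQ m ptw i2.
have le1 := le_trans (ler_norm _) (Rintegral_le_dom mQ m ptw i2).
rewrite muQ -(fineK (integrable_fin_num mQ i3)) -EFinM lee_fin mulrC ler_pdivrMr//.
apply: (le_trans le1); rewrite RintegralD// Rintegral_cst// muQ -/I.
rewrite -!mulrA mulVf ?gt_eqF// mulr1; move: h1; rewrite -/I; lra.
Qed.

End mean_oscillation.

(** * Geometric sequences of mollifications *)

Section geometric.
Context {R : realType}.
(** The sum of a geometric series, for any function that satisfies the triangle inequality; it is
used for real and complex numbers. *)
Lemma geometric_dist (V : Type) (dist : V -> V -> R) (u : nat -> V) (C q : R) : 0 <= C -> 0 <= q < 1 ->
  (forall x, dist x x = 0) -> (forall x y z, dist x z <= dist x y + dist y z) ->
  (forall k, dist (u k.+1) (u k) <= C * q ^+ k) -> forall k m, dist (u (m + k)%N) (u k) <= C / (1 - q) * q ^+ k.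
Proof.
move=> C0 /andP[q0 q1] d0 tri h k m; have q1' : 0 < 1 - q by rewrite subr_gt0.
have key : dist (u (m + k)%N) (u k) <= C / (1 - q) * q ^+ k * (1 - q ^+ m).
  elim: m => [|m IH]; first by rewrite add0n d0 expr0 subrr mulr0.
  apply: (le_trans (tri _ (u (m + k)%N) _)); rewrite addSn.
  apply: (le_trans (lerD (h _) IH)); rewrite le_eqVlt; apply/orP; left; apply/eqP.
  by rewrite exprD exprS; field; rewrite gt_eqF.
apply: (le_trans key); apply: ler_piMr; last by rewrite gerBl exprn_ge0.
by rewrite mulr_ge0 ?exprn_ge0// divr_ge0// ltW.
Qed.

Lemma geometric_cvg (u : nat -> R) (C q : R) : 0 <= C -> 0 <= q < 1 ->
  (forall k, `|u k.+1 - u k| <= C * q ^+ k) -> cvgn u.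
Proof.
move=> C0 q01 h; have /andP[q0 q1] := q01; have q1' : 0 < 1 - q by rewrite subr_gt0.
pose c := C / (1 - q); have c0 : 0 <= c by rewrite divr_ge0// ltW.
have cC : c * (1 - q) = C by rewrite /c divfK// gt_eqF.
(* Subtracting the tail of the geometric series turns [u] into a nondecreasing sequence. *)
pose a k := u k - c * q ^+ k.
have ca : cvgn a.
  apply: nondecreasing_is_cvgn.
    apply/nondecreasing_seqP => k; rewrite /a exprS.
    have := h k; rewrite ler_norml => /andP[h1 _]; rewrite -cC in h1.
    have -> : c * (q * q ^+ k) = c * q ^+ k - c * (1 - q) * q ^+ k by ring.
    by lra.
  exists (u 0%N + c) => _ [k _ <-].
  have := geometric_dist (V := R) (dist := fun x y => `|x - y|) C0 q01 _ _ h 0%N k.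
  rewrite addn0 expr0 mulr1 -/c => H.
  have {}H : `|u k - u 0%N| <= c.
    by apply: H => [x|x y z]; [rewrite subrr normr0|exact: ler_distD].
  move: H; rewrite ler_norml => /andP[_ H]; rewrite /a.
  have : 0 <= c * q ^+ k by rewrite mulr_ge0// exprn_ge0.
  lra.
have qk : geometric c q @ \oo --> (0 : R) by apply: cvg_geometric; rewrite ger0_norm.
rewrite (_ : u = (a + geometric c q)%R); first exact: is_cvgD ca (cvgP _ qk).
by apply/funext => k; rewrite /a /geometric /= fctE subrK.
Qed.

Lemma cgeometric_cvg (u : nat -> R[i]) (C q : R) : 0 <= C -> 0 <= q < 1 ->
  (forall k, normc (u k.+1 - u k) <= C * q ^+ k) ->
  exists l, ccvg \oo u l /\ forall k, normc (l - u k) <= C / (1 - q) * q ^+ k.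
Proof.
move=> C0 q01 h.
have c1 : cvgn (fun k => complex.Re (u k)).
  apply: (geometric_cvg C0 q01) => k; apply: le_trans (h k).
  by rewrite -Re_opp -Re_add; exact: Re_le_normc.
have c2 : cvgn (fun k => complex.Im (u k)).
  apply: (geometric_cvg C0 q01) => k; apply: le_trans (h k).
  by rewrite -Im_opp -Im_add; exact: Im_le_normc.
exists (limn (fun k => complex.Re (u k)) +i* limn (fun k => complex.Im (u k))).
have cu : ccvg \oo u (limn (fun k => complex.Re (u k)) +i* limn (fun k => complex.Im (u k))).
  by apply/ccvgP; split.
split => // k.
have cs := ccvgD (F := \oo) cu (@ccvg_cst _ _ \oo _ (- u k)).
apply: (@ccvg_le _ _ \oo _ (fun j => u j - u k)); last exact: cs.
exists k => // m /= km.
have := geometric_dist (V := R[i]) (dist := fun x y => normc (x - y)) C0 q01 _ _ h k (m - k).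
rewrite subnK//; apply => [x|x y z]; first by rewrite subrr normc_0.
exact: normc_triangle.
Qed.

End geometric.

Section weak_limit.
Context {R : realType} {n : nat}.
Local Notation E := 'rV[R]_n.
Local Notation mu := (@lebesgue_rV R n).
Implicit Types (u g : E -> R[i]) (x y : E).
Lemma tensor_integrable (a b : E -> R) : (forall x, 0 <= a x) -> (forall x, 0 <= b x) ->
  mu.-integrable setT (EFin \o a) -> mu.-integrable setT (EFin \o b) ->
  (mu \x mu)%E.-integrable setT (EFin \o (fun z : E * E => a z.1 * b z.2)).
Proof.
move=> a0 b0 ia ib.
have ma : measurable_fun setT a by apply/measurable_EFinP; case/integrableP : ia.
have mb : measurable_fun setT b by apply/measurable_EFinP; case/integrableP : ib.
have abs (c : E -> R) : (forall x, 0 <= c x) -> mu.-integrable setT (EFin \o c) -> (\int[mu]_x (c x)%:E < +oo)%E.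
  by move=> c0 /integrableP[_]; under eq_integral do rewrite /= ger0_norm//.
have mG : measurable_fun setT (fun z : E * E => (a z.1 * b z.2)%:E).
  apply/measurable_EFinP; apply: measurable_funM.
    exact: (measurableT_comp ma measurable_fst).
  exact: (measurableT_comp mb measurable_snd).
apply/(integrable12ltyP mu mu mG).
have inner x : (\int[mu]_y `|(a x * b y)%:E| = (a x)%:E * \int[mu]_y (b y)%:E)%E.
  rewrite -ge0_integralZl//; last 3 first.
    exact/measurable_EFinP.
    by move=> y _; rewrite lee_fin.
    by rewrite lee_fin.
  by apply: eq_integral => y _; rewrite /= ger0_norm ?mulr_ge0// EFinM.
under eq_integral do rewrite inner.
rewrite ge0_integralZr//; last 3 first.
  exact/measurable_EFinP.
  by move=> x _; rewrite lee_fin.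
  by apply: integral_ge0 => y _; rewrite lee_fin.
apply: lte_mul_pinfty; last exact: abs.
  by apply: integral_ge0 => x _; rewrite lee_fin.
by rewrite ge0_fin_numE; [exact: abs|apply: integral_ge0 => x _; rewrite lee_fin].
Qed.

Lemma clocint_normc u (r : R) : clocint u -> mu.-integrable (nball 0 r) (EFin \o (fun x => normc (u x))).
Proof.
move=> [[m1 h1] [m2 h2]]; apply: cintegrable_normc; first exact: measurable_normball.
by split; [exact: h1|exact: h2].
Qed.

Lemma clocint_measurable u : clocint u -> cmeasurable setT u.
Proof. by case=> -[? _] [? _]. Qed.

(** Mollification is self-adjoint, because the mollifier is even. *)
Lemma cmoll_fubini u g (e : R) : clocint u -> 0 < e -> test g ->
  cintegral mu setT (fun x => cconv u (moll e) x * g x) = cintegral mu setT (fun y => u y * cconv g (moll e) y).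
Proof.
move=> lu e0 tg; have mu_ := clocint_measurable lu; have mg := test_cmeasurable (test_csmooth tg).
have [G G0 hG] := test_bounded tg; have [s s0 hs] := test_supported tg.
have gG x : normc (g x) <= G * indic (nball 0 s) x.
  by apply: normc_indic => // y h; apply: hs; rewrite ltNge; apply/negP => yr; apply: h; rewrite /nball /= subr0.
pose F (z : E * E) := u z.2 * (moll e (z.2 - z.1))%:C * g z.1.
have mmoll : measurable_fun setT (fun z : E * E => moll e (z.2 - z.1)).
  apply: (measurableT_comp (measurable_smooth (smooth_moll e))).
  apply: measurable_fun_rVP => i; under eq_fun do rewrite !mxE.
  apply: measurable_funB.
    exact: (measurableT_comp (measurable_rV_coord i) measurable_snd).
  exact: (measurableT_comp (measurable_rV_coord i) measurable_fst).
have mF : cmeasurable setT F.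
  apply: cmeasurableM; last exact: (cmeasurable_comp mg measurable_fst).
  apply: cmeasurableM; first exact: (cmeasurable_comp mu_ measurable_snd).
  exact: cmeasurable_real.
pose a x := G * indic (nball (0 : E) s) x.
pose b y := bump_const (n := n) / e ^+ n * (if y \in nball (0 : E) (s + e) then normc (u y) else 0).
have bc0 : 0 <= bump_const (R := R) (n := n) / e ^+ n by rewrite divr_ge0 ?exprn_ge0 ?(ltW e0)// ltW// bump_const_gt0.
have a0 x : 0 <= a x by rewrite mulr_ge0// /indic; case: ifP.
have b0 x : 0 <= b x by rewrite mulr_ge0//; case: ifP => // _; exact: normc_ge0.
have ia : mu.-integrable setT (EFin \o a).
  by apply: integrable_indic_cst; [exact: measurable_normball|exact: mu_normball_fin].
have ib : mu.-integrable setT (EFin \o b).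
  apply: RintegrableZ => //; apply/(integrable_mkcond mu (fun y => normc (u y)) (measurable_normball 0 (s + e))).
  exact: clocint_normc.
have iF : cintegrable (mu \x mu)%E setT F.
  apply: (cintegrable_dom measurableT mF _ (tensor_integrable a0 b0 ia ib)) => -[x y] _ /=.
  have ab0 : 0 <= a x * b y by rewrite mulr_ge0.
  have [xs|xs] := leP `|x| s; last by rewrite /F hs// mulr0 normc_0.
  have [h|h] := leP e `|y - x|; first by rewrite /F (moll_supp e0 h) mulr0 mul0r normc_0.
  have ys : `|y| <= s + e.
    have := lerB_dist y x.
    lra.
  rewrite /F /a /b /indic !mem_set /nball /= ?subr0// mulr1 !normc_mul normc_real ger0_norm ?moll_ge0// mulrC.
  have ml := ler_wpM2r (normc_ge0 (u y)) (moll_le (y - x) e0).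
  rewrite [normc (u y) * _]mulrC; apply: (ler_pM (normc_ge0 _) _ (hG x) ml).
  by rewrite mulr_ge0 ?normc_ge0 ?moll_ge0.
have [e1 e2 _ _] := cfubini iF.
have lg : clocint g by exact: (cbounded_clocint mg hG).
transitivity (cintegral (mu \x mu)%E setT F).
  rewrite e1; apply: eq_cintegral => x _; rewrite cconvE -cintegralZr//.
  exact: (cconv_integrable x lu (smooth_moll e) (moll_supported e0)).
rewrite e2; apply: eq_cintegral => y _; rewrite cconvE -cintegralZ//; last first.
  exact: (cconv_integrable y lg (smooth_moll e) (moll_supported e0)).
by apply: eq_cintegral => x _; rewrite /F /= moll_evenB; ring.
Qed.

Lemma clocint_bdd_integrable u w (s N : R) : clocint u -> cmeasurable setT w -> (forall x, normc (w x) <= N) ->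
  (forall x, ~ nball 0 s x -> w x = 0) -> cintegrable mu setT (fun x => u x * w x).
Proof.
move=> lu mw wN wD; have mD := @measurable_normball R n 0 s.
apply: (@cintegrable_supp _ _ _ _ (nball 0 s)) => //; first by move=> x /wD ->; rewrite mulr0.
apply: (cintegrable_dom mD _ _ (RintegrableZ N mD (clocint_normc s lu))).
  by apply: (cmeasurableS measurableT) => //; apply: cmeasurableM => //; exact: clocint_measurable.
by move=> x _; rewrite normc_mul mulrC ler_wpM2r ?normc_ge0.
Qed.

Lemma clocint_test_integrable u g : clocint u -> test g -> cintegrable mu setT (fun x => u x * g x).
Proof.
move=> lu tg; have [G G0 hG] := test_bounded tg; have [s s0 hs] := test_supported tg.
apply: (clocint_bdd_integrable (s := s) lu (test_cmeasurable (test_csmooth tg)) hG).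
by move=> x /negP; rewrite /nball /= subr0 -ltNge; exact: hs.
Qed.

(** By self-adjointness the mollification falls on [g], where convergence is uniform and the
supports stay in one ball. *)
Lemma moll_weak u g (e_ : nat -> R) : clocint u -> test g -> (forall k, 0 < e_ k) -> (e_ @ \oo --> 0) ->
  ccvg \oo (fun k => cintegral mu setT (fun x => cconv u (moll (e_ k)) x * g x)) (cintegral mu setT (fun x => u x * g x)).
Proof.
move=> lu tg e0 ecvg; have mu_ := clocint_measurable lu; have mg := test_cmeasurable (test_csmooth tg).
have [G G0 hG] := test_bounded tg; have [s s0 hs] := test_supported tg.
have [L L0 hL] := test_lipschitz tg.
have lg : clocint g by exact: (cbounded_clocint mg hG).
set D := nball (0 : E) (s + 1); have mD : measurable D by exact: measurable_normball.
have iu := clocint_normc (s + 1) lu.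
have gout x : s < `|x| -> g x = 0 by exact: hs.
have cout k x : e_ k <= 1 -> ~ D x -> cconv g (moll (e_ k)) x = 0.
  move=> ek /negP; rewrite /D /nball /= subr0 -ltNge => xs; rewrite cconvE; apply: cintegral0 => y _.
  have [ys|ys] := leP `|y| s; last by rewrite hs// mul0r.
  rewrite moll_supp ?mulr0//.
  have : `|x| <= `|y - x| + `|y| by rewrite distrC -[X in X <= _](_ : `|x - y + y| = _) ?ler_normD// subrK.
  lra.
pose B := \int[mu]_(x in D) normc (u x).
have B0 : 0 <= B by apply: Rintegral_ge0 => x _; exact: normc_ge0.
have bd k : e_ k <= 1 -> normc (cintegral mu setT (fun x => cconv u (moll (e_ k)) x * g x) - cintegral mu setT (fun x => u x * g x)) <= 4 * L * B * e_ k.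
  move=> ek; rewrite cmoll_fubini//.
  have mc : cmeasurable setT (cconv g (moll (e_ k))).
    exact: (test_cmeasurable (csmooth_cconv lg (smooth_moll (e_ k)) (moll_supported (e0 k)))).
  have dist x : normc (cconv g (moll (e_ k)) x - g x) <= 2 * (L * e_ k).
    apply: cmoll_dist => //; first by rewrite mulr_ge0// ltW.
    by move=> y yx; apply: (le_trans (hL y x)); rewrite ler_wpM2l// ltW.
  have outD x : ~ D x -> g x = 0.
    by move=> /negP; rewrite /D /nball /= subr0 -ltNge => xs; apply: gout; lra.

  have i1 : cintegrable mu setT (fun x => u x * cconv g (moll (e_ k)) x).
    apply: (@clocint_bdd_integrable _ _ (s + 1) (2 * (L * e_ k) + G) lu mc) => [x|x h].
      rewrite -[cconv _ _ _](subrK (g x)); apply: (le_trans (normcD_le _ _)); exact: lerD.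
    by apply: cout.
  have i2 := clocint_test_integrable lu tg.
  rewrite -cintegralB// (@cintegral_supp _ _ _ mu D); last by move=> x nD; rewrite (cout _ _ ek nD) (outD _ nD) subrr.
  have ptw x : D x -> normc (u x * cconv g (moll (e_ k)) x - u x * g x) <= 2 * (L * e_ k) * normc (u x).
    by move=> _; rewrite -mulrBr normc_mul mulrC ler_wpM2r ?normc_ge0.
  have m : cmeasurable D (fun x => u x * cconv g (moll (e_ k)) x - u x * g x).
    apply: (cintegrable_measurable (cintegrableS measurableT mD (@subsetT _ _) (cintegrableB measurableT i1 i2))).
  apply: (le_trans (normc_cintegral_le mD m ptw (RintegrableZ _ mD iu))).
  by rewrite RintegralZl// -/B le_eqVlt; apply/orP; left; apply/eqP; ring.
apply/cvgr0Pnorm_le => t t0.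
have q0 : 0 < t / (4 * L * B + 1) by rewrite divr_gt0// ltr_wpDl// !mulr_ge0.
move/cvgr0Pnorm_le : ecvg => ecvg.
apply: filterS2 (ecvg _ ltr01) (ecvg _ q0) => k; rewrite !ger0_norm ?normc_ge0 ?(ltW (e0 k))// => e1 e2.
apply: (le_trans (bd k e1)); rewrite ler_pdivlMr in e2; last by rewrite ltr_wpDl// !mulr_ge0.
have := ltW (e0 k); move: e2; rewrite mulrDr mulr1 mulrC; lra.
Qed.

(** The geometric sequence has a uniform limit [F]; integrals of [F] and of [u] against test
functions agree by [moll_weak], so [F = u] almost everywhere and the distance to the limit is
inherited. *)
Lemma moll_limit u (e_ : nat -> R) (C q : R) : clocint u -> (forall k, 0 < e_ k) -> (e_ @ \oo --> 0) -> 0 <= C -> 0 <= q < 1 ->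
  (forall k x, normc (cconv u (moll (e_ k.+1)) x - cconv u (moll (e_ k)) x) <= C * q ^+ k) ->
  {ae mu, forall x, forall k, normc (u x - cconv u (moll (e_ k)) x) <= C / (1 - q) * q ^+ k}.
Proof.
move=> lu e0 ecvg C0 q01 h.
have [F hF] := choice (fun x => cgeometric_cvg C0 q01 (fun k => h k x)).
pose Gk k := cconv u (moll (e_ k)).
have sG k : csmooth (Gk k) := csmooth_cconv lu (smooth_moll (e_ k)) (moll_supported (e0 k)).
have mG k : cmeasurable setT (Gk k) by exact: test_cmeasurable (sG k).
have mu_ := clocint_measurable lu.
have mF : cmeasurable setT F.
  split.
    apply: (@measurable_fun_cvg _ _ _ _ (fun k x => complex.Re (Gk k x))) => [k|x _]; first by case: (mG k).
    by have [/ccvgP[]] := hF x.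
  apply: (@measurable_fun_cvg _ _ _ _ (fun k x => complex.Im (Gk k x))) => [k|x _]; first by case: (mG k).
  by have [/ccvgP[]] := hF x.
have dF x := (hF x).2.
pose c := C / (1 - q).
have c0 : 0 <= c by case/andP: q01 => q0 q1; rewrite divr_ge0// subr_ge0 ltW.
have ae_ball N : {ae mu, forall x, eball 0 N.+1%:R x -> u x - F x = 0}.
  have mB : measurable (eball (0 : E) N.+1%:R) by exact: measurable_eball.
  have fB := mu_eball_fin (0 : E) N.+1%:R.
  have iu : cintegrable mu (eball (0 : E) N.+1%:R) u.
    have mN := @measurable_normball R n 0 N.+1%:R.
    apply: (cintegrableS mN mB).
      by move=> x /eball_bounded; rewrite /nball /= subr0; exact: ltW.
    by case: lu => -[_ h1] [_ h2]; split; [exact: h1|exact: h2].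
  have iG : forall g, test g -> cintegrable mu setT (fun x => F x * g x) /\ ccvg \oo (fun k => cintegral mu setT (fun x => Gk k x * g x)) (cintegral mu setT (fun x => F x * g x)).
    move=> g tg.
    have tG : test (fun x => Gk 0%N x * g x) by exact: testM.
    have iG0 := cintegrable_normc measurableT (test_integrable tG).
    have ig := cintegrable_normc measurableT (test_integrable tg).
    have idom := RintegrableD measurableT iG0 (RintegrableZ (c + c) measurableT ig).
    apply: (cintegral_cvg measurableT (g := fun x => normc (Gk 0%N x * g x) + (c + c) * normc (g x))) => //.
    - move=> k; apply: cmeasurableM => //; exact: (test_cmeasurable (test_csmooth tg)).
    - move=> x _; have [h1 _] := hF x; have h2 : ccvg \oo (fun k => g x * cconv u (moll (e_ k)) x) (g x * F x) by exact: ccvgM_cst.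
      by rewrite mulrC; under eq_fun do rewrite mulrC.
    - move=> k x _; rewrite -[Gk k x](subrK (Gk 0%N x)) mulrDl addrC; apply: (le_trans (normcD_le _ _)).
      rewrite lerD2l normc_mul; apply: ler_wpM2r; first exact: normc_ge0.
      apply: (le_trans (normc_triangle (F x) _ _)); rewrite normc_distC; apply: lerD.
        apply: (le_trans (dF x k)); rewrite -/c ler_piMr//; case/andP: q01 => q0 q1; exact: exprn_ile1 (ltW q1).
      by apply: (le_trans (dF x 0%N)); rewrite expr0 mulr1.
  apply: fundamental_lemma_c.
  - exact: open_eball.
  - by exists N.+1%:R => x /eball_bounded; rewrite subr0; exact: ltW.
  - exact: cmeasurableB.
  - apply: cintegrableB => //.
    have [chi [schi suppchi _ chi1]] := @cutoff_exists R n N.+1%:R.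
    have tG : test (fun x => Gk 0%N x * (chi x)%:C) by apply: testM => //; exact: (test_real schi suppchi).
    have [M M0 hM] := test_bounded tG.
    apply: (cintegrable_bounded (M := M + c)) => //; first exact: (cmeasurableS measurableT (@subsetT _ _) mF).
    move=> x /eball_bounded; rewrite subr0 => /ltW xN.
    rewrite -[F x](subrK (Gk 0%N x)) addrC; apply: (le_trans (normcD_le _ _)); apply: lerD.
      by have := hM x; rewrite chi1// mulr1.
    by apply: (le_trans (dF x 0%N)); rewrite expr0 mulr1.
  - move=> g r sg gr _ _; have tg : test (fun x => (g x)%:C) := test_real sg gr.
    have [i1 l1] := iG _ tg; have l2 := moll_weak lu tg e0 ecvg.
    under eq_cintegral do rewrite mulrBl.
    rewrite cintegralB//; last exact: clocint_test_integrable.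
    by rewrite (ccvg_unique l1 l2) subrr.
have H := ae_foralln ae_ball.
apply: filterS H => x hx k.
have xN : eball 0 (Num.truncn (enorm x)).+1%:R x by rewrite /eball /= subr0; exact: truncnS_gt.
by have /eqP := hx _ xN; rewrite subr_eq0 => /eqP ->; exact: dF.
Qed.

End weak_limit.

(** * Cutoffs and coverings by balls *)

Section ball_geometry.
Context {R : realType} {d : nat}.
Local Notation E := 'rV[R]_d.
Local Notation mu := (@lebesgue_rV R d).

Lemma ccvgM (u v : nat -> R[i]) l l' : ccvg \oo u l -> ccvg \oo v l' -> ccvg \oo (fun j => u j * v j) (l * l').
Proof.
move=> /ccvgP[h1 h2] /ccvgP[h3 h4]; apply/ccvgP; rewrite !ReImE; split.
  under eq_fun do rewrite !ReImE; apply: cvgB; exact: cvgM.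
under eq_fun do rewrite !ReImE; apply: cvgD; exact: cvgM.
Qed.

(** The weak triangle inequality is sharp enough here: [2 (2 r)^2 + 2 (2 r)^2 = (4 r)^2]. *)
Lemma eball_grow (x0 : E) (r e : R) y z : 0 < r -> enorm (y - x0) < 2 * r -> `|z - y| < e -> d%:R * e <= 2 * r ->
  eball x0 (4 * r) z.
Proof.
move=> r0 yr ze dr.
have h1 := enormD_sqr (z - y) (y - x0); rewrite addrA subrK in h1.
have h2 : enorm (z - y) <= 2 * r.
  by apply: (le_trans (enorm_le _)); apply: le_trans dr; rewrite ler_wpM2l// ltW.
rewrite /eball /= -(ltr_pXn2r (n := 2))// ?nnegrE ?enorm_ge0 ?mulr_ge0 ?(ltW r0)//.
apply: (le_lt_trans h1).
have h3 : enorm (z - y) ^+ 2 <= (2 * r) ^+ 2 by rewrite ler_pXn2r// ?nnegrE ?enorm_ge0 ?mulr_ge0 ?(ltW r0).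
have h4 : enorm (y - x0) ^+ 2 < (2 * r) ^+ 2 by rewrite ltr_pXn2r// ?nnegrE ?enorm_ge0 ?mulr_ge0 ?(ltW r0).
rewrite !exprMn in h3 h4 *; lra.
Qed.

(** On the shell [N <= |x| < N + 1] take [v N]; countably many null sets are discarded. *)
Lemma ae_glue (v : nat -> E -> R[i]) : (forall N, cmeasurable setT (v N)) ->
  (forall N, {ae mu, forall x, eball 0 N.+1%:R x -> v N.+1 x = v N x}) ->
  exists b, cmeasurable setT b /\ forall N, {ae mu, forall x, eball 0 N.+1%:R x -> b x = v N x}.
Proof.
move=> mv hv; pose k x := Num.truncn (enorm (x : E)).
have kP x N : (k x == N) = (N%:R <= enorm x < N.+1%:R).
  by rewrite /k -truncn_eq ?enorm_ge0.
exists (fun x => v (k x) x); split.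
  have key (u : nat -> E -> R) : (forall N, measurable_fun setT (u N)) -> measurable_fun setT (fun x => u (k x) x).
    move=> mu_ _ Y mY; rewrite setTI.
    rewrite (_ : _ @^-1` Y = \bigcup_N ((eball 0 N.+1%:R `\` eball 0 N%:R) `&` u N @^-1` Y)).
      apply: bigcup_measurable => N _; apply: measurableI; first by apply: measurableD; exact: measurable_eball.
      by rewrite -[X in measurable X]setTI; exact: mu_.
    apply/seteqP; split=> x /=.
      move=> h; exists (k x) => //; split => //; have /andP[h1 h2] : (k x)%:R <= enorm x < (k x).+1%:R by rewrite -kP.
      by rewrite /eball /= subr0; split => //; apply/negP; rewrite -leNgt.
    move=> [N _] [[h1 h2] h3]; move: h1 h2; rewrite /eball /= subr0 => h1 /negP; rewrite -leNgt => h2.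
    by have /eqP -> : k x == N by rewrite kP h1 h2.
  by split; [apply: (key (fun N x => complex.Re (v N x))) => N; case: (mv N)|apply: (key (fun N x => complex.Im (v N x))) => N; case: (mv N)].
move=> N; have := ae_foralln hv; apply: filterS => x hx xN.
have kN : (k x <= N)%N.
  have /andP[h1 _] : (k x)%:R <= enorm x < (k x).+1%:R by rewrite -kP.
  by move: xN; rewrite /eball /= subr0 => /(le_lt_trans h1); rewrite ltr_nat ltnS.
have xk : enorm x < (k x).+1%:R by have /andP[] : (k x)%:R <= enorm x < (k x).+1%:R by rewrite -kP.
rewrite -(subnK kN); elim: (N - k x)%N => [|j IH]; first by [].
rewrite addSn hx// /eball /= subr0; apply: (lt_le_trans xk); rewrite ler_nat; lia.
Qed.

Lemma test_scale (phi : E -> R[i]) (c : R) : 0 < c -> test phi -> test (fun x => phi (c *: x)).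
Proof.
move=> c0 tp; have [s s0 hs] := test_supported tp.
apply: (@testP _ _ _ (s / c)).
  have := csmooth_affine c 0 (test_csmooth tp); congr csmooth; apply/funext => x; by rewrite addr0.
move=> x; rewrite ltr_pdivrMr// => h; apply: hs; by rewrite normrZ gtr0_norm// mulrC.
Qed.

(** The smoothed indicator function of the ball of radius [4 r]: points of the ball of radius [2 r]
are deep inside by [eball_grow]. *)
Lemma ball_cutoff (x0 : E) (r : R) : 0 < r -> exists u : E -> R,
  [/\ smooth u, (forall x, 0 <= u x <= 1), (forall x, ~ eball x0 (4 * r) x -> u x = 0) &
      forall x, enorm (x - x0) < 2 * r -> u x = 1].
Proof.
move=> r0; pose e := 2 * r / (3 * d%:R + 1).
have e0 : 0 < e by rewrite divr_gt0 ?mulr_gt0// ltr_wpDl// mulr_ge0.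
exists (urysohn_test (eball x0 (4 * r)) e); split.
- exact: smooth_urysohn.
- by move=> x; rewrite urysohn_ge0 ?urysohn_le1.
- by move=> x nB; apply: urysohn_out => // /(inner_sub e0).
- move=> x xr; apply: urysohn_eq1 => // z zx; apply: (eball_grow r0 xr zx).
  have -> : d%:R * (3 * e) = 2 * r * ((3 * d%:R) / (3 * d%:R + 1)) by rewrite /e; ring.
  rewrite ler_piMr ?mulr_ge0 ?(ltW r0)// ler_pdivrMr ?mul1r ?lerDl// ltr_wpDl// mulr_ge0.
Qed.

(** The smoothed indicator function of the unit ball, at a scale so small that the ball of radius
1/2 is not affected. *)
Lemma cutoff_one : exists phi : E -> R, cutoff phi /\ smooth phi.
Proof.
pose e : R := (6 * d.+1%:R)^-1; have e0 : 0 < e by rewrite invr_gt0 mulr_gt0.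
have oU : open (eball (0 : E) 1) by exact: open_eball.
exists (urysohn_test (eball 0 1) e); split; last exact: smooth_urysohn.
have ss := @smooth_urysohn R d (eball 0 1) e e0.
have supp : supported (urysohn_test (eball (0 : E) 1) e) 1.
  by apply: urysohn_supported => // x /eball_bounded; rewrite subr0; exact: ltW.
split.
- exact: (test_real ss supp).
- by move=> x; rewrite urysohn_ge0 ?urysohn_le1.
- move=> x xh; apply: urysohn_eq1 => // z zx.
  have h1 := enormD_sqr (z - x) x; rewrite subrK in h1.
  have de : d%:R * (3 * e) < 2^-1.
    have -> : d%:R * (3 * e) = 2^-1 * (d%:R / d.+1%:R).
      have : d.+1%:R != 0 :> R by rewrite pnatr_eq0.
      by rewrite /e; move: (d.+1%:R) => D D0; field.
    by rewrite gtr_pMr ?invr_gt0// ltr_pdivrMr// mul1r ltr_nat.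
  have h2 : enorm (z - x) < 2^-1.
    apply: (le_lt_trans (enorm_le _)); apply: le_lt_trans de; by rewrite ler_wpM2l// ltW.
  rewrite /eball /= subr0 -(ltr_pXn2r (n := 2))// ?nnegrE ?enorm_ge0//.
  have h3 : enorm (z - x) ^+ 2 < 2^-1 ^+ 2 by rewrite ltr_pXn2r// ?nnegrE ?enorm_ge0 ?invr_ge0.
  have h4 : enorm x ^+ 2 <= 2^-1 ^+ 2 by rewrite ler_pXn2r// ?nnegrE ?enorm_ge0 ?invr_ge0.
  rewrite expr1n; rewrite !expr2 in h1 h3 h4 *; lra.
- exact: urysohn_csupp.
Qed.

Lemma test_moll (e : R) x : 0 < e -> test (fun y : E => (moll e (y - x))%:C).
Proof.
move=> e0; apply: (@test_real _ _ _ (e + `|x|)); first exact: (smooth_shift (- x) (smooth_moll e)).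
move=> y h; apply: moll_supp => //.
have := lerB_dist y x.
lra.
Qed.

Lemma moll_indic (e r : R) (x y : E) : 0 < e -> d.+1%:R * e <= r ->
  normc ((moll e (y - x))%:C : R[i]) <= bump_const (n := d) / e ^+ d * indic (eball x r) y.
Proof.
move=> e0 er; apply: (normc_indic (f := fun y => (moll e (y - x))%:C)) => [|z _|z nB].
- by rewrite divr_ge0 ?exprn_ge0 ?(ltW e0)// ltW// bump_const_gt0.
- by rewrite normc_real ger0_norm ?moll_ge0//; exact: moll_le.
- rewrite moll_supp// leNgt; apply/negP => h; apply: nB; apply: lt_le_trans er.
  apply: (le_lt_trans (enorm_le _)); apply: (@le_lt_trans _ _ (d%:R * e)).
    by rewrite ler_wpM2l// ltW.
  by rewrite ltr_pM2r// ltr_nat.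
Qed.

End ball_geometry.

(** * The operator off the support of its argument *)

Section operator.
Context {R : realType} {d : nat}.
Local Notation E := 'rV[R]_d.
Local Notation mu := (@lebesgue_rV R d).
Local Notation cnorm p f := (Lnorm mu p%:E (fun x => (normc (f x))%:E)).
Context (K : E -> E -> R[i]) (A delta : R).
Hypothesis A0 : 0 < A.
Hypothesis delta01 : 0 < delta <= 1.
Hypothesis mK : cmeasurable (~` @Pilot.Defs.diagonal R d) (fun z : E * E => K z.1 z.2).
Hypothesis Ksize : forall x y, x != y -> normc (K x y) <= A / enorm (x - y) ^+ d.
Hypothesis Ksmooth : forall x x' y, enorm (x - x') < 2^-1 * enorm (x - y) ->
              normc (K x y - K x' y) + normc (K y x - K y x') <=
              A * (enorm (x - x') `^ delta / enorm (x - y) `^ (d%:R + delta)).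
Context (T : (E -> R[i]) -> (E -> R[i]) -> R[i]) (Tp : (E -> R[i]) -> (E -> R[i])) (p Cp : R).
Hypothesis p1 : 1 < p.
Hypothesis Cp0 : 0 <= Cp.
Hypothesis TpLp : forall f, in_Lp p f -> in_Lp p (Tp f).
Hypothesis Tplin : forall (a : R[i]) f g, in_Lp p f -> in_Lp p g ->
         {ae mu, forall x, Tp (fun y => a * f y + g y) x = a * Tp f x + Tp g x}.
Hypothesis TpB : forall f, in_Lp p f -> (cnorm p (Tp f) <= Cp%:E * cnorm p f)%E.
Hypothesis extT : forall f g, schwartz f -> schwartz g -> T f g = cintegral mu setT (fun x => Tp f x * g x).
Hypothesis kerT : exists KT, distributional_kernel T KT /\ agrees_off_diagonal KT K.
(** Bounded measurable functions of bounded support. They belong to every [L^p], and truncations of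
functions of [C_0] to balls are of this kind. *)
Definition bdd (h : E -> R[i]) := cmeasurable setT h /\
  exists (M r : R), 0 <= M /\ forall x, normc (h x) <= M * indic (nball 0 r) x.

Lemma bdd_Lp h : bdd h -> in_Lp p h.
Proof.
move=> [mh [M [r [M0 hM]]]].
by have [] := Lp_bounded p1 (measurable_normball 0 r) (mu_normball_fin 0 r) mh M0 hM.
Qed.

Lemma test_bdd f : test f -> bdd f.
Proof.
move=> tf; split; first exact: (test_cmeasurable (test_csmooth tf)).
have [M M0 hM] := test_bounded tf; have [r r0 hr] := test_supported tf.
exists M, r; split => //; apply: normc_indic => // x h; apply: hr.
by rewrite ltNge; apply/negP => xr; apply: h; rewrite /nball /= subr0.
Qed.

Lemma bdd_lin (a : R[i]) h k : bdd h -> bdd k -> bdd (fun x => a * h x + k x).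
Proof.
move=> [mh [M [r [M0 hM]]]] [mk [N [s [N0 hN]]]]; split.
  by apply: cmeasurableD => //; exact: cmeasurableZ.
exists (normc a * M + N), (Num.max r s); split; first by rewrite addr_ge0 ?mulr_ge0 ?normc_ge0.
have sub (u v : R) x : u <= v -> indic (nball (0 : E) u) x <= indic (nball 0 v) x.
  move=> uv; rewrite /indic; case: ifPn => [/set_mem xu|_]; last by case: ifP.
  by rewrite mem_set//; apply: (le_trans xu).
move=> x; apply: (le_trans (normcD_le _ _)); rewrite mulrDl normc_mul; apply: lerD.
  rewrite -mulrA; apply: ler_wpM2l; first exact: normc_ge0.
  apply: (le_trans (hM x)); apply: ler_wpM2l => //; apply: sub; by rewrite le_max lexx.
by apply: (le_trans (hN x)); apply: ler_wpM2l => //; apply: sub; rewrite le_max lexx orbT.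
Qed.

Lemma bddB h k : bdd h -> bdd k -> bdd (fun x => h x - k x).
Proof.
move=> bh bk; have := bdd_lin (-1) bk bh.
by congr bdd; apply/funext => x; rewrite mulN1r addrC.
Qed.

Lemma bdd_restr (B : set E) (f : E -> R[i]) (M r : R) : measurable B -> cmeasurable setT f -> 0 <= M ->
  (forall x, normc (f x) <= M) -> B `<=` nball 0 r -> bdd (restr B f).
Proof.
move=> mB mf M0 fM Br; split; first exact: cmeasurable_restr.
exists M, r; split => // x; rewrite /restr /indic; case: ifPn => [/set_mem/Br h|_].
  by rewrite mem_set// mulr1.
by rewrite normc_0 mulr_ge0//; case: ifP.
Qed.

Lemma bdd_restr_eball a (r : R) (f : E -> R[i]) (M : R) : cmeasurable setT f -> 0 <= M ->
  (forall x, normc (f x) <= M) -> bdd (restr (eball a r) f).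
Proof.
move=> mf M0 fM; apply: (@bdd_restr _ _ M (r + `|a|)) => //; first exact: measurable_eball.
move=> x /eball_bounded h; rewrite /nball /= subr0.
have := lerB_dist x a.
lra.
Qed.

Lemma Tp_measurable h : bdd h -> cmeasurable setT (Tp h).
Proof. by move=> /bdd_Lp/TpLp[]. Qed.

Lemma Tp_integrable_normc h D : bdd h -> measurable D -> (mu D < +oo)%E ->
  mu.-integrable D (EFin \o (fun x => normc (Tp h x))).
Proof. by move=> bh mD fD; have [] := Lp_integral p1 (TpLp (bdd_Lp bh)) mD fD. Qed.

Lemma Tp_integrable h D : bdd h -> measurable D -> (mu D < +oo)%E -> cintegrable mu D (Tp h).
Proof.
move=> bh mD fD; apply: (cintegrable_dom mD _ _ (Tp_integrable_normc bh mD fD)) => //.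
by apply: cmeasurableS (Tp_measurable bh).
Qed.

Lemma TpB_ae h k : bdd h -> bdd k -> {ae mu, forall x, Tp (fun y => h y - k y) x = Tp h x - Tp k x}.
Proof.
move=> bh bk; have := Tplin (-1) (bdd_Lp bk) (bdd_Lp bh).
apply: filterS => x; rewrite mulN1r [_ + Tp h x]addrC => <-.
by congr (Tp _ x); apply/funext => y; rewrite mulN1r addrC.
Qed.

(** Hoelder twice: the [L^p] bound costs [|D|^(1/p)] for the function and [|D|^(1 - 1/p)] for its
image. *)
Lemma Tp_local h (M : R) D : measurable D -> (mu D < +oo)%E -> cmeasurable setT h -> 0 <= M ->
  bdd h -> (forall x, normc (h x) <= M * indic D x) ->
  \int[mu]_(x in D) normc (Tp h x) <= Cp * M * fine (mu D).
Proof.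
move=> mD fD mh M0 bh hM; have [hLp hn] := Lp_bounded p1 mD fD mh M0 hM.
have [_ hi] := Lp_integral p1 (TpLp hLp) mD fD.
rewrite -lee_fin; apply: (le_trans hi).
apply: (@le_trans _ _ (Cp%:E * (M%:E * (mu D `^ p^-1)) * (mu D `^ (1 - p^-1)))%E).
  apply: lee_wpmul2r; first exact: poweR_ge0.
  by apply: (le_trans (TpB hLp)); apply: lee_wpmul2l; rewrite ?lee_fin.
have m0 : (0 <= mu D)%E by exact: measure_ge0.
have mfin : mu D \is a fin_num by rewrite ge0_fin_numE.
rewrite -(fineK mfin) !poweR_EFin -!EFinM lee_fin.
rewrite -!mulrA ler_wpM2l// ler_wpM2l// mulrC.
have [->|z0] := eqVneq (fine (mu D)) 0.
  by rewrite !powR0 ?mul0r// ?subr_eq0 ?invr_eq0 gt_eqF// ?(lt_trans _ p1)// invf_lt1// (lt_trans _ p1).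
rewrite -powRD ?subrK ?powRr1 ?fine_ge0//.
by apply/implyP => _.
Qed.

Lemma Tp_pair_integrable h g : bdd h -> test g -> cintegrable mu setT (fun x => Tp h x * g x).
Proof.
move=> bh tg; have [G G0 hG] := test_bounded tg; have [r r0 hr] := test_supported tg.
have mB := @measurable_normball R d 0 r; have fB := @mu_normball_fin R d 0 r.
have mTg : cmeasurable setT (fun x => Tp h x * g x).
  by apply: cmeasurableM; [exact: Tp_measurable|exact: (test_cmeasurable (test_csmooth tg))].
apply: (@cintegrable_supp _ _ _ _ (nball 0 r)) => //.
  move=> x /negP; rewrite /nball /= subr0 -ltNge => /hr ->; exact: mulr0.
have iT := RintegrableZ G mB (Tp_integrable_normc bh mB fB).
apply: (cintegrable_dom mB _ _ iT); first exact: cmeasurableS mTg.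
by move=> x _; rewrite normc_mul mulrC ler_wpM2r ?normc_ge0.
Qed.

Lemma Tp_pair_le h g D (G : R) : bdd h -> test g -> measurable D -> (mu D < +oo)%E ->
  (forall x, normc (g x) <= G * indic D x) ->
  normc (cintegral mu setT (fun x => Tp h x * g x)) <= 2 * (G * \int[mu]_(x in D) normc (Tp h x)).
Proof.
move=> bh tg mD fD gG.
have gD x : ~ D x -> g x = 0.
  move=> nD; apply: normc_eq0; apply/eqP; rewrite eq_le normc_ge0 andbT.
  by have := gG x; rewrite /indic memNset ?mulr0.
rewrite (@cintegral_supp _ _ _ mu D) //; last by move=> x /gD ->; rewrite mulr0.
have iT := Tp_integrable_normc bh mD fD.
rewrite -RintegralZl//; apply: normc_cintegral_le => //; last exact: RintegrableZ.
  apply: (cmeasurableS measurableT) => //; apply: cmeasurableM; first exact: Tp_measurable.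
  exact: (test_cmeasurable (test_csmooth tg)).
move=> x Dx; rewrite normc_mul mulrC; apply: ler_wpM2r; first exact: normc_ge0.
by have := gG x; rewrite /indic mem_set ?mulr1.
Qed.

(** The tensor product of [g] and [f] is supported away from the diagonal, where the distributional
kernel is the function [K]. *)
Lemma kernel_rep f g x0 (r : R) : 0 < r -> test f -> test g ->
  (forall y, enorm (y - x0) < 2 * r -> f y = 0) -> (forall x, r <= enorm (x - x0) -> g x = 0) ->
  T f g = cintegral (mu \x mu)%E setT (fun z : E * E => Kz K z * f z.2 * g z.1).
Proof.
move=> r0 tf tg ff gg; have [KT [[_ hKT] agree]] := kerT.
pose Phi (z : 'rV[R]_(d + d)) := g (lsubmx z) * f (rsubmx z).
have tP : test Phi := test_tensor tg tf.
rewrite (hKT _ _ (test_schwartz tf) (test_schwartz tg)) (agree Phi tP).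
  apply: eq_cintegral => -[x y] _ /=; rewrite /Phi row_mxKl row_mxKr.
  have [xy|xy] := eqVneq x y; last by rewrite KzE//; ring.
  have [h|h] := ltP (enorm (y - x0)) (2 * r); first by rewrite ff// !mulr0 mul0r.
  by rewrite gg ?mul0r ?mulr0// xy; apply: le_trans h; lra.
pose C := [set z : 'rV[R]_(d + d) | enorm (lsubmx z - x0) <= r] `&` [set z | 2 * r <= enorm (rsubmx z - x0)].
have cE (a : E) : continuous (fun x : E => enorm (x - a)).
  move=> x; apply: (@continuous_comp _ _ _ (fun x : E => x - a) (@enorm R d)); first exact: continuous_addv.
  exact: continuous_enorm.
have cl : continuous (fun z : 'rV[R]_(d + d) => enorm (lsubmx z - x0)).
  move=> z; apply: (@continuous_comp _ _ _ (fun z : 'rV[R]_(d + d) => lsubmx z) (fun x => enorm (x - x0))); last exact: cE.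
  rewrite (_ : (fun z => lsubmx z) = proj (@lshift d d)); first exact: continuous_proj.
  by apply/funext => w; exact: lsubmx_proj.
have cr : continuous (fun z : 'rV[R]_(d + d) => enorm (rsubmx z - x0)).
  move=> z; apply: (@continuous_comp _ _ _ (fun z : 'rV[R]_(d + d) => rsubmx z) (fun x => enorm (x - x0))); last exact: cE.
  rewrite (_ : (fun z => rsubmx z) = proj (@rshift d d)); first exact: continuous_proj.
  by apply/funext => w; exact: rsubmx_proj.
have clC : closed C.
  apply: closedI.
    by apply: (@closed_comp _ _ (fun z => enorm (lsubmx z - x0)) [set t | t <= r]) => [z _|]; [exact: cl|exact: closed_le].
  by apply: (@closed_comp _ _ (fun z => enorm (rsubmx z - x0)) [set t | 2 * r <= t]) => [z _|]; [exact: cr|exact: closed_ge].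
apply: (@subset_trans _ C).
  apply: csupp_sub => // z nC; rewrite /Phi.
  have [h|h] := ltP (enorm (rsubmx z - x0)) (2 * r); first by rewrite ff// mulr0.
  rewrite gg ?mul0r// leNgt; apply/negP => h2; apply: nC; split => //=; exact: ltW.
move=> z [/= h1 h2]; apply/eqP => lr; move: h2; rewrite -lr leNgt => /negP; apply.
by apply: (le_lt_trans h1); rewrite ltr_pMl// ltr1n.
Qed.

(** Both sides are tested against smooth functions supported in the ball. For the approximating test
functions they agree by [kernel_rep]; the left side passes to the limit by the [L^p] bound and the
right side by dominated convergence. *)
Lemma off_support_rep h (h_ : nat -> E -> R[i]) x0 (r : R) D (M : R) : 0 < r -> measurable D -> (mu D < +oo)%E ->
  0 <= M -> bdd h -> (forall k, test (h_ k)) ->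
  (forall y, normc (h y) <= M * indic D y) -> (forall k y, normc (h_ k y) <= M * indic D y) ->
  (forall y, enorm (y - x0) < 2 * r -> h y = 0) -> (forall k y, enorm (y - x0) < 2 * r -> h_ k y = 0) ->
  (forall y, ccvg \oo (h_ ^~ y) (h y)) ->
  {ae mu, forall x, eball x0 r x -> Tp h x = cintegral mu setT (fun y => Kz K (x, y) * h y)}.
Proof.
move=> r0 mD fD M0 bh th hM h_M h0 h_0 hh.
pose B := eball x0 r.
have mB : measurable B by exact: measurable_eball.
have fB : (mu B < +oo)%E by exact: mu_eball_fin.
have mh : cmeasurable setT h by case: bh.
have mh_ k : cmeasurable setT (h_ k) by exact: (test_cmeasurable (test_csmooth (th k))).
pose I x := cintegral mu setT (fun y => Kz K (x, y) * h y).
pose one : E -> R[i] := fun x => (indic B x)%:C.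
have mone : cmeasurable setT one by apply: cmeasurable_real; exact: measurable_indic_fun.
have one1 x : normc (one x) <= 1 * indic B x.
  by rewrite mul1r normc_real ger0_norm// /indic; case: ifP.
have [_ iI] := sep_fubini A0 delta01 mK Ksize Ksmooth r0 mD fD M0 ler01 mh mone hM h0 one1.
(* The indicator function [one] is there to make the kernel integral integrable on the whole space.
   *)
pose v x := Tp h x - I x * one x.
have mv : cmeasurable setT v by apply: cmeasurableB; [exact: Tp_measurable|exact: (cintegrable_measurable iI)].
have iv : cintegrable mu B v.
  by apply: cintegrableB => //; [exact: Tp_integrable|exact: (cintegrableS measurableT mB (@subsetT _ _) iI)].
suff H : {ae mu, forall x, B x -> v x = 0}.
  apply: filterS H => x /= H Bx; have := H Bx; rewrite /v /one /indic mem_set// mulr1 => /eqP.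
  by rewrite subr_eq0 => /eqP.
apply: (fundamental_lemma_c _ _ mv iv); first exact: open_eball.
  exists (r + `|x0|) => x /eball_bounded hx.
  have := lerB_dist x x0.
  lra.
move=> g s sg gs g01 gB; set gC := fun x => (g x)%:C.
have tg : test gC := test_real sg gs.
have mg : cmeasurable setT gC := test_cmeasurable (test_csmooth tg).
have gout x : ~ B x -> gC x = 0 by move=> nB; apply: csupp_out => /gB.
have gG x : normc (gC x) <= 1 * indic B x.
  rewrite mul1r /indic; case: ifPn => [_|/negP nB]; last by rewrite gout ?normc_0// => Bx; apply: nB; exact: mem_set.
  by rewrite normc_real; have /andP[g0 g1] := g01 x; rewrite ger0_norm.
have gG' x : r <= enorm (x - x0) -> gC x = 0.
  by move=> rx; apply: gout; rewrite /B /eball /= ltNge rx.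
have [e1 i1] := sep_fubini A0 delta01 mK Ksize Ksmooth r0 mD fD M0 ler01 mh mg hM h0 gG.
have -> : cintegral mu setT (fun x => v x * gC x) = cintegral mu setT (fun x => Tp h x * gC x) - cintegral mu setT (fun x => I x * gC x).
  rewrite -cintegralB//; last exact: Tp_pair_integrable.
  apply: eq_cintegral => x _; rewrite /v mulrBl; congr (_ - _); rewrite -mulrA; congr (_ * _).
  rewrite /one /indic; case: ifPn => [_|/negP nB]; first by rewrite mul1r.
  by rewrite gout ?mulr0// => Bx; apply: nB; exact: mem_set.
rewrite -e1.
apply/eqP; rewrite subr_eq0; apply/eqP.
have c1 : ccvg \oo (fun k => cintegral mu setT (fun x => Tp (h_ k) x * gC x)) (cintegral mu setT (fun x => Tp h x * gC x)).
  apply/cvgr0Pnorm_le => e e0.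
  have bk k := test_bdd (th k).
  have mBD : 0 <= fine (mu B) `^ (1 - p^-1) by exact: powR_ge0.
  pose q := 2 * (Cp * fine (mu B) `^ (1 - p^-1)) + 1.
  have q0 : 0 < q by rewrite ltr_wpDl// !mulr_ge0.
  have M20 : 0 <= M + M by rewrite addr_ge0.
  have near1 : \forall k \near \oo, (cnorm p (fun y => h_ k y - h y) <= (e / q)%:E)%E.
    apply: (Lp_small p1 mD fD (M := M + M)) => //.
    - by move=> k; exact: cmeasurableB.
    - by move=> k x; rewrite mulrDl; apply: (le_trans (normcB_le _ _)); apply: lerD.
    - by rewrite divr_gt0.
  apply: filterS near1 => k hk; rewrite ger0_norm ?normc_ge0//.
  have bd := bddB (bk k) bh.
  have -> : cintegral mu setT (fun x => Tp (h_ k) x * gC x) - cintegral mu setT (fun x => Tp h x * gC x) =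
            cintegral mu setT (fun x => Tp (fun y => h_ k y - h y) x * gC x).
    rewrite -cintegralB//; try exact: Tp_pair_integrable.
    apply: ae_eq_cintegral => //.
    - by apply: (@cintegrable_measurable _ _ _ mu); apply: cintegrableB => //; exact: Tp_pair_integrable.
    - exact: (cintegrable_measurable (Tp_pair_integrable bd tg)).
    - by apply: filterS (TpB_ae (bk k) bh) => x h1 _; rewrite h1 mulrBl.
  apply: (le_trans (Tp_pair_le bd tg mB fB gG)); rewrite mul1r.
  have [_ hi] := Lp_integral p1 (TpLp (bdd_Lp bd)) mB fB.
  have mfin : mu B \is a fin_num by rewrite ge0_fin_numE.
  have : ((\int[mu]_(x in B) normc (Tp (fun y => h_ k y - h y) x))%:E <= (Cp * (e / q) * fine (mu B) `^ (1 - p^-1))%:E)%E.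
    apply: (le_trans hi); rewrite -{1}(fineK mfin) poweR_EFin EFinM; apply: lee_wpmul2r; first by rewrite lee_fin.
    by apply: (le_trans (TpB (bdd_Lp bd))); rewrite EFinM; apply: lee_wpmul2l; rewrite ?lee_fin.
  rewrite lee_fin => /(ler_wpM2l (ler0n R 2)) /le_trans; apply.
  have -> : 2 * (Cp * (e / q) * fine (mu B) `^ (1 - p^-1)) = e * ((q - 1) / q) by rewrite /q; ring.
  by rewrite ler_piMr ?(ltW e0)// ler_pdivrMr// mul1r; lra.
have c2 : ccvg \oo (fun k => cintegral mu setT (fun x => Tp (h_ k) x * gC x)) (cintegral (mu \x mu)%E setT (fun z : E * E => Kz K z * h z.2 * gC z.1)).
  have e2 k : cintegral mu setT (fun x => Tp (h_ k) x * gC x) = cintegral (mu \x mu)%E setT (fun z : E * E => Kz K z * h_ k z.2 * gC z.1).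
    by rewrite -(extT (test_schwartz (th k)) (test_schwartz tg)); exact: (kernel_rep r0 (th k) tg (h_0 k) gG').
  rewrite (_ : (fun k => _) = (fun k => cintegral (mu \x mu)%E setT (fun z : E * E => Kz K z * h_ k z.2 * gC z.1))); last first.
    by apply/funext => k; exact: e2.
  pose S : set (E * E) := eball x0 r `*` D.
  have mS : measurable S by exact: measurableX.
  have fS : ((mu \x mu)%E S < +oo)%E by rewrite /S product_measure1E// lte_mul_pinfty// ge0_fin_numE.
  have [] := @cintegral_cvg _ _ _ (mu \x mu)%E setT (fun k (z : E * E) => Kz K z * h_ k z.2 * gC z.1) (fun z => Kz K z * h z.2 * gC z.1)
     (fun z => if z \in S then Kbound (d := d) A delta r * M * 1 else 0) measurableT => //.
  - by move=> k; exact: (sep_measurable mK).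
  - move=> [x y] _ /=.
    have -> : (fun k => Kz K (x, y) * h_ k y * gC x) = (fun k => Kz K (x, y) * gC x * h_ k y).
      by apply/funext => k; ring.
    have -> : Kz K (x, y) * h y * gC x = Kz K (x, y) * gC x * h y by ring.
    exact: ccvgM_cst (hh y).
  - by apply/(integrable_mkcond _ (fun=> Kbound (d := d) A delta r * M * 1) mS); exact: integrable_cst.
  - by move=> k z _; exact: (sep_bound A0 delta01 Ksize Ksmooth r0 M0 ler01 (h_M k) (h_0 k) gG).
exact: (ccvg_unique c1 c2).
Qed.

(** The function [f 1_U - f 1_V] vanishes near the ball, so the operator acts on it through the
kernel. It is the pointwise limit of test functions that vanish on the double ball: approximations
of [f] times differences of smoothed indicator functions. *)
Lemma Tp_restr_enlarge f x0 (r : R) x1 (s : R) : C0 f -> 0 < r -> eball x0 (4 * r) `<=` eball x1 s ->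
  {ae mu, forall x, eball x0 r x -> Tp (restr (eball x1 s) f) x =
     Tp (restr (eball x0 (4 * r)) f) x + cintegral mu (eball x1 s `\` eball x0 (4 * r)) (fun y => K x y * f y)}.
Proof.
move=> fC r0; set V := eball x0 (4 * r); set U := eball x1 s => VU.
have mf : cmeasurable setT f by case: fC => cf _; exact: ccontinuous_measurable.
have [M M0 fM] := C0_bounded fC.
have oU : open U by exact: open_eball.
have oV : open V by exact: open_eball.
have mU : measurable U by exact: measurable_eball.
have mV : measurable V by exact: measurable_eball.
have [bU bV] : bdd (restr U f) /\ bdd (restr V f) by split; apply: (bdd_restr_eball _ _ mf M0 fM).
pose h y := restr U f y - restr V f y.
have hE y : h y = f y * (indic U y - indic V y)%:C.
  have rE (W : set E) : restr W f y = f y * (indic W y)%:C by rewrite /restr /indic; case: ifP; rewrite ?mulr1 ?mulr0.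
  by rewrite /h !rE realcD realcN mulrBr.
pose ep k : R := k.+1%:R^-1.
have ep0 k : 0 < ep k by rewrite invr_gt0.
have d1 : 0 < 2 * r / (3 * d%:R + 1) by rewrite divr_gt0 ?mulr_gt0// ltr_wpDl// mulr_ge0.
(* The smoothing scale is kept below a multiple of [r], so that both smoothed indicator functions
   equal 1 on the double ball. *)
have [k0 hk0] : exists k0, forall k, ep (k + k0)%N < 2 * r / (3 * d%:R + 1).
  have [N _ hN] := near_infty_natSinv_lt (PosNum d1).
  by exists N => k; apply: hN => /=; exact: leq_addl.
have ex k : {phi : E -> R[i] | test phi /\ forall x, normc (f x - phi x) <= ep k}.
  by apply: cid; have [phi t1 t2] := C0_approx fC (ep0 k); exists phi.
pose phi k := sval (ex k).
have tphi k : test (phi k) by case: (svalP (ex k)).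
have dphi k x : normc (f x - phi k x) <= ep k by case: (svalP (ex k)) => _; exact.
pose w k y : R := urysohn_test U (ep (k + k0)%N) y - urysohn_test V (ep (k + k0)%N) y.
pose h_ k y := (w k y)%:C * phi k y.
have innerVU e y : inner V e y -> inner U e y by move=> H z /H/VU.
have w1 k y : `|w k y| <= 1.
  rewrite ler_norml /w.
  have := urysohn_ge0 U (ep0 (k + k0)%N) y; have := urysohn_le1 U (ep0 (k + k0)%N) y.
  have := urysohn_ge0 V (ep0 (k + k0)%N) y; have := urysohn_le1 V (ep0 (k + k0)%N) y.
  by move=> *; apply/andP; split; lra.
have wout k y : ~ U y -> w k y = 0.
  move=> nU; rewrite /w urysohn_out//; last by move=> /(inner_sub (ep0 _)).
  by rewrite urysohn_out ?subrr// => /(inner_sub (ep0 _)) /VU.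
have wnear k y : enorm (y - x0) < 2 * r -> w k y = 0.
  move=> yr; have iV : inner V (3 * ep (k + k0)%N) y.
    move=> z zy; apply: (eball_grow r0 yr zy).
    have := hk0 k; rewrite ltr_pdivlMr; last by rewrite ltr_wpDl// mulr_ge0.
    have := ep0 (k + k0)%N; lra.
  rewrite /w urysohn_eq1//; last exact: innerVU.
  by rewrite urysohn_eq1 ?subrr.
have ep1 k : ep k <= 1 by rewrite /ep invf_le1// ler1n.
have rep := @off_support_rep h h_ x0 r U (M + 1) r0 mU (mu_eball_fin x1 s).
have {}rep : {ae mu, forall x, eball x0 r x -> Tp h x = cintegral mu setT (fun y => Kz K (x, y) * h y)}.
  apply: rep => //.
  - by rewrite addr_ge0.
  - exact: bddB.
  - move=> k; apply: testM => //; apply: csmooth_real; apply: smoothB; exact: smooth_urysohn.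
  - apply: normc_indic => [|y _|y nU]; first by rewrite addr_ge0.
      rewrite hE normc_mul -[leRHS]mulr1.
      apply: (ler_pM (normc_ge0 _) (normc_ge0 _)).
        by apply: (le_trans (fM y)); rewrite lerDl.
      rewrite normc_real /indic; case: ifP; case: ifP; by rewrite ?subrr ?subr0 ?sub0r ?normrN ?normr0 ?normr1.
    by rewrite hE /indic !memNset ?subrr ?mulr0// => /VU.
  - move=> k; apply: normc_indic => [|y _|y nU]; first by rewrite addr_ge0.
      rewrite normc_mul normc_real -[leRHS]mul1r; apply: ler_pM; rewrite ?normc_ge0//.
      rewrite (_ : phi k y = f y - (f y - phi k y)); last by rewrite opprB addrC subrK.
      by apply: (le_trans (normcB_le _ _)); apply: lerD => //; apply: (le_trans (dphi k y)).
    by rewrite /h_ wout// mul0r.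
  - move=> y yr; rewrite hE; have Vy : V y by rewrite /V /eball /=; apply: (lt_trans yr); lra.
    by rewrite /indic !mem_set ?subrr ?mulr0//; exact: VU.
  - by move=> k y yr; rewrite /h_ wnear// mul0r.
  - move=> y; rewrite hE mulrC; apply: ccvgM.
      apply/ccvgP; split => /=; last exact: cvg_cst.
      have cw (W : set E) : open W -> (fun k => urysohn_test W (ep (k + k0)%N) y) @ \oo --> indic W y.
        move=> oW; exact: (@cvg_comp _ _ _ (addn^~ k0) (fun k => urysohn_test W k.+1%:R^-1 y) \oo \oo _ (cvg_addnr k0) (urysohn_cvg oW)).
      by apply: cvgB; exact: cw.
    apply/cvgr0Pnorm_le => e e0; near=> k.
    rewrite ger0_norm ?normc_ge0// normc_distC; apply: (le_trans (dphi k y)); apply: ltW.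
    by near: k; exact: (near_infty_natSinv_lt (PosNum e0)).
apply: filterS2 rep (TpB_ae bU bV) => x h1 h2 xB.
have h3 : Tp (restr U f) x = Tp (restr V f) x + Tp h x by rewrite [Tp h x]h2 addrCA subrr addr0.
rewrite h3 h1//; congr (_ + _).
rewrite [RHS]cintegral_mkcond; apply: eq_cintegral => y _.
rewrite hE in_setD /indic; case: ifPn => yU; case: ifPn => yV; rewrite ?subrr ?subr0 ?mulr0//=.
  rewrite mulr1 KzE//; apply/eqP => xy; move/negP: yV; apply; rewrite -xy; apply: mem_set.
  by move: xB; rewrite /V /eball /=; lra.
by move/negP: yU; case; apply: mem_set; apply: VU; exact: set_mem.
Unshelve. all: by end_near. Qed.

(** The expression of the image of [f] on the ball [B(x0, r)] in the pairing that defines it. *)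
Definition local_image f x0 r x : R[i] := Tp (restr (eball x0 (4 * r)) f) x + far K f x0 r x.

(** * Local images and their gluing *)

(** The operator parts differ by an integral of the kernel over [U \ V]; the far parts differ by the
same integral up to terms that do not depend on [x]. *)
Lemma local_image_change f x0 (r : R) x1 (s : R) : C0 f -> 0 < r -> 0 < s ->
  eball x0 (4 * r) `<=` eball x1 (4 * s) -> eball x0 r `<=` eball x1 s ->
  exists c, {ae mu, forall x, eball x0 r x -> local_image f x1 s x = local_image f x0 r x + c}.
Proof.
move=> fC r0 s0 VU Bs; set V := eball x0 (4 * r); set U := eball x1 (4 * s).
have mf : cmeasurable setT f by case: fC => cf _; exact: ccontinuous_measurable.
have [M M0 fM] := C0_bounded fC.
have mU : measurable U by exact: measurable_eball.
have mV : measurable V by exact: measurable_eball.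
have mUV : measurable (U `\` V) by exact: measurableD.
have fUV : (mu (U `\` V) < +oo)%E.
  apply: (le_lt_trans _ (mu_eball_fin x1 (4 * s))); apply: le_measure; rewrite ?inE//; exact: subDsetl.
have xx0 : eball x0 r x0 by rewrite /eball /= subrr enorm0.
have iK x : eball x0 r x -> cintegrable mu (U `\` V) (fun y => K x y * f y).
  move=> xB.
  have sep y : (U `\` V) y -> 4 * r <= enorm (y - x0) by move=> [_] h; rewrite leNgt; apply/negP.
  have KE y : (U `\` V) y -> Kz K (x, y) = K x y.
    by move=> /sep h; rewrite KzE//; apply: (sep_neq xB); lra.
  have mKf : cmeasurable (U `\` V) (fun y => K x y * f y).
    have := cmeasurableS (D' := U `\` V) measurableT (@subsetT _ _) (cmeasurableM (measurable_Kz1 mK x) mf).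
    case=> m1 m2; split; [apply: eq_measurable_fun m1|apply: eq_measurable_fun m2] => y /set_mem yo; by rewrite KE.
  apply: (cintegrable_bounded (M := Kbound (d := d) A delta r * M)) => // y yUV.
  rewrite normc_mul; apply: ler_pM; rewrite ?normc_ge0//.
  apply: (kernel_le A0 delta01 Ksize Ksmooth xB); have := sep y yUV; lra.
exists (far K f x1 s x0 + cintegral mu (U `\` V) (fun y => K x0 y * f y)).
apply: filterS (Tp_restr_enlarge fC r0 VU) => x h xB.
rewrite /local_image h// -/V -/U.
have h24 (t : R) : 0 < t -> 2 * t <= 4 * t by move=> t0; lra.
have nU : ~` U `<=` ~` V by apply: subsetC.
have mnU : measurable (~` U) by exact: measurableC.
have mnV : measurable (~` V) by exact: measurableC.
have i1 : cintegrable mu (~` V) (fun y => (K x y - K x0 y) * f y).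
  exact: (far_integrable A0 delta01 mK Ksmooth r0 (h24 _ r0) mf fM xB).
have i2 z : eball x0 r z -> cintegrable mu (~` U) (fun y => (K z y - K x1 y) * f y).
  move=> /Bs; exact: (far_integrable A0 delta01 mK Ksmooth s0 (h24 _ s0) mf fM).
have e1 : far K f x0 r x = cintegral mu (~` U) (fun y => (K x y - K x0 y) * f y) + cintegral mu (U `\` V) (fun y => (K x y - K x0 y) * f y).
  rewrite /far (cintegral_setI_split mnV mnU nU i1); congr (_ + cintegral _ _ _).
  by rewrite setDE setCK setIC.
have e2 : cintegral mu (~` U) (fun y => (K x y - K x0 y) * f y) = far K f x1 s x - far K f x1 s x0.
  rewrite /far -cintegralB//; [|exact: i2|exact: i2].
  by apply: eq_cintegral => y _; ring.
have e3 : cintegral mu (U `\` V) (fun y => (K x y - K x0 y) * f y) =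
  cintegral mu (U `\` V) (fun y => K x y * f y) - cintegral mu (U `\` V) (fun y => K x0 y * f y).
  rewrite -cintegralB//; [|exact: iK|exact: iK].
  by apply: eq_cintegral => y _; ring.
rewrite e1 e2 e3; ring.
Qed.

Lemma local_image_measurable f x0 (r : R) : C0 f -> 0 < r -> cmeasurable setT (restr (eball x0 r) (local_image f x0 r)).
Proof.
move=> fC r0; have mf : cmeasurable setT f by case: fC => cf _; exact: ccontinuous_measurable.
have [M M0 fM] := C0_bounded fC; have r24 : 2 * r <= 4 * r by lra.
have m1 : cmeasurable setT (restr (eball x0 r) (Tp (restr (eball x0 (4 * r)) f))).
  apply: cmeasurable_restr; first exact: measurable_eball.
  apply: Tp_measurable; exact: (bdd_restr_eball _ _ mf M0 fM).
have m2 : cmeasurable setT (restr (eball x0 r) (far K f x0 r)).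
  exact: (far_measurable_x A0 delta01 mK Ksmooth x0 r0 r24 mf M0 fM).
have := cmeasurableD m1 m2; congr cmeasurable; apply/funext => x; rewrite /restr /local_image.
by case: ifP; rewrite ?addr0.
Qed.

(** A function representing [T f]: up to a constant on every ball, it is the local image. *)
Definition is_image f b := cmeasurable setT b /\
  forall x0 (r : R), 0 < r -> exists c, {ae mu, forall x, eball x0 r x -> b x = local_image f x0 r x + c}.

(** The local images on the balls of centre zero and radius [N + 1] differ by constants. Subtracting
the accumulated constants makes them compatible, and they glue. *)
Lemma global_image f : C0 f -> exists b, is_image f b.
Proof.
move=> fC.
have sub (a : E) (r s : R) : 2 * (`|a| * d%:R + r) <= s -> eball a r `<=` eball 0 s.
  move=> h x; rewrite /eball /= subr0 => xr.
  have h1 := enorm_le a; rewrite mulrC in h1.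
  have := enormD_le (x - a) a; rewrite subrK; lra.
have sub0 (r s : R) : r <= s -> eball (0 : E) r `<=` eball 0 s.
  by move=> rs x /lt_le_trans; exact.
pose L N := local_image f 0 N.+1%:R.
have ex N : exists c, {ae mu, forall x, eball 0 N.+1%:R x -> L N.+1 x = L N x + c}.
  by apply: local_image_change => //; apply: sub0; rewrite ?ler_pM2l// ler_nat.
have [c hc] := choice ex.
pose C N := \sum_(i < N) c i.
(* Restriction to the ball makes the far part measurable. *)
pose v N := restr (eball 0 N.+1%:R) (fun x => L N x - C N).
have [||b [mb hb]] := @ae_glue R d v.
- move=> N; have m0 := local_image_measurable (0 : E) fC (ltr0Sn R N).
  have m1 : cmeasurable setT (restr (eball (0 : E) N.+1%:R) (fun=> C N)).
    by apply: cmeasurable_restr; [exact: measurable_eball|exact: cmeasurable_cst].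
  have := cmeasurableB m0 m1; congr cmeasurable; apply/funext => x; rewrite /v /L /restr.
  by case: ifP; rewrite ?subr0.
- move=> N; apply: filterS (hc N) => x h xN; rewrite /v !restr_in//.
    by rewrite h// /C big_ord_recr/=; ring.
  by apply: sub0 xN; rewrite ler_nat.
exists b; split => // x0 r r0.
have [N hN] : exists N : nat, 2 * (`|x0| * d%:R + 4 * r) <= N.+1%:R.
  by exists (Num.truncn (2 * (`|x0| * d%:R + 4 * r))); apply: ltW; exact: truncnS_gt.
have s1 : eball x0 (4 * r) `<=` eball 0 (4 * N.+1%:R) by apply: sub; have := ltr0Sn R N; lra.
have s2 : eball x0 r `<=` eball 0 N.+1%:R by apply: sub; lra.
have [c1 h1] := local_image_change fC r0 (ltr0Sn R N) s1 s2.
exists (c1 - C N); apply: filterS2 (hb N) h1 => x hx h1 xB.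
have xN := s2 _ xB; rewrite hx// /v restr_in// /L h1//; ring.
Qed.

(** On a ball that contains the support of [f] the far part vanishes and nothing is truncated. *)
Lemma test_image f : test f -> is_image f (Tp f).
Proof.
move=> tf; split; first exact: Tp_measurable (test_bdd tf).
move=> x0 r r0; have [s s0 fs] := test_supported tf.
pose t := 2 * (`|x0| * d%:R + 4 * r) + s * d%:R + s + 1.
have d0 : 0 <= d%:R :> R by exact: ler0n.
have nx0 : 0 <= `|x0| * d%:R by rewrite mulr_ge0.
have sd0 : 0 <= s * d%:R by rewrite mulr_ge0.
have t0 : 0 < t by rewrite /t; lra.
have out y : ~ eball 0 (4 * t) y -> f y = 0.
  rewrite /eball /= subr0 => /negP; rewrite -leNgt => h; apply: fs; rewrite ltNge; apply/negP => ys.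
  have h1 := enorm_le y; have : d%:R * `|y| <= s * d%:R by rewrite mulrC ler_wpM2r.
  rewrite /t in h t0; lra.
have sub (u v : R) : 2 * (`|x0| * d%:R + u) <= v -> eball x0 u `<=` eball 0 v.
  move=> h x; rewrite /eball /= subr0 => xr.
  have h1 := enorm_le x0; rewrite mulrC in h1.
  have := enormD_le (x - x0) x0; rewrite subrK; lra.
have [||c hc] := local_image_change (test_C0 tf) r0 t0 (x0 := x0) (x1 := 0).
- by apply: sub; rewrite /t; lra.
- by apply: sub; rewrite /t; lra.
exists c; apply: filterS hc => x hc xB; rewrite -hc// /local_image /far.
have -> : restr (eball 0 (4 * t)) f = f.
  by apply/funext => y; rewrite /restr; case: ifPn => // /negP h; rewrite out// => hy; apply: h; exact: mem_set.
by rewrite cintegral0 ?addr0// => y /out ->; rewrite mulr0.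
Qed.

Lemma local_image_sum f x0 (r : R) g M : cmeasurable setT f -> 0 < r -> 0 <= M -> (forall x, normc (f x) <= M) ->
  test g -> csupp g `<=` eball x0 r ->
  cintegrable mu setT (fun x => far K f x0 r x * g x) /\
  cintegrable mu setT (fun x => local_image f x0 r x * g x).
Proof.
move=> mf r0 M0 fM tg gB; have r24 : 2 * r <= 4 * r by lra.
have mB : measurable (eball x0 r) by exact: measurable_eball.
have gout x : ~ eball x0 r x -> g x = 0 by move=> nB; apply: csupp_out => /gB.
have i1 : cintegrable mu setT (fun x => far K f x0 r x * g x).
  have [G G0 hG] := test_bounded tg.
  have mfar := far_measurable_x A0 delta01 mK Ksmooth x0 r0 r24 mf M0 fM.
  have mfg : cmeasurable setT (fun x => far K f x0 r x * g x).
    have := cmeasurableM mfar (test_cmeasurable (test_csmooth tg)).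
    congr cmeasurable; apply/funext => x; rewrite /restr; case: ifPn => // /negP nB.
    by rewrite gout ?mulr0// => h; apply: nB; exact: mem_set.
  apply: (@cintegrable_supp _ _ _ _ (eball x0 r)) => //; first by move=> x /gout ->; rewrite mulr0.
  apply: (cintegrable_bounded (M := 2 * A * M * tail_const (n := d) delta * G)) => //.
  - exact: mu_eball_fin.
  - exact: cmeasurableS mfg.
  - move=> x xB; rewrite normc_mul; apply: (ler_pM (normc_ge0 _) (normc_ge0 _)) => //.
    exact: (far_le A0 delta01 mK Ksmooth r0 r24 mf M0 fM xB).
split => //.
have i2 : cintegrable mu setT (fun x => Tp (restr (eball x0 (4 * r)) f) x * g x).
  apply: Tp_pair_integrable => //; exact: (bdd_restr_eball _ _ mf M0 fM).
have := cintegrableD measurableT i2 i1; congr cintegrable; apply/funext => x.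
by rewrite -mulrDl.
Qed.

(** The constants disappear when paired with a function of integral zero. *)
Lemma is_image_pairing f b : C0 f -> is_image f b -> bmo_image Tp K f b.
Proof.
move=> fC [mb hb] g x0 r r0 [tg g0] gB.
have mf : cmeasurable setT f by case: fC => cf _; exact: ccontinuous_measurable.
have [M M0 fM] := C0_bounded fC.
have [i1 i2] := local_image_sum mf r0 M0 fM tg gB.
have gout x : ~ eball x0 r x -> g x = 0 by move=> nB; apply: csupp_out => /gB.
have [c hc] := hb x0 r r0.
have ig := test_integrable tg.
have mg := test_cmeasurable (test_csmooth tg).
have -> : cintegral mu setT (fun x => b x * g x) = cintegral mu setT (fun x => local_image f x0 r x * g x + c * g x).
  apply: ae_eq_cintegral => //; first exact: cmeasurableM.
    by apply: (@cintegrable_measurable _ _ _ mu); apply: cintegrableD => //; exact: cintegrableZ.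
  apply: filterS hc => x h _; have [/h ->|/gout ->] := pselect (eball x0 r x); first by rewrite mulrDl.
  by rewrite !mulr0 addr0.
rewrite cintegralD//; last exact: cintegrableZ.
rewrite cintegralZ// g0 mulr0 addr0 /bmo_pairing -cintegralD//.
  by apply: eq_cintegral => x _; rewrite -mulrDl.
apply: Tp_pair_integrable => //; exact: (bdd_restr_eball _ _ mf M0 fM).
Qed.

Lemma is_image_integrable f b x0 (r : R) : C0 f -> 0 < r -> is_image f b -> cintegrable mu (eball x0 r) b.
Proof.
move=> fC r0 [mb hb]; have [c hc] := hb x0 r r0.
have mf : cmeasurable setT f by case: fC => cf _; exact: ccontinuous_measurable.
have [M M0 fM] := C0_bounded fC; have r24 : 2 * r <= 4 * r by lra.
have mB : measurable (eball x0 r) by exact: measurable_eball.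
have fB := mu_eball_fin x0 r.
have bT : bdd (restr (eball x0 (4 * r)) f) by exact: (bdd_restr_eball _ _ mf M0 fM).
have i1 : cintegrable mu (eball x0 r) (Tp (restr (eball x0 (4 * r)) f)) by exact: Tp_integrable.
have mfar := far_measurable_x A0 delta01 mK Ksmooth x0 r0 r24 mf M0 fM.
have i2 : cintegrable mu (eball x0 r) (restr (eball x0 r) (far K f x0 r)).
  apply: (cintegrable_bounded (M := 2 * A * M * tail_const (n := d) delta)) => //.
    exact: cmeasurableS mfar.
  by move=> x xB; rewrite restr_in//; exact: (far_le A0 delta01 mK Ksmooth r0 r24 mf M0 fM xB).
have i3 : cintegrable mu (eball x0 r) (fun=> c).
  by apply: (cintegrable_bounded (M := normc c)) => //; exact: cmeasurable_cst.
have i := cintegrableD mB (cintegrableD mB i1 i2) i3.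
have key (u v : E -> R) : measurable_fun setT u -> {ae mu, forall x, eball x0 r x -> v x = u x} ->
  mu.-integrable (eball x0 r) (EFin \o v) -> mu.-integrable (eball x0 r) (EFin \o u).
  move=> mu_ h /integrableP[mv iv]; have mu' : measurable_fun (eball x0 r) (EFin \o u).
    by apply/measurable_EFinP; apply: measurable_funS mu_.
  apply/integrableP; split => //; move: iv; congr (_ < _)%E; apply: ge0_ae_eq_integral => //.
  - exact: measurableT_comp.
  - exact: measurableT_comp.
  - by apply: filterS h => x h /h /= ->.
case: i => j1 j2; case: mb => m1 m2; split.
  by apply: key j1 => //; apply: filterS hc => x h xB; rewrite h// /local_image restr_in.
by apply: key j2 => //; apply: filterS hc => x h xB; rewrite h// /local_image restr_in.
Qed.

Lemma is_image_locint f b : C0 f -> is_image f b -> locally_integrable_fun b.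
Proof.
move=> fC ib; have mb : cmeasurable setT b by case: ib.
split => // D cD.
have mD : measurable D by apply: closed_measurable_rV; apply: compact_closed => //; exact: norm_hausdorff.
have [r [r0 hr]] : exists r : R, 0 < r /\ D `<=` eball 0 r.
  have [M [_ hM]] := compact_bounded cD.
  have M1 : M < `|M| + 1 by apply: (le_lt_trans (ler_norm M)); rewrite ltrDl.
  exists (d%:R * (`|M| + 1) + 1); split; first by rewrite ltr_wpDl// mulr_ge0.
  move=> x Dx; rewrite /eball /= subr0; apply: (le_lt_trans (enorm_le x)).
  have h : `|x| <= `|M| + 1 := hM _ M1 x Dx.
  by apply: (@le_lt_trans _ _ (d%:R * (`|M| + 1))); rewrite ?ltrDl// ler_wpM2l.
have mB : measurable (eball (0 : E) r) by exact: measurable_eball.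
have /integrableP[_] := cintegrable_normc mB (is_image_integrable 0 fC r0 ib).
apply: le_lt_trans.
have mn : measurable_fun setT (fun x => normc (b x)) by exact: measurable_normc.
apply: (@le_trans _ _ (\int[mu]_(x in eball 0 r) (normc (b x))%:E)%E).
  apply: ge0_subset_integral => //.
    by apply/measurable_EFinP; exact: measurable_funS mn.
  by move=> x _; rewrite lee_fin normc_ge0.
by rewrite le_eqVlt; apply/orP; left; apply/eqP; apply: eq_integral => x _ /=; rewrite ger0_norm ?normc_ge0.
Qed.

(** From the [L^p] bound on the ball of radius [4 (d + 1) l] around a corner of a cube of side [l],
and from the bound of the far part. *)
Definition bmo_const : R := Cp * (8 * d.+1%:R) ^+ d + 2 * A * tail_const (n := d) delta.

Lemma bmo_const_ge0 : 0 <= bmo_const.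
Proof.
have delta0 : 0 < delta by case/andP: delta01.
have t0 := tail_const_gt0 (n := d) delta0.
have a1 : 0 <= Cp * (8 * d.+1%:R) ^+ d by rewrite mulr_ge0// exprn_ge0// mulr_ge0.
have a2 : 0 <= 2 * A * tail_const (n := d) delta by rewrite mulr_ge0 ?(ltW t0)// mulr_ge0 ?(ltW A0).
by rewrite /bmo_const addr_ge0.
Qed.

(** The bound from [L^oo] to [BMO], for the difference of two functions: every cube lies in a ball
[B] of comparable size, on which the difference of the images is the local image of the difference,
up to a constant. *)
Lemma osc_image f phi b c (eta : R) : C0 f -> C0 phi -> is_image f b -> is_image phi c -> 0 <= eta ->
  (forall x, normc (f x - phi x) <= eta) -> osc (fun x => b x - c x) (bmo_const * eta).
Proof.
move=> fC pC [mb hb] [mc hc] eta0 fp a l l0.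
have mf : cmeasurable setT f by case: fC => cf _; exact: ccontinuous_measurable.
have mp : cmeasurable setT phi by case: pC => cf _; exact: ccontinuous_measurable.
have [M M0 fM] := C0_bounded fC; have [M' M'0 pM] := C0_bounded pC.
(* The cube has diameter at most [d l]; the radius must be strictly larger. *)
pose r : R := d.+1%:R * l; have r0 : 0 < r by rewrite mulr_gt0.
have r24 : 2 * r <= 4 * r by lra.
have [k1 h1] := hb a r r0; have [k2 h2] := hc a r r0; exists (k1 - k2).
set Q := cube a l; set D := eball a (4 * r).
have mQ : measurable Q by exact: measurable_cube.
have fQ : (mu Q < +oo)%E by exact: mu_cube_fin.
have mD : measurable D by exact: measurable_eball.
have fD : (mu D < +oo)%E by exact: mu_eball_fin.
have QB : Q `<=` eball a r.
  move=> x xQ; apply: (le_lt_trans (enorm_le _)); apply: (@le_lt_trans _ _ (d%:R * l)); last by rewrite ltr_pM2r// ltr_nat.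
  rewrite ler_wpM2l//; apply/(norm_rV_leP _ (ltW l0)) => i; rewrite !mxE.
  by have /andP[] := xQ i; rewrite ler_norml; lra.
have QD : Q `<=` D by move=> x /QB h; apply: (lt_trans h); lra.
pose h x := f x - phi x.
have mh : cmeasurable setT h by exact: cmeasurableB.
have bf := bdd_restr_eball a (4 * r) mf M0 fM.
have bp := bdd_restr_eball a (4 * r) mp M'0 pM.
have bh := bdd_restr_eball a (4 * r) mh eta0 fp.
have farB x : eball a r x -> far K f a r x - far K phi a r x = far K h a r x.
  move=> xB; rewrite /far -cintegralB//; last 3 first.
    exact: measurable_off_eball.
    exact: (far_integrable A0 delta01 mK Ksmooth r0 r24 mf fM xB).
    exact: (far_integrable A0 delta01 mK Ksmooth r0 r24 mp pM xB).
  by apply: eq_cintegral => y _; rewrite -mulrBr.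
have key : {ae mu, forall x, Q x -> b x - c x - (k1 - k2) = Tp (restr D h) x + far K h a r x}.
  apply: filterS2 (TpB_ae bf bp) (filterI h1 h2) => x e [e1 e2] xQ.
  have xB := QB _ xQ; rewrite e1// e2// /local_image -farB//.
  have -> : restr D h = fun y => restr D f y - restr D phi y.
    by apply/funext => y; rewrite /restr /h; case: ifP; rewrite ?subrr.
  by rewrite e -/D; ring.
have mfar := far_measurable_x A0 delta01 mK Ksmooth a r0 r24 mh eta0 fp.
pose C2 := 2 * A * eta * tail_const (n := d) delta.
have iT := Tp_integrable_normc bh mD fD.
have iTQ := integrableS mD mQ QD iT.
have iC := integrable_cst C2 mQ fQ.
have iS := RintegrableD mQ iTQ iC.
have ms : cmeasurable Q (fun x => Tp (restr D h) x + restr (eball a r) (far K h a r) x).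
  apply: cmeasurableD; apply: cmeasurableS measurableT _ _ => //; exact: Tp_measurable.
have mn := measurable_normc ms.
have ptw x : Q x -> `|normc (Tp (restr D h) x + restr (eball a r) (far K h a r) x)| <= normc (Tp (restr D h) x) + C2.
  move=> xQ; have xB := QB _ xQ; rewrite ger0_norm ?normc_ge0//; apply: (le_trans (normcD_le _ _)).
  by rewrite lerD2l restr_in//; exact: (far_le A0 delta01 mK Ksmooth r0 r24 mh eta0 fp xB).
have i1 := integrable_dom mQ mn ptw iS.
have le1 := le_trans (ler_norm _) (Rintegral_le_dom mQ mn ptw iS).
have m0 : measurable_fun Q (fun x => normc (b x - c x - (k1 - k2))).
  by apply: measurable_normc; apply: cmeasurable_shift => //; exact: cmeasurableB.
have aeq : {ae mu, forall x, Q x -> (normc (b x - c x - (k1 - k2)))%:E = (normc (Tp (restr D h) x + restr (eball a r) (far K h a r) x))%:E}.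
  by apply: filterS key => x e xQ; rewrite e// restr_in//; exact: QB.
have eI : (\int[mu]_(x in Q) (normc (b x - c x - (k1 - k2)))%:E = \int[mu]_(x in Q) (normc (Tp (restr D h) x + restr (eball a r) (far K h a r) x))%:E)%E.
  by apply: ae_eq_integral => //; exact/measurable_EFinP.
have eb (u : E -> R[i]) : (\int[mu]_(x in Q) `|(normc (u x))%:E| = \int[mu]_(x in Q) (normc (u x))%:E)%E.
  by apply: eq_integral => x _ /=; rewrite ger0_norm ?normc_ge0.
split.
  apply/integrableP; split; first exact/measurable_EFinP.
  rewrite (eb (fun x => b x - c x - (k1 - k2))) eI -(eb (fun x => Tp (restr D h) x + restr (eball a r) (far K h a r) x)).
  by case/integrableP : i1.
rewrite /Rintegral eI; apply: (le_trans le1).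
rewrite RintegralD// Rintegral_cst// lebesgue_cube_fine ?(ltW l0)//.
have leT : \int[mu]_(x in Q) normc (Tp (restr D h) x) <= Cp * eta * (8 * d.+1%:R) ^+ d * l ^+ d.
  have hD x : normc (restr D h x) <= eta * indic D x.
    apply: normc_indic => // y yD; last exact: restr_out.
    rewrite restr_in//; exact: fp.
  have le2 := Tp_local mD fD (cmeasurable_restr mD mh) eta0 bh hD.
  have le3 : \int[mu]_(x in Q) normc (Tp (restr D h) x) <= \int[mu]_(x in D) normc (Tp (restr D h) x).
    rewrite -lee_fin /Rintegral !fineK//; last 2 first.
      exact: integrable_fin_num iT.
      exact: integrable_fin_num iTQ.
    apply: ge0_subset_integral => //; last by move=> x _; rewrite lee_fin normc_ge0.
    by case/integrableP : iT.
  apply: (le_trans le3); apply: (le_trans le2); rewrite -[leRHS]mulrA; apply: ler_wpM2l; first by rewrite mulr_ge0.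
  have := mu_eball_le a (l := 4 * r); rewrite mulr_ge0 ?(ltW r0)// => /(_ isT) le4.
  have -> : (8 * d.+1%:R) ^+ d * l ^+ d = (2 * (4 * r)) ^+ d by rewrite -exprMn /r; congr (_ ^+ d); ring.
  by rewrite -lee_fin fineK// ge0_fin_numE.
have -> : bmo_const * eta * l ^+ d = Cp * eta * (8 * d.+1%:R) ^+ d * l ^+ d + C2 * l ^+ d by rewrite /bmo_const /C2; ring.
by rewrite lerD2r.
Qed.

Hypothesis linT : forall g, schwartz g -> slinear (T^~ g).
(** * Oscillation of the image of a test function *)

(** The [L^p] bound on [B(x0, 4 r)]. *)
Lemma near_part u g x0 (r G N : R) : 0 < r -> 0 <= G -> 0 <= N -> test u -> test g ->
  (forall x, normc (g x) <= G * indic (eball x0 r) x) ->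
  (forall y, normc (u y) <= N * indic (eball x0 (4 * r)) y) ->
  normc (T u g) <= 2 * G * Cp * N * (8 * r) ^+ d.
Proof.
move=> r0 G0 N0 tu tg gG uN; set D := eball x0 (4 * r).
have mD : measurable D by exact: measurable_eball.
have fD : (mu D < +oo)%E by exact: mu_eball_fin.
have sub : eball x0 r `<=` D by move=> x /lt_le_trans; apply; lra.
have gD x : normc (g x) <= G * indic D x.
  apply: (le_trans (gG x)); apply: ler_wpM2l => //; rewrite /indic; case: ifPn => [/set_mem/sub h|_]; first by rewrite mem_set.
  by case: ifP.
have bu := test_bdd tu.
rewrite (extT (test_schwartz tu) (test_schwartz tg)); apply: (le_trans (Tp_pair_le bu tg mD fD gD)).
have le1 := Tp_local mD fD (test_cmeasurable (test_csmooth tu)) N0 bu uN.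
have h8 : 0 <= 4 * r by rewrite mulr_ge0// ltW.
have le2 : fine (mu D) <= (8 * r) ^+ d.
  have := mu_eball_le x0 h8; rewrite mulrA -natrM => h.
  by rewrite -lee_fin fineK// ge0_fin_numE.
have -> : 2 * G * Cp * N * (8 * r) ^+ d = 2 * (G * (Cp * N * (8 * r) ^+ d)) by ring.
rewrite ler_wpM2l// ler_wpM2l//; apply: (le_trans le1); rewrite ler_wpM2l// mulr_ge0//.
Qed.

(** Since [g] has integral zero, the value at [x0] of the integral of the kernel against [h] may be
subtracted; the difference is estimated by the smoothness of the kernel. The growth [|y - x0|^alpha]
of [h] is compensated by the decay [|y - x0|^(- d - delta)] because [alpha < delta]. *)
Lemma far_part h g x0 (r G N alpha : R) : 0 < r -> 0 <= G -> 0 <= N -> 0 < alpha < delta -> test h -> test0 g ->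
  (forall x, normc (g x) <= G * indic (eball x0 r) x) ->
  (forall y, enorm (y - x0) < 2 * r -> h y = 0) ->
  (forall y, normc (h y) <= N * enorm (y - x0) `^ alpha) ->
  normc (T h g) <= 4 * G * A * N * tail_const (n := d) (delta - alpha) * (2 * r) ^+ d * r `^ alpha.
Proof.
move=> r0 G0 N0 /andP[a0 ad] th [tg g0] gG h0 hN; set B := eball x0 r.
have delta0 : 0 < delta by case/andP: delta01.
have s0 : 0 < delta - alpha by rewrite subr_gt0.
have mB : measurable B by exact: measurable_eball.
have fB : (mu B < +oo)%E by exact: mu_eball_fin.
have mg := test_cmeasurable (test_csmooth tg); have mh := test_cmeasurable (test_csmooth th).
have gout x : r <= enorm (x - x0) -> g x = 0.
  move=> rx; apply: normc_eq0; apply/eqP; rewrite eq_le normc_ge0 andbT.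
  by have := gG x; rewrite /indic memNset ?mulr0// /eball /= ltNge rx.
have [M M0 hM] := test_bounded th; have [s1 _ hs] := test_supported th.
set D := nball (0 : E) s1.
have mD : measurable D by exact: measurable_normball.
have fD : (mu D < +oo)%E by exact: mu_normball_fin.
have hMD y : normc (h y) <= M * indic D y.
  by apply: normc_indic => // x nD; apply: hs; rewrite ltNge; apply/negP => xr; apply: nD; rewrite /D /nball /= subr0.
have [e1 i1] := sep_fubini A0 delta01 mK Ksize Ksmooth r0 mD fD M0 G0 mh mg hMD h0 gG.
rewrite (kernel_rep r0 th tg h0 gout) e1.
pose W x := cintegral mu setT (fun y => Kz K (x, y) * h y).
have iW x : B x -> cintegrable mu setT (fun y => Kz K (x, y) * h y).
  move=> xB; apply: (@cintegrable_supp _ _ _ _ D) => //.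
    move=> y nD; have := hMD y; rewrite /indic memNset// mulr0 => hy.
    by rewrite (@normc_eq0 _ (h y)) ?mulr0//; apply/eqP; rewrite eq_le normc_ge0 andbT.
  have mKh : cmeasurable setT (fun y => Kz K (x, y) * h y) by apply: cmeasurableM => //; exact: measurable_Kz1.
  apply: (cintegrable_bounded (M := Kbound (d := d) A delta r * M)) => //; first exact: cmeasurableS mKh.
  move=> y _; rewrite normc_mul; have [yr|yr] := ltP (enorm (y - x0)) (2 * r).
    by rewrite h0// normc_0 mulr0 mulr_ge0// Kbound_ge0.
  rewrite KzE; last by apply: (sep_neq xB); lra.
  apply: ler_pM; rewrite ?normc_ge0//; exact: (kernel_le A0 delta01 Ksize Ksmooth xB).
have x0B : B x0 by rewrite /B /eball /= subrr enorm0.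
set Cw := 2 * (A * N * tail_const (n := d) (delta - alpha) * r `^ alpha).
have WB x : B x -> normc (W x - W x0) <= Cw.
  move=> xB; rewrite /W -cintegralB//; [|exact: iW|exact: iW].
  have r2 : 0 < 2 * r by rewrite mulr_gt0.
  have [it ti] := tail_integral x0 r2 s0.
  have iz := RintegrableZ (A * r `^ delta * N) measurableT it.
  have ptw y : normc (Kz K (x, y) * h y - Kz K (x0, y) * h y) <= A * r `^ delta * N * tail x0 (2 * r) (delta - alpha) y.
    rewrite -mulrBl normc_mul; have [yr|yr] := ltP (enorm (y - x0)) (2 * r).
      by rewrite h0// normc_0 mulr0 mulr_ge0 ?tail_ge0// !mulr_ge0 ?powR_ge0// ltW.
    rewrite !KzE; [|apply: (sep_neq x0B); lra|apply: (sep_neq xB); lra].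
    have := kernel_diff_le A0 delta01 Ksmooth xB yr => kd.
    apply: (le_trans (ler_pM (normc_ge0 _) (normc_ge0 _) kd (hN y))).
    rewrite /tail yr le_eqVlt; apply/orP; left; apply/eqP.
    have y0 : 0 < enorm (y - x0) by apply: lt_le_trans yr.
    have -> : d%:R + delta = (d%:R + (delta - alpha)) + alpha by ring.
    rewrite powRD; last by apply/implyP => _; rewrite gt_eqF.
    have p0 := powR_gt0 alpha y0; have p1' := powR_gt0 (d%:R + (delta - alpha)) y0.
    move: (enorm (y - x0) `^ alpha) (enorm (y - x0) `^ (d%:R + (delta - alpha))) p0 p1' => u v u0 v0.
    by rewrite invfM; field; rewrite !gt_eqF.
  have m : cmeasurable setT (fun y => Kz K (x, y) * h y - Kz K (x0, y) * h y).
    apply: (@cintegrable_measurable _ _ _ mu); apply: cintegrableB => //; exact: iW.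
  apply: (le_trans (normc_cintegral_le measurableT m (fun y _ => ptw y) iz)).
  rewrite RintegralZl// /Cw ler_wpM2l//.
  have c0 : 0 <= A * r `^ delta * N by rewrite !mulr_ge0 ?powR_ge0// ltW.
  apply: (le_trans (ler_wpM2l c0 ti)).
  have t0 := tail_const_gt0 (n := d) s0.
  have -> : A * r `^ delta * N * (tail_const (n := d) (delta - alpha) / (2 * r) `^ (delta - alpha)) =
     A * N * tail_const (n := d) (delta - alpha) * (r `^ delta / (2 * r) `^ (delta - alpha)) by ring.
  apply: ler_wpM2l; first by rewrite mulr_ge0 ?(ltW t0)// mulr_ge0 ?(ltW A0).
  rewrite ler_pdivrMr ?powR_gt0//.
  have -> : delta = alpha + (delta - alpha) by ring.
  rewrite powRD; last by apply/implyP => _; rewrite gt_eqF.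
  rewrite addrAC subrr add0r; apply: ler_wpM2l; first exact: powR_ge0.
  apply: ge0_ler_powR; rewrite ?nnegrE ?mulr_ge0 ?(ltW r0) ?(ltW s0)//; lra.
have ig := test_integrable tg.
have -> : cintegral mu setT (fun x => W x * g x) = cintegral mu setT (fun x => W x * g x - W x0 * g x).
  by rewrite cintegralB//; [rewrite cintegralZ// g0 mulr0 subr0|exact: cintegrableZ].
have out x : ~ B x -> W x * g x - W x0 * g x = 0.
  move=> nB; rewrite gout ?mulr0 ?subrr// leNgt; apply/negP; exact: nB.
rewrite (@cintegral_supp _ _ _ mu B)//.
have i2 := integrable_cst (Cw * G) mB fB.
have m2 : cmeasurable setT (fun x => W x * g x - W x0 * g x).
  by apply: cmeasurableB; [exact: (cintegrable_measurable i1)|exact: cmeasurableZ].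
have ptw x : B x -> normc (W x * g x - W x0 * g x) <= Cw * G.
  move=> xB; rewrite -mulrBl normc_mul; apply: (ler_pM (normc_ge0 _) (normc_ge0 _) (WB x xB)).
  by have := gG x; rewrite /indic mem_set ?mulr1.
apply: (le_trans (normc_cintegral_le mB (cmeasurableS measurableT (@subsetT _ _) m2) ptw i2)).
have t0 := tail_const_gt0 (n := d) s0.
have Cw0 : 0 <= Cw by rewrite /Cw mulr_ge0// mulr_ge0 ?powR_ge0// mulr_ge0 ?(ltW t0)// mulr_ge0 ?(ltW A0).
rewrite Rintegral_cst//.
have le2 : fine (mu B) <= (2 * r) ^+ d.
  have := mu_eball_le x0 (ltW r0) => h'.
  by rewrite -lee_fin fineK// ge0_fin_numE.
have := ler_wpM2l (mulr_ge0 (mulr_ge0 (ler0n R 2) Cw0) G0) le2; rewrite -!mulrA => /le_trans; apply.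
by rewrite le_eqVlt; apply/orP; left; apply/eqP; rewrite /Cw; ring.
Qed.

(** Because [T 1 = 0], the constant [f x0] can be removed from [f] near [x0], in the form of [f x0]
times a wide cutoff whose width tends to infinity. *)
Lemma test_oscillation f : one_to_zero T -> test f -> exists2 C : R, 0 <= C &
  forall x0 (r G : R) g, 0 < r -> 0 <= G -> test0 g -> (forall x, normc (g x) <= G * indic (eball x0 r) x) ->
    normc (T f g) <= C * G * r ^+ d * r `^ (delta / 2).
Proof.
move=> [phi [tphi phi01 phi1 phisupp] Tphi] tf.
have delta0 : 0 < delta by case/andP: delta01.
set alpha := delta / 2; have a0 : 0 < alpha by rewrite divr_gt0.
have ad : 0 < alpha < delta by rewrite a0 /alpha; lra.
have s0 : 0 < delta - alpha by rewrite /alpha; lra.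
have [M M0 fM] := test_bounded tf; have [L L0 fL] := test_lipschitz tf.
pose N := L + 2 * M; have N0 : 0 <= N by rewrite addr_ge0// mulr_ge0.
have t0 := ltW (tail_const_gt0 (n := d) s0).
pose C := 2 * Cp * N * 4 `^ alpha * 8 ^+ d + 4 * A * N * tail_const (n := d) (delta - alpha) * 2 ^+ d.
exists C.
  apply: addr_ge0; first by rewrite !mulr_ge0 ?powR_ge0 ?exprn_ge0.
  by apply: mulr_ge0; rewrite ?exprn_ge0// mulr_ge0// mulr_ge0// mulr_ge0 ?(ltW A0).
move=> x0 r G g r0 G0 tg0 gG; have [tg g0] := tg0.
(* The cutoff [phi_t] stands for the constant function 1 when [t] tends to infinity. *)
pose ph (t : R) x := (phi (t^-1 *: x))%:C.
have tph t : 0 < t -> test (ph t).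
  by move=> tt; apply: (@test_scale R d (fun x => (phi x)%:C)); rewrite ?invr_gt0.
have sg := test_schwartz tg.
pose u t x := - f x0 * ph t x + f x.
have tu t : 0 < t -> test (u t) by move=> tt; apply: testD => //; apply: testZ; exact: tph.
have Tu t : 0 < t -> T (u t) g = - f x0 * T (ph t) g + T f g.
  by move=> tt; apply: (linT sg); apply: test_schwartz => //; exact: tph.
have lim : ccvg (pinfty_nbhs R) (fun t => T (u t) g) (T f g).
  apply: (ccvg_near_eq (u := fun t => - f x0 * T (ph t) g + T f g)).
    by apply: filterS (nbhs_pinfty_gt (num_real 0)) => t tt; rewrite Tu.
  have := ccvgD (ccvgM_cst (- f x0) (Tphi g tg0)) (@ccvg_cst _ _ (pinfty_nbhs R) _ (T f g)).
  rewrite (_ : cintegral mu setT _ = 0); first by rewrite mulr0 add0r; apply.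
  by apply: cintegral0 => y _; rewrite mul0r.
apply: (ccvg_le _ lim).
near=> t.
(* For such [t], a point at distance less than 1 from [x0] lies where [phi_t = 1]. *)
have tbig : 4 * (1 + enorm x0) < t by near: t; exact: nbhs_pinfty_gt (num_real _).
have e00 := enorm_ge0 x0.
have t0' : 0 < t by apply: le_lt_trans tbig; lra.
have uN y : normc (u t y) <= N * enorm (y - x0) `^ alpha.
  have e0 := enorm_ge0 (y - x0).
  have p01 := phi01 (t^-1 *: y).
  have le2M : normc (u t y) <= 2 * M.
    apply: (le_trans (normcD_le _ _)); have -> : 2 * M = M + M by ring.
    apply: lerD => //; rewrite normc_mul normc_opp -[leRHS]mulr1; apply: ler_pM; rewrite ?normc_ge0//.
    by rewrite /ph normc_real; case/andP: p01 => p0 p1'; rewrite ger0_norm.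
  have [e1|e1] := leP 1 (enorm (y - x0)).
    apply: (le_trans le2M); rewrite -[leLHS]mulr1; apply: ler_pM; rewrite ?mulr_ge0//; first by rewrite /N; lra.
    have h1 : 1 `^ alpha = 1 :> R by rewrite powR1.
    by rewrite -{1}h1; apply: ge0_ler_powR; rewrite ?nnegrE ?(ltW a0).
  have yin : enorm (t^-1 *: y) <= 2^-1.
    have enormZ (c : R) (z : E) : 0 <= c -> enorm (c *: z) = c * enorm z.
      move=> c0; rewrite /enorm.
      have -> : \sum_i (c *: z) 0 i ^+ 2 = c ^+ 2 * \sum_i z 0 i ^+ 2.
        by rewrite mulr_sumr; apply: eq_bigr => i _; rewrite mxE exprMn.
      by rewrite sqrtrM ?sqr_ge0// sqrtr_sqr ger0_norm.
    have := enormD_le (y - x0) x0; rewrite subrK => hy.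
    rewrite enormZ ?invr_ge0 ?(ltW t0')// mulrC ler_pdivrMr//; lra.
  have -> : u t y = f y - f x0 by rewrite /u /ph phi1// mulr1 addrC.
  have le1 : normc (f y - f x0) <= L * enorm (y - x0).
    by apply: (le_trans (fL y x0)); rewrite ler_wpM2l// norm_le_enorm.
  apply: (le_trans le1); apply: ler_pM => //; first by rewrite /N lerDl mulr_ge0.
  have [->|en0] := eqVneq (enorm (y - x0)) 0; first exact: powR_ge0.
  have ep : 0 < enorm (y - x0) by rewrite lt_neqAle eq_sym en0.
  rewrite -{1}[enorm (y - x0)]powRr1//; apply: ger_powR; rewrite ?ep ?(ltW e1)//.
  by rewrite /alpha; case/andP: delta01 => _; lra.
have [chi [sch chi01 chiout chi1]] := ball_cutoff x0 r0.
pose u1 x := (chi x)%:C * u t x; pose u2 x := (1 - chi x)%:C * u t x.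
have tu1 : test u1 by apply: testM (tu _ t0'); exact: csmooth_real.
have tu2 : test u2.
  exact: (testM (csmooth_real (smoothB (@smooth_cst _ _ 1) sch)) (tu _ t0')).
have -> : T (u t) g = T u1 g + T u2 g.
  have := linT sg 1 (test_schwartz tu1) (test_schwartz tu2); rewrite mul1r => <-.
  by congr (T _ g); apply/funext => x; rewrite mul1r /u1 /u2 -mulrDl -realcD addrCA subrr addr0 mul1r.
apply: (le_trans (normcD_le _ _)).
have chi_le x : normc ((chi x)%:C : R[i]) <= 1 /\ normc ((1 - chi x)%:C : R[i]) <= 1.
  by case/andP: (chi01 x) => c0 c1; rewrite !normc_real !ger0_norm ?subr_ge0//; split => //; lra.
have n1 : normc (T u1 g) <= 2 * G * Cp * (N * (4 * r) `^ alpha) * (8 * r) ^+ d.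
  apply: (near_part r0 G0 _ tu1 tg gG); first by rewrite mulr_ge0 ?powR_ge0.
  apply: normc_indic => [|y yD|y yD]; first by rewrite mulr_ge0 ?powR_ge0.
    rewrite normc_mul -[leRHS]mul1r; apply: (ler_pM (normc_ge0 _) (normc_ge0 _)); first by case: (chi_le y).
    apply: (le_trans (uN y)); apply: ler_wpM2l => //.
    apply: ge0_ler_powR; rewrite ?nnegrE; [exact: ltW|exact: enorm_ge0|by rewrite mulr_ge0// ltW|exact: ltW yD].
  by rewrite /u1 chiout// mul0r.
have n2 : normc (T u2 g) <= 4 * G * A * N * tail_const (n := d) (delta - alpha) * (2 * r) ^+ d * r `^ alpha.
  apply: (far_part r0 G0 N0 ad tu2 tg0 gG).
    by move=> y yr; rewrite /u2 chi1// subrr mul0r.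
  move=> y; rewrite normc_mul -[leRHS]mul1r; apply: (ler_pM (normc_ge0 _) (normc_ge0 _)) => //.
  by case: (chi_le y).
apply: (le_trans (lerD n1 n2)); rewrite le_eqVlt; apply/orP; left; apply/eqP.
rewrite /C powRM ?(ltW r0)// !exprMn; ring.
Unshelve. all: by end_near. Qed.

(** * Uniform approximation of the image of a test function *)

(** This is where positive dimension enters: in dimension zero there is no decay. *)
Lemma Kbound_le (r : R) : (0 < d)%N -> 1 <= r -> Kbound (d := d) A delta r <= 2 * A / r.
Proof.
move=> d0 r1; have r0 : 0 < r by apply: lt_le_trans r1.
have delta0 : 0 < delta by case/andP: delta01.
have rd : r <= (2 * r) ^+ d.
  by apply: (@le_trans _ _ (2 * r)); [lra|apply: ler_eXnr => //; lra].
have p0 : 0 < (2 * r) ^+ d by apply: lt_le_trans rd.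
have h1 : A / (2 * r) ^+ d <= A / r by rewrite ler_wpM2l ?(ltW A0)// lef_pV2.
have h2 : A * r `^ delta * ((2 * r) `^ (d%:R + delta))^-1 <= A / (2 * r) ^+ d.
  have r20 : 0 < 2 * r by rewrite mulr_gt0.
  rewrite powRD; last by apply/implyP => _; rewrite gt_eqF.
  rewrite powR_mulrn ?(ltW r20)// invfM mulrACA -!mulrA ler_wpM2l ?(ltW A0)// ler_piMr ?invr_ge0 ?(ltW p0)//.
  rewrite ler_pdivrMr ?powR_gt0// mul1r; apply: ge0_ler_powR; rewrite ?nnegrE ?(ltW r0) ?(ltW r20) ?(ltW delta0)//; lra.
rewrite /Kbound; apply: (le_trans (lerD h1 (le_trans h2 h1))); lra.
Qed.

(** A mollification of [T f] at a point [x] is the pairing of [T f] with a mollifier. Far from the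
support of [f] this is an integral of the kernel, which is at most a constant over the distance. *)
Lemma moll_decay f (e eps : R) : (0 < d)%N -> test f -> 0 < e -> 0 < eps -> exists rho : R,
  forall x, rho < enorm x -> normc (cconv (Tp f) (moll e) x) <= eps.
Proof.
move=> d0 tf e0 eps0.
have [M M0 hM] := test_bounded tf; have [s s0 hs] := test_supported tf.
set D := nball (0 : E) s.
have mD : measurable D by exact: measurable_normball.
have fD : (mu D < +oo)%E by exact: mu_normball_fin.
have hMD y : normc (f y) <= M * indic D y.
  by apply: normc_indic => // x nD; apply: hs; rewrite ltNge; apply/negP => xr; apply: nD; rewrite /D /nball /= subr0.
have mf := test_cmeasurable (test_csmooth tf).
set m := fine (mu D); have m0 : 0 <= m by exact: fine_ge0.
(* The radius exceeds 1 for [Kbound_le], [(d + 1) e] for the support of the mollifier, and a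
   multiple of [1/eps] for the smallness. *)
pose r := Num.max 1 (Num.max (d.+1%:R * e) (8 * A * M * m / eps)).
have r1 : 1 <= r by rewrite /r le_max lexx.
have re : d.+1%:R * e <= r by rewrite /r !le_max lexx orbT.
have rm : 8 * A * M * m / eps <= r by rewrite /r !le_max lexx !orbT.
have r0 : 0 < r by apply: lt_le_trans r1.
exists (4 * r + 2 * (d%:R * s)) => x xbig.
pose g := fun y : E => (moll e (y - x))%:C.
have tg : test g by exact: test_moll.
have gG y := moll_indic x y e0 re.
have G0 : 0 <= bump_const (R := R) (n := d) / e ^+ d by rewrite divr_ge0 ?exprn_ge0 ?(ltW e0)// ltW// bump_const_gt0.
have gout y : r <= enorm (y - x) -> g y = 0.
  move=> ry; apply: normc_eq0; apply/eqP; rewrite eq_le normc_ge0 andbT.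
  by have := gG y; rewrite /indic memNset ?mulr0// /eball /= ltNge ry.
have f0 y : enorm (y - x) < 2 * r -> f y = 0.
  move=> yx; apply: hs; rewrite ltNge; apply/negP => ys.
  have h1 := enormD_le (x - y) y; rewrite subrK enormC in h1.
  have h2 := enorm_le y; have h3 : d%:R * `|y| <= d%:R * s by rewrite ler_wpM2l.
  lra.
have -> : cconv (Tp f) (moll e) x = T f g by rewrite cconvE (extT (test_schwartz tf) (test_schwartz tg)).
rewrite (kernel_rep r0 tf tg f0 gout).
have [-> iW] := sep_fubini A0 delta01 mK Ksize Ksmooth r0 mD fD M0 G0 mf (test_cmeasurable (test_csmooth tg)) hMD f0 gG.
set W := fun z => cintegral mu setT (fun y => Kz K (z, y) * f y).
(* The kernel integral is bounded by [Wb] on the whole ball of radius [r], while the mollifier has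
   integral 1; the volume of that ball does not enter. *)
pose Wb := 2 * (Kbound (d := d) A delta r * M * m).
have K0 : 0 <= Kbound (d := d) A delta r by exact: Kbound_ge0.
have hW z : eball x r z -> normc (W z) <= Wb.
  move=> zB; rewrite /W (@cintegral_supp _ _ _ mu D); last first.
    move=> y nD; rewrite hs ?mulr0// ltNge; apply/negP => xr; apply: nD; rewrite /D /nball /= subr0//.
  have i1 := integrable_cst (Kbound (d := d) A delta r * M) mD fD.
  have ptw y : D y -> normc (Kz K (z, y) * f y) <= Kbound (d := d) A delta r * M.
    move=> _; have [yr|yr] := ltP (enorm (y - x)) (2 * r); first by rewrite f0// mulr0 normc_0 mulr_ge0.
    rewrite normc_mul KzE; last by apply: (sep_neq zB); lra.
    apply: ler_pM; rewrite ?normc_ge0//; exact: (kernel_le A0 delta01 Ksize Ksmooth zB).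
  have mW : cmeasurable D (fun y => Kz K (z, y) * f y).
    apply: (cmeasurableS measurableT) => //; apply: cmeasurableM => //; exact: measurable_Kz1.
  by apply: (le_trans (normc_cintegral_le mD mW ptw i1)); rewrite Rintegral_cst.
have Wb0 : 0 <= Wb by rewrite /Wb !mulr_ge0.
have im := moll_shift_integrable x e0.
have ptw z : setT z -> normc (W z * g z) <= Wb * moll e (z - x).
  move=> _; rewrite normc_mul; have [zB|nB] := pselect (eball x r z).
    apply: ler_pM; rewrite ?normc_ge0//; first exact: hW.
    by rewrite /g normc_real ger0_norm// moll_ge0.
  have -> : g z = 0 by apply: gout; rewrite leNgt; apply/negP.
  by rewrite normc_0 mulr0 mulr_ge0// moll_ge0.
apply: (le_trans (normc_cintegral_le measurableT (cintegrable_measurable iW) ptw (RintegrableZ Wb measurableT im))).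
rewrite RintegralZl// moll_int// mulr1 /Wb.
have kb := Kbound_le d0 r1.
have -> : 2 * (2 * (Kbound (d := d) A delta r * M * m)) = 4 * (M * m) * Kbound (d := d) A delta r by ring.
apply: (@le_trans _ _ (4 * (M * m) * (2 * A / r))); first by rewrite ler_wpM2l ?mulr_ge0.
have -> : 4 * (M * m) * (2 * A / r) = 8 * A * M * m / r by ring.
rewrite ler_pdivrMr//; move: rm; rewrite ler_pdivrMr// => rm; lra.
Qed.

(** Consecutive mollifications differ by the pairing of [T f] with a difference of two mollifiers,
which has integral zero, is supported at scale [2^-k] and is of size [2^(k d)]; the oscillation
estimate bounds it by a multiple of [2^(- k alpha)]. *)
Lemma test_image_approx f (eps : R) : (0 < d)%N -> one_to_zero T -> test f -> 0 < eps ->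
  exists2 psi, test psi & {ae mu, forall x, normc (Tp f x - psi x) <= eps}.
Proof.
move=> d0 T1 tf eps0; have [C Cge0 hC] := test_oscillation T1 tf.
have bf := test_bdd tf.
have delta0 : 0 < delta by case/andP: delta01.
set alpha := delta / 2; have a0 : 0 < alpha by rewrite divr_gt0.
have lu : clocint (Tp f).
  have [m1 m2] := Tp_measurable bf.
  by split; split => // a r; have [] := Tp_integrable bf (measurable_normball a r) (mu_normball_fin a r).
pose e_ k : R := 2^-1 ^+ k.
have e0 k : 0 < e_ k by rewrite exprn_gt0// invr_gt0.
have half1 : 2^-1 < 1 :> R by rewrite invf_lt1// ltr1n.
have ecvg : e_ @ \oo --> 0 by apply: cvg_expr; rewrite ger0_norm.
(* The ratio of the geometric sequence: halving the scale gains a factor [2^- alpha]. *)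
pose q : R := 2^-1 `^ alpha.
have h1 : 1 `^ alpha = 1 :> R by rewrite powR1.
have q01 : 0 <= q < 1.
  by rewrite powR_ge0/= -h1; apply: gt0_ltr_powR; rewrite ?nnegrE ?invr_ge0.
have eq_ k : e_ k `^ alpha = q ^+ k.
  elim: k => [|k IH]; first by rewrite /e_ !expr0.
  by rewrite exprS -IH /e_ exprS powRM ?exprn_ge0 ?invr_ge0.
pose bc : R := bump_const (n := d); have bc0 : 0 < bc by exact: bump_const_gt0.
pose C1 := C * (bc * 2 ^+ d + bc) * d.+1%:R ^+ d * d.+1%:R `^ alpha.
have C10 : 0 <= C1 by rewrite !mulr_ge0 ?powR_ge0 ?exprn_ge0// addr_ge0 ?mulr_ge0 ?exprn_ge0// ltW.
pose g k (x y : E) : R[i] := (moll (e_ k) (y - x))%:C.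
have tg k x : test (g k x) by exact: test_moll.
have step k x : normc (cconv (Tp f) (moll (e_ k.+1)) x - cconv (Tp f) (moll (e_ k)) x) <= C1 * q ^+ k.
  rewrite !cconvE -cintegralB//; [|exact: Tp_pair_integrable bf (tg k.+1 x)|exact: Tp_pair_integrable bf (tg k x)].
  pose h y := g k.+1 x y - g k x y.
  have th : test h by apply: testB; exact: tg.
  have th0 : test0 h.
    split => //; rewrite /h cintegralB//; [|exact: test_integrable (tg _ _)|exact: test_integrable (tg _ _)].
    by rewrite !cmoll_int// subrr.
  have -> : cintegral mu setT (fun y => Tp f y * (moll (e_ k.+1) (y - x))%:C - Tp f y * (moll (e_ k) (y - x))%:C) = T f h.
    by rewrite (extT (test_schwartz tf) (test_schwartz th)); apply: eq_cintegral => y _; rewrite -mulrBr.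
  pose r := d.+1%:R * e_ k; have r0 : 0 < r by rewrite mulr_gt0.
  have e1 : e_ k.+1 = e_ k / 2 by rewrite /e_ exprS mulrC.
  pose G := bc / e_ k.+1 ^+ d + bc / e_ k ^+ d.
  have G0 : 0 <= G by rewrite addr_ge0// divr_ge0 ?exprn_ge0 ?(ltW (e0 _))// ltW.
  have hG y : normc (h y) <= G * indic (eball x r) y.
    rewrite mulrDl; apply: (le_trans (normcB_le _ _)); apply: lerD; apply: moll_indic => //.
    by rewrite /r e1; have := e0 k; have : 0 < d.+1%:R :> R by []; nra.
  apply: (le_trans (hC x r G h r0 G0 th0 hG)).
  rewrite le_eqVlt; apply/orP; left; apply/eqP.
  rewrite -/alpha /r powRM ?(ltW (e0 k))// eq_ /G e1 /C1 !exprMn exprVn invfM invrK.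
  have : e_ k ^+ d != 0 by rewrite expf_neq0// gt_eqF.
  by move: (e_ k ^+ d) => w w0; field.
have H := moll_limit lu e0 ecvg C10 q01 step.
have e2 : 0 < eps / 2 by rewrite divr_gt0.
have [k hk] : exists k, C1 / (1 - q) * q ^+ k <= eps / 2.
  have : geometric (C1 / (1 - q)) q @ \oo --> (0 : R) by apply: cvg_geometric; case/andP: q01 => q0 q1; rewrite ger0_norm.
  move/cvgr0Pnorm_le => /(_ _ e2) [N _ hN]; exists N.
  by apply: (le_trans (ler_norm _)); exact: (hN N (leqnn N)).
have GC : C0 (cconv (Tp f) (moll (e_ k))).
  split; first exact: (csmooth_continuous (csmooth_cconv lu (smooth_moll (e_ k)) (moll_supported (e0 k)))).
  move=> t t0; have t2 : 0 < t / 2 by rewrite divr_gt0.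
  have [rho hrho] := moll_decay d0 tf (e0 k) t2.
  by exists rho => x /hrho; lra.
have [psi tpsi hpsi] := C0_approx GC e2.
exists psi => //; apply: filterS H => x hx.
apply: (le_trans (normc_triangle (cconv (Tp f) (moll (e_ k)) x) _ _)); rewrite (splitr eps); apply: lerD => //.
exact: le_trans (hx k) hk.
Qed.

Lemma oscB_ae b u psi (x y : R) : cmeasurable setT b -> cmeasurable setT u -> test psi -> 
  osc (fun t => b t - u t) x -> 0 <= y -> {ae mu, forall t, normc (u t - psi t) <= y} ->
  osc (fun t => b t - psi t) (x + y).
Proof.
move=> mb mu_ tpsi h1 y0 h2; have mpsi := test_cmeasurable (test_csmooth tpsi).
have h3 := osc_bounded (cmeasurableB mu_ mpsi) y0 h2.
have := oscD (cmeasurableB mb mu_) (cmeasurableB mu_ mpsi) h1 h3.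
by congr osc; apply/funext => t; rewrite addrA subrK.
Qed.

(** * Passage to continuous functions vanishing at infinity *)

(** If [phi] is a test function close to [f] and [psi] one close to [T phi], then [b - psi] is the
sum of [b - T phi], small in [BMO] by [osc_image], and of [T phi - psi], small almost everywhere. *)
Theorem C0_to_CMO f : (0 < d)%N -> one_to_zero T -> C0 f -> exists b, CMO b /\ bmo_image Tp K f b.
Proof.
move=> d0 T1 fC; have [b ib] := global_image fC; exists b.
have mb : cmeasurable setT b by case: ib.
split; last exact: is_image_pairing.
have approx (e : R) : 0 < e -> exists2 psi, test psi & osc (fun x => b x - psi x) e.
  move=> e0; have e2 : 0 < e / 2 by rewrite divr_gt0.
  have c1 : 0 < bmo_const + 1 by rewrite ltr_wpDl// bmo_const_ge0.
  have eta0 : 0 < e / 2 / (bmo_const + 1) by rewrite divr_gt0.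
  have [phi tphi hphi] := C0_approx fC eta0.
  have h1 := osc_image fC (test_C0 tphi) ib (test_image tphi) (ltW eta0) hphi.
  have [psi tpsi hpsi] := test_image_approx d0 T1 tphi e2.
  exists psi => //; have mT := Tp_measurable (test_bdd tphi).
  have h2 := oscB_ae mb mT tpsi h1 (ltW e2) hpsi.
  move=> a l l0; have [c [i le]] := h2 a l l0; exists c; split => //.
  apply: (le_trans le); apply: ler_wpM2r; first by rewrite exprn_ge0 ?(ltW l0).
  rewrite [leRHS]splitr lerD2r mulrCA ler_piMr ?(ltW e2)// ler_pdivrMr// mul1r; lra.
have mpsi (psi : E -> R[i]) : test psi -> cmeasurable setT psi by move=> tpsi; exact: (test_cmeasurable (test_csmooth tpsi)).
split; last first.
  move=> e e0; have e4 : 0 < e / 4 by rewrite divr_gt0.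
  have [psi tpsi h] := approx _ e4; exists psi => //.
  have H := osc_bmo_norm (cmeasurableB mb (mpsi _ tpsi)) h.
  by apply: (le_lt_trans H); rewrite lte_fin; lra.
split; first exact: is_image_locint fC ib.
have [psi tpsi h] := approx _ ltr01; have [M M0 hM] := test_bounded tpsi.
have h2 : osc psi M.
  by apply: osc_bounded => //; [exact: mpsi|apply: aeW].
have h3 := oscD (cmeasurableB mb (mpsi _ tpsi)) (mpsi _ tpsi) h h2.
have {}h3 : osc b (1 + M) by move: h3; congr osc; apply/funext => x; rewrite subrK.
by apply: (le_lt_trans (osc_bmo_norm mb h3)); exact: ltry.
Qed.

(** * Operators of convolution type *)

(** The function [Psi z = \int phi_t (x - z) g x dx] is [O(1/t)] because [g] has integral zero and
[phi_t] has Lipschitz constant [O(1/t)]; it vanishes for [|z| < t / 8], where [phi_t (x - z) = 1] on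
the support of [g]. It is supported in [|z| <= t + s], of volume [O(t^d)], where [|k z| = O(t^-d)].
*)
Lemma convolution_one_to_zero : (0 < d)%N -> convolution_type T K -> one_to_zero T.
Proof.
move=> d0 [k [kdist [Kk _ kd Tk]]]; have [phi [cphi sphi]] := @cutoff_one R d; exists phi => // g [tg g0].
have [tphi phi01 phi1 phisupp] := cphi.
have [s s0 hs] := test_supported tg; have mg := test_cmeasurable (test_csmooth tg).
have [G G0 hG] := test_bounded tg; have lg : clocint g by exact: (cbounded_clocint mg hG).
have [L L0 hL] := test_lipschitz tphi.
have ig := cintegrable_normc measurableT (test_integrable tg).
pose I := \int[mu]_x normc (g x).
have I0 : 0 <= I by apply: Rintegral_ge0 => x _; exact: normc_ge0.
pose C := 4 * A * (L * s * I) * 32 ^+ d.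
have C0 : 0 <= C by rewrite !mulr_ge0 ?exprn_ge0// ltW.
have dr0 : 0 <= d%:R :> R by exact: ler0n.
have main t : 8 * (d%:R * s) + s + 1 < t -> normc (T (fun x => (phi (t^-1 *: x))%:C) g) <= C / t.
  move=> tbig; have ds0 : 0 <= d%:R * s by rewrite mulr_ge0.
  have t0 : 0 < t by apply: le_lt_trans tbig; lra.
  pose w (x : E) := phi (t^-1 *: x).
  have tw : test (fun x => (w x)%:C) by apply: (@test_scale R d (fun x => (phi x)%:C)); rewrite ?invr_gt0.
  have enormZ (z : E) : enorm (t^-1 *: z) = t^-1 * enorm z.
    rewrite /enorm; have -> : \sum_i (t^-1 *: z) 0 i ^+ 2 = t^-1 ^+ 2 * \sum_i z 0 i ^+ 2.
      by rewrite mulr_sumr; apply: eq_bigr => i _; rewrite mxE exprMn.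
    by rewrite sqrtrM ?sqr_ge0// sqrtr_sqr ger0_norm// invr_ge0 ltW.
  have sw : smooth w.
    have := smooth_affine t^-1 0 sphi; congr smooth; apply/funext => x; by rewrite addr0.
  have wout (x : E) : t <= `|x| -> w x = 0.
    move=> tx; rewrite /w; have : ~ csupp (fun x => (phi x)%:C) (t^-1 *: x).
      move=> /phisupp; rewrite /eball /= subr0 enormZ mulrC ltr_pdivrMr// mul1r => h.
      by have := le_lt_trans (norm_le_enorm x) h; rewrite ltNge tx.
    by move=> /csupp_out /(congr1 (@complex.Re R)).
  have w1 (x : E) : enorm x <= t / 2 -> w x = 1.
    by move=> xt; apply: phi1; rewrite enormZ mulrC ler_pdivrMr// mulrC.
  have ws : supported w t by move=> x /ltW; exact: wout.
  pose Psi := cconv g w.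
  have PsiE z : Psi z = cintegral mu setT (fun x => (w (x - z))%:C * g x).
    by rewrite /Psi cconvE; apply: eq_cintegral => x _; rewrite mulrC.
  have sPsi : csmooth Psi by exact: (csmooth_cconv lg sw ws).
  have Psi_out z : t + s < `|z| -> Psi z = 0.
    move=> tz; rewrite PsiE; apply: cintegral0 => x _; have [xs|xs] := leP `|x| s; last by rewrite hs ?mulr0.
    rewrite wout ?mul0r// distrC.
    have := lerB_dist z x.
    lra.
  have tPsi : test Psi by exact: (testP sPsi Psi_out).
  have Psi_in z : enorm z < t / 8 -> Psi z = 0.
    move=> zt; rewrite PsiE -[RHS]g0; apply: eq_cintegral => x _.
    have [xs|xs] := leP `|x| s; last by rewrite hs ?mulr0.
    rewrite w1 ?mul1r//.
    have h1 := enormD_le x (- z); rewrite enormN in h1.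
    have h2 := enorm_le x; have h3 : d%:R * `|x| <= d%:R * s by rewrite ler_wpM2l.
    lra.
  have nPsi0 : ~ csupp Psi 0.
    have cl : closed [set z : E | t / 8 <= enorm z].
      by apply: (@closed_comp _ _ (@enorm R d) [set u | t / 8 <= u]) => [z _|]; [exact: continuous_enorm|exact: closed_ge].
    move=> h; have : [set z : E | t / 8 <= enorm z] 0.
      by apply: (csupp_sub cl) h => z /= /negP; rewrite -ltNge; exact: Psi_in.
    by rewrite /= enorm0 leNgt divr_gt0.
  have -> : T (fun x => (phi (t^-1 *: x))%:C) g = cintegral mu setT (fun z => k z * Psi z).
    rewrite (Tk _ _ (test_schwartz tw) (test_schwartz tg)) -kd//; congr kdist.
    by apply/funext => z; rewrite PsiE.
  have PsiB z : normc (Psi z) <= 2 * (L * s * I) / t.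
    have iw : cintegrable mu setT (fun x => (w (x - z))%:C * g x).
      have := cconv_integrable z lg sw ws; congr cintegrable; apply/funext => x; exact: mulrC.
    have itg := test_integrable tg.
    have -> : Psi z = cintegral mu setT (fun x => ((w (x - z))%:C - (w (- z))%:C) * g x).
      under eq_cintegral do rewrite mulrBl.
      rewrite cintegralB//; last exact: cintegrableZ.
      by rewrite cintegralZ// g0 mulr0 subr0 PsiE.
    have ptw x : setT x -> normc (((w (x - z))%:C - (w (- z))%:C) * g x) <= L * s / t * normc (g x).
      move=> _; rewrite normc_mul; have [xs|xs] := leP `|x| s; last by rewrite hs ?normc_0 ?mulr0.
      apply: ler_wpM2r; first exact: normc_ge0.
      apply: (le_trans (hL _ _)); rewrite -mulrA; apply: ler_wpM2l => //.
      rewrite -scalerBr opprK subrK normrZ gtr0_norm ?invr_gt0// mulrC ler_wpM2r// invr_ge0 ltW//.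
    have m : cmeasurable setT (fun x : E => ((w (x - z))%:C - (w (- z))%:C) * g x).
      apply: (@cintegrable_measurable _ _ _ mu).
      have := cintegrableB measurableT iw (cintegrableZ (w (- z))%:C measurableT itg).
      by congr cintegrable; apply/funext => x; rewrite mulrBl.
    apply: (le_trans (normc_cintegral_le measurableT m ptw (RintegrableZ (L * s / t) measurableT ig))).
    by rewrite RintegralZl// -/I le_eqVlt; apply/orP; left; apply/eqP; ring.
  set D := nball (0 : E) (t + s).
  have mD : measurable D by exact: measurable_normball.
  have fD : (mu D < +oo)%E by exact: mu_normball_fin.
  have eK z : k z * Psi z = Kz K (z, 0) * Psi z.
    have [->|z0] := eqVneq z 0; first by rewrite Psi_in ?mulr0// enorm0 divr_gt0.
    by rewrite KzE// Kk// subr0.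
  have mk : cmeasurable setT (fun z => k z * Psi z).
    have := cmeasurableM (measurable_Kz2 mK 0) (test_cmeasurable sPsi).
    by congr cmeasurable; apply/funext => z; rewrite eK.
  rewrite (@cintegral_supp _ _ _ mu D); last first.
    by move=> z /negP; rewrite /D /nball /= subr0 -ltNge => /Psi_out ->; rewrite mulr0.
  pose B := A / (t / 8) ^+ d * (2 * (L * s * I) / t).
  have t80 : 0 < t / 8 by rewrite divr_gt0.
  have B0 : 0 <= B by rewrite !mulr_ge0 ?invr_ge0 ?exprn_ge0 ?(ltW t80) ?(ltW t0) ?(ltW A0).
  have ptw z : D z -> normc (k z * Psi z) <= B.
    move=> _; have [zt|zt] := ltP (enorm z) (t / 8); first by rewrite Psi_in// mulr0 normc_0.
    rewrite normc_mul; apply: (ler_pM (normc_ge0 _) (normc_ge0 _) _ (PsiB z)).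
    have z0 : z != 0 by apply/eqP => z0; move: zt; rewrite z0 enorm0 leNgt t80.
    have := Ksize z0; rewrite Kk// subr0 => /le_trans; apply.
    rewrite ler_wpM2l ?(ltW A0)// lef_pV2 ?posrE ?exprn_gt0 ?(lt_le_trans t80 zt)//.
    by rewrite ler_pXn2r// ?nnegrE ?(ltW t80) ?enorm_ge0.
  apply: (le_trans (normc_cintegral_le mD (cmeasurableS measurableT (@subsetT _ _) mk) ptw (integrable_cst B mD fD))).
  rewrite Rintegral_cst//.
  have ts0 : 0 <= t + s by rewrite addr_ge0 ?(ltW t0).
  have muD : fine (mu D) <= (4 * t) ^+ d.
    have h1 : fine (mu D) <= (2 * (t + s)) ^+ d.
      by rewrite -lee_fin fineK; [exact: mu_normball_le|rewrite ge0_fin_numE].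
    apply: (le_trans h1); rewrite ler_pXn2r// ?nnegrE ?mulr_ge0 ?(ltW t0)//; lra.
  apply: (@le_trans _ _ (2 * (B * (4 * t) ^+ d))); first by rewrite ler_wpM2l// ler_wpM2l.
  rewrite le_eqVlt; apply/orP; left; apply/eqP.
  have -> : (4 * t) ^+ d = 32 ^+ d * (t / 8) ^+ d by rewrite -exprMn; congr (_ ^+ d); field.
  rewrite /B /C; have : (t / 8) ^+ d != 0 by rewrite expf_neq0// gt_eqF.
  by move: ((t / 8) ^+ d) => a a0; field; rewrite a0 gt_eqF.
rewrite (_ : cintegral mu setT _ = 0); last by apply: cintegral0 => x _; rewrite mul0r.
apply/cvgr0Pnorm_le => e e0.
have n1 := nbhs_pinfty_gt (num_real (8 * (d%:R * s) + s + 1)).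
have n2 := nbhs_pinfty_gt (num_real (C / e)).
have n3 := nbhs_pinfty_gt (num_real (0 : R)).
apply: filterS2 (filterI n1 n3) n2 => t [h1 h3] h2; rewrite subr0 ger0_norm ?normc_ge0//.
apply: (le_trans (main t h1)); rewrite ler_pdivrMr// mulrC -ler_pdivrMr//; exact: ltW.
Qed.

End operator.

Theorem proposition5p4 (R : realType) (d : nat)
    (T : ('rV[R]_d -> R[i]) -> ('rV[R]_d -> R[i]) -> R[i])
    (K : 'rV[R]_d -> 'rV[R]_d -> R[i]) (p : R)
    (Tp : ('rV[R]_d -> R[i]) -> ('rV[R]_d -> R[i])) :
  (0 < d)%N ->
  cz_operator T K p Tp ->
  convolution_type T K \/ (one_to_zero T /\ one_to_zero (transpose T)) ->
  forall f, C0 f -> exists b, CMO b /\ bmo_image Tp K f b.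
Proof.
move=> d0 [[_ linT _] [mK _ [A [delta [A0 delta01 Ksize Ksmooth]]]] kerT p1 [[TpLp Tplin [B TpB]] extT]] H f fC.
have Cp0 : 0 <= Num.max 0 B by rewrite le_max lexx.
have TpB' h : in_Lp p h -> (Lnorm (lebesgue_rV d) p%:E (fun x => (normc (Tp h x))%:E) <=
    (Num.max 0 B)%:E * Lnorm (lebesgue_rV d) p%:E (fun x => (normc (h x))%:E))%E.
  move=> /TpB /le_trans; apply; apply: lee_wpmul2r; first exact: Lnorm_ge0.
  by rewrite lee_fin le_max lexx orbT.
have T1 : one_to_zero T.
  case: H => [cT|[]//]; exact: (convolution_one_to_zero A0 mK Ksize d0 cT).
exact: (C0_to_CMO A0 delta01 mK Ksize Ksmooth p1 Cp0 TpLp Tplin TpB' extT kerT linT d0 T1 fC).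
Qed.
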